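(* For any $\beta,\gamma\ge0$, the joint distribution of $H_I^2$ and $R_I^2$ under the Palm probability of $\mathcal V_I$ is given by the joint Laplace transform $$\mathbb E^0_{\mathcal V_I}\left[e^{-\gamma H_I^2-\beta R_I^2}\right]=\frac{2\lambda\pi}{\beta}\left[\left(1+\frac{\gamma}{\lambda\pi}\right)^{-1/2}-\left(1+\frac{\gamma+\beta}{\lambda\pi}\right)^{-1/2}\right],$$ where for $\beta=0$ the right-hand side is understood as its limit as $\beta\downarrow0$.
   Context: Model. Let $\lambda,v>0$. $\Phi=\sum_i\delta_{X_i}$ is a homogeneous Poisson point process of intensity $\lambda$ on $\mathbb R^2$ and $(\Theta_i)$ are i.i.d. uniform angles on $[-\pi,\pi)$, independent of $\Phi$. Base station (BS) $i$ is at $X_i^t=X_i+vt(\cos\Theta_i,\sin\Theta_i)$ at time $t\in\mathbb R$; $d_i(t)=\|X_i^t\|$ is its distance to the user at the origin. $T_i$ is the time at which $d_i$ is minimal and $H_i=d_i(T_i)$. The max interference point process $\mathcal V_I$ on $\mathbb R$ consists of the times $s=T_i$ such that exactly one BS $j$ satisfies $d_j(s)<H_i$. At such a time, $H_I=H_i$ (distance of the nearest interferer) and $R_I=d_j(s)$ (distance of the serving BS). Palm expectation: for a stationary point process $N$ on $\mathbb R$ with intensity $\lambda_N\in(0,\infty)$, built time-shift-compatibly from the moving configuration, $\mathbb E^0_N[f]=\lambda_N^{-1}\,\mathbb E\big[\sum_{t\in N\cap[0,1]}f_t\big]$, where $f_t$ is the quantity $f$ observed at time $t$. *)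

(* Defs.v *)
From mathcomp Require Import all_boot all_order all_algebra.
From mathcomp Require Import all_classical all_reals all_analysis.

Set Implicit Arguments.
Unset Strict Implicit.
Unset Printing Implicit Defensive.

Import Order.TTheory GRing.Theory Num.Theory.
Import numFieldNormedType.Exports.

Local Open Scope classical_set_scope.
Local Open Scope ring_scope.

(* R^2 with its Borel sigma-algebra. The library norm on a product is the max
   norm, so Euclidean distances are written out explicitly below. *)
Notation plane R := (measurableTypeR R * measurableTypeR R)%type.

Section probability_notions.
Context {d : measure_display} {T : measurableType d} {R : realType}.
Variable P : probability T R.

Definition mutually_independent {d' : measure_display} {U : measurableType d'}
    (Y : nat -> {RV P >-> U}) : Prop :=
  forall (s : seq nat) (B : nat -> set U), uniq s ->
    (forall i, measurable (B i)) ->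
    P (\bigcap_(i in [set` s]) Y i @^-1` B i) =
    (\prod_(i <- s) P (Y i @^-1` B i))%E.

Definition sigma_generated {d' : measure_display} {U : measurableType d'}
    (Y : nat -> {RV P >-> U}) : set (set T) :=
  <<s [set E | exists i B, measurable B /\ E = Y i @^-1` B] >>.

Definition independent_sequences
    {d1 d2 : measure_display} {U1 : measurableType d1} {U2 : measurableType d2}
    (Y : nat -> {RV P >-> U1}) (Z : nat -> {RV P >-> U2}) : Prop :=
  forall E F, sigma_generated Y E -> sigma_generated Z F ->
    P (E `&` F) = (P E * P F)%E.

Definition point_measure {d' : measure_display} {U : measurableType d'}
    (Y : nat -> {RV P >-> U}) (w : T) : set U -> \bar R :=
  mseries (fun i => \d_(Y i w)) 0.

(* The Poisson weights are written out because the library's [poisson_pmf] is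
   identically 1 at rate 0, the rate of a Lebesgue-null set. *)
Definition poisson_process (lam : R) (X : nat -> {RV P >-> plane R}) : Prop :=
  let area := (@lebesgue_measure R \x @lebesgue_measure R)%E in
  forall (k : nat) (B : 'I_k -> set (plane R)) (n : 'I_k -> nat),
    (forall l, measurable (B l)) -> (forall l, (area (B l) < +oo)%E) ->
    trivIset setT B ->
    P [set w | forall l, point_measure X w (B l) = (n l)%:R%:E] =
    (\prod_l (let m := lam * fine (area (B l)) in
              expR (- m) * m ^+ n l / (n l)`!%:R))%:E.

(* A point process on the line is given by its random set of atoms, so it is
   simple. [palm_expectation] is meant for a stationary [N] of positive finite
   intensity and for a nonnegative [f]: [\esum] is the sum of a nonnegative
   family over an arbitrary set. *)
Definition intensity (N : T -> set R) : \bar R :=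
  (\int[P]_w \esum_(t in N w `&` `[0%R, 1%R]) 1)%E.

Definition palm_expectation (N : T -> set R) (f : T -> R -> R) : \bar R :=
  ((intensity N)^-1 *
   \int[P]_w \esum_(t in N w `&` `[0%R, 1%R]) (f w t)%:E)%E.

End probability_notions.

(* One realization of the network: [x i] and [th i] are the position at time 0
   and the direction of motion of base station [i]. *)
Section configuration.
Context {R : realType}.
Variables (v : R) (x : nat -> plane R) (th : nat -> R).

Definition bs_pos (i : nat) (t : R) : R * R :=
  ((x i).1 + v * t * cos (th i), (x i).2 + v * t * sin (th i)).

Definition bs_dist (i : nat) (t : R) : R :=
  Num.sqrt ((bs_pos i t).1 ^+ 2 + (bs_pos i t).2 ^+ 2).

(* [xget] selects an element of a set; for v > 0 this one is a singleton. *)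
Definition bs_mintime (i : nat) : R :=
  xget 0 [set t | forall u, bs_dist i t <= bs_dist i u].

Definition bs_mindist (i : nat) : R := bs_dist i (bs_mintime i).

(* Station [i] is at its minimal distance at time [s], and [j] is the only
   station that is then strictly closer to the user. *)
Definition max_interference (i j : nat) (s : R) : Prop :=
  s = bs_mintime i /\ unique (fun k => bs_dist k s < bs_mindist i) j.

Definition max_interference_times : set R :=
  [set s | exists i j, max_interference i j s].

(* For [s] in [max_interference_times] the sets below are singletons, even if
   several stations reach their minimal distance at time [s]: two admissible
   interferers must be at the same distance, hence have the same server. *)
Definition interferer_dist (s : R) : R :=
  xget 0 [set h | exists i j, max_interference i j s /\ h = bs_mindist i].

Definition server_dist (s : R) : R :=
  xget 0 [set r | exists i j, max_interference i j s /\ r = bs_dist j s].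

End configuration.

Lemma ltNpi_pi (R : realType) : - pi < pi :> R.
Proof. by rewrite gtrN // pi_gt0. Qed.

(* [X i] and [Theta i] are the initial position and the angle of station [i];
   the uniform law charges neither endpoint, so [-pi, pi] and [-pi, pi[ are
   interchangeable. The angles are independent of the whole sequence of atoms
   and not merely of the measure it induces: otherwise the enumeration of the
   atoms could depend on the angles. *)
Record mobile_network {d : measure_display} {T : measurableType d}
    {R : realType} (P : probability T R) (lam : R)
    (X : nat -> {RV P >-> plane R})
    (Theta : nat -> {RV P >-> measurableTypeR R}) : Prop := MobileNetwork {
  network_poisson : poisson_process lam X ;
  network_uniform : forall (i : nat) (A : set (measurableTypeR R)),
    measurable A ->
    distribution P (Theta i) A = uniform_prob (ltNpi_pi R) A ;
  network_angles_indep : mutually_independent Theta ;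
  network_indep : independent_sequences X Theta }.

Section network.
Context {d : measure_display} {T : measurableType d} {R : realType}.
Variables (P : probability T R) (v : R) (X : nat -> {RV P >-> plane R})
  (Theta : nat -> {RV P >-> measurableTypeR R}).

Definition VI (w : T) : set R := max_interference_times v (X ^~ w) (Theta ^~ w).
Definition HI (w : T) : R -> R := interferer_dist v (X ^~ w) (Theta ^~ w).
Definition RI (w : T) : R -> R := server_dist v (X ^~ w) (Theta ^~ w).

End network.

Definition laplace_HR {R : realType} (lam gamma beta : R) : R :=
  2 * lam * pi / beta *
  ((1 + gamma / (lam * pi)) `^ (- 2^-1) -
   (1 + (gamma + beta) / (lam * pi)) `^ (- 2^-1)).

(* Main.v *)
Require Import Defs.
From HB Require Import structures.
From mathcomp Require Import all_boot all_order all_algebra.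
From mathcomp Require Import all_classical all_reals all_analysis.
From mathcomp Require Import measurable_realfun ring lra.
Set Implicit Arguments.
Unset Strict Implicit.
Unset Printing Implicit Defensive.
Import Order.TTheory GRing.Theory Num.Theory.
Import numFieldNormedType.Exports.
Local Open Scope classical_set_scope.
Local Open Scope ring_scope.

(** Why the formula holds. Seen in axes turned along its direction of motion, a
    station moves uniformly along the first axis, so its squared distance to the
    user at time t is [(v (t - arrival))^2 + across^2]: the minimum is attained at
    time [arrival] and equals [|across|]. For a fixed angle, (along, across) is a
    rotation of the initial position and [arrival] is [- along / v], so the pairs
    (arrival, |across|) form a Poisson process of intensity [2 lam v dt dh] on the
    half-plane h > 0, whatever the law of the angles. Given a station with minimum
    (t, h), the other ones are distributed as before; the disc of radius h around
    the user contains exactly one of them at time t with probability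
    [lam pi h^2 exp (- lam pi h^2)], and that one, the server, is uniform in the
    disc. The mean of the sum of [exp (- gamma HI^2 - beta RI^2)] over the atoms
    in [0, 1] is therefore

      [2 lam v int_0^oo exp (- gamma h^2) lam pi (int_0^(h^2) exp (- beta s) ds)
          exp (- lam pi h^2) dh].

    The inner integral is [(1 - exp (- beta h^2)) / beta], so this is a difference
    of two Gaussian integrals divided by beta. Its quotient by the same quantity
    at beta = gamma = 0, which is the intensity, is the announced formula.

    The heuristic conditioning on a station is replaced by a computation with
    Laplace functionals. [laplace_functional] evaluates the mean of a product
    over all stations of a function of position and angle; it comes from the
    Poisson counts on the level sets of a step function, after the angles have
    been averaged out one by one. [cell_formula] then takes a mixed second
    derivative of these functionals: for disjoint sets C and A of marked points it
    gives the mean of the number of points in C times the value of a function at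
    the only point of A. The window of pairs (arrival, |across|) is cut into
    small cells. Within one cell every interferer is treated as if its minimum
    were the lower corner (t, h) of the cell, C being the cell and A the set of
    stations closer than h at time t. When the mesh tends to 0 the sum over the
    cells converges almost surely ([grid_total_cvg]), because two stations are
    almost surely never tied at the minimum of one of them ([ae_no_tie]), and its
    mean is a Riemann sum of the integral above ([mean_window_total],
    [mean_total]).

    It remains to read the sum over random times as a sum over stations:
    [sum_over_times] does so on the almost sure event [generic]. The sum over
    times is an arbitrary function of the outcome as far as measurability is
    concerned, and [ae_eq_integral_nonmeasurable] allows its integral to be
    computed nevertheless. *)

(** * Area-preserving maps of the plane *)

Section plane_measure.
Context {R : realType}.
Local Notation leb := (@lebesgue_measure R).
Local Notation area := (leb \x leb)%E.

Lemma lebesgue_affine (a c : R) (B : set (measurableTypeR R)) : 0 < a ->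
  measurable B ->
  leb ((fun x : measurableTypeR R => a * x + c : measurableTypeR R) @^-1` B) = (a^-1%:E * leb B)%E.
Proof.
move=> a0 mB.
pose phi := fun x : measurableTypeR R => a * x + c : measurableTypeR R.
have mphi : measurable_fun setT phi.
  by apply: measurable_funD => //; apply: measurable_funM.
have a0' : 0 <= a by exact: ltW.
have E : leb B = (a%:E * leb (phi @^-1` B))%E.
  have := @lebesgue_measure_unique R (mscale (NngNum a0') (pushforward leb phi)).
  apply => //= _ [[u w]] _ <-.
  rewrite /mscale/= /pushforward.
  have -> : phi @^-1` `]u, w] = `](u - c)/a, (w-c)/a]%classic.
    by apply/seteqP; split => x /=; rewrite /phi !in_itv/= ltr_pdivrMr// ler_pdivlMr// => /andP[h1 h2]; apply/andP; split; lra.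
  rewrite !lebesgue_measure_itv/= !lte_fin ltr_pM2r ?invr_gt0// ltrD2r.
  case: ifPn => _; last by rewrite mule0.
  by rewrite -!EFinB -EFinM; congr EFin; field; lra.
by rewrite E muleA -EFinM mulVf ?mul1e// gt_eqF.
Qed.

Definition area_preserving (phi : plane R -> plane R) :=
  measurable_fun setT phi /\
  forall B, measurable B -> area (phi @^-1` B) = area B.

Lemma area_preserving_comp phi psi : area_preserving phi -> area_preserving psi ->
  area_preserving (phi \o psi).
Proof.
move=> [m1 e1] [m2 e2]; split; first exact: measurableT_comp.
move=> B mB; rewrite comp_preimage e2 ?e1// -[X in measurable X]setTI.
exact: m1.
Qed.

Lemma area_preserving_integral phi f : area_preserving phi ->
  measurable_fun setT f -> (forall y, 0 <= f y)%E ->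
  (\int[area]_y f (phi y) = \int[area]_y f y)%E.
Proof.
move=> [mphi ephi] mf f0.
have -> : (\int[area]_y f y = \int[pushforward area phi]_y f y)%E.
  by apply: eq_measure_integral => A mA _; exact/esym/ephi.
by rewrite ge0_integral_pushforward.
Qed.

Lemma area_affine (a : R) (c : plane R) (B : set (plane R)) : 0 < a ->
  measurable B ->
  area ((fun x : plane R => (a * x.1 + c.1, a * x.2 + c.2) : plane R) @^-1` B) = ((a ^- 2)%:E * area B)%E.
Proof.
move=> a0 mB.
pose phi := fun x : plane R => (a * x.1 + c.1, a * x.2 + c.2) : plane R.
have mphi : measurable_fun setT phi.
  apply: measurable_fun_pair => /=; apply: measurable_funD => //;
    by apply: measurable_funM.
have a0' : 0 <= a ^+ 2 by exact: sqr_ge0.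
have E : area B = ((a ^+ 2)%:E * area (phi @^-1` B))%E.
  have := @product_measure_unique _ _ _ _ R leb leb (mscale (NngNum a0') (pushforward area phi)).
  apply => //= C D mC mD.
  rewrite /mscale/= /pushforward.
  have -> : phi @^-1` (C `*` D) =
      ((fun x : measurableTypeR R => a * x + c.1 : measurableTypeR R) @^-1` C) `*`
      ((fun x : measurableTypeR R => a * x + c.2 : measurableTypeR R) @^-1` D) by [].
  have mA1 (c' : R) (A : set (measurableTypeR R)) : measurable A ->
      measurable ((fun x : measurableTypeR R => a * x + c' : measurableTypeR R) @^-1` A).
    move=> mA; rewrite -[X in measurable X]setTI.
    suff : measurable_fun setT (fun x : measurableTypeR R => a * x + c' : measurableTypeR R) by apply.
    by apply: measurable_funD => //; apply: measurable_funM.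
  transitivity ((a ^+ 2)%:E * ((a^-1%:E * leb C) * (a^-1%:E * leb D)))%E.
    congr (_ * _)%E; rewrite -(lebesgue_affine c.1 a0 mC) -(lebesgue_affine c.2 a0 mD).
    exact: product_measure1E (mA1 _ _ mC) (mA1 _ _ mD).
  have e1 : 1%E = ((a ^+ 2)%:E * (a^-1%:E * a^-1%:E))%E :> \bar R.
    by rewrite -!EFinM; congr EFin; field; lra.
  transitivity (1 * (leb C * leb D))%E; last by rewrite mul1e.
  by rewrite muleACA [LHS]muleA; congr (_ * _)%E; exact: esym e1.
rewrite E muleA -EFinM mulVf ?mul1e//.
by rewrite expf_neq0// gt_eqF.
Qed.

Lemma area_preserving_translation (c : plane R) :
  area_preserving (fun x => (x.1 + c.1, x.2 + c.2)).
Proof.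
split; first by apply: measurable_fun_pair => /=; apply: measurable_funD.
move=> B mB; have := area_affine c (@ltr01 R) mB.
rewrite expr1n invr1 mul1e => <-; congr (area _).
by apply/funext => x /=; rewrite !mul1r.
Qed.

(** Tonelli: each section at a fixed first coordinate is translated. *)
Lemma shear_second (a : R) : area_preserving (fun x => (x.1, x.2 + a * x.1)).
Proof.
split.
  apply: measurable_fun_pair => //=; apply: measurable_funD => //.
  by apply: measurable_funM.
move=> B mB.
rewrite /product_measure1; apply: eq_integral => x _ /=.
have -> : xsection ((fun x0 : R * R => (x0.1, x0.2 + a * x0.1)) @^-1` B) x =
  (fun y : measurableTypeR R => 1 * y + a * x : measurableTypeR R) @^-1` xsection B x.
  by apply/seteqP; split => y /=; rewrite /xsection/= !inE/= mul1r.
rewrite lebesgue_affine ?invr1 ?mul1e//.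
exact: measurable_xsection.
Qed.

Lemma swap_area : area_preserving (fun x => (x.2, x.1)).
Proof.
pose phi := fun x : plane R => (x.2, x.1) : plane R.
have mphi : measurable_fun setT phi by exact: measurable_fun_pair.
split=> // B mB.
have := @product_measure_unique _ _ _ _ R leb leb (pushforward area phi).
move=> H; apply/esym; apply: H => //= C D mC mD; rewrite /pushforward.
have -> : phi @^-1` (C `*` D) = D `*` C.
  by apply/seteqP; split => -[x y] /= [].
by rewrite product_measure1E// muleC.
Qed.

Lemma shear_first (a : R) : area_preserving (fun x => (x.1 + a * x.2, x.2)).
Proof.
exact: (area_preserving_comp swap_area (area_preserving_comp (shear_second a) swap_area)).
Qed.

(** A rotation with nonzero sine is a product of three shears, the outer ones with
    ratio the tangent [t] of the half angle; the identity and the half turn are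
    products of two quarter turns. *)
Lemma rotation_area (a b : R) : a ^+ 2 + b ^+ 2 = 1 ->
  area_preserving (fun x => (a * x.1 + b * x.2, a * x.2 - b * x.1)).
Proof.
have H c d : c ^+ 2 + d ^+ 2 = 1 -> d != 0 ->
    area_preserving (fun x => (c * x.1 + d * x.2, c * x.2 - d * x.1)).
  move=> cd d0; pose t := (1 - c) / d.
  have := area_preserving_comp (shear_first t) (area_preserving_comp (shear_second (- d)) (shear_first t)).
  congr area_preserving; apply/funext => -[x y] /=; rewrite /t.
  have c2 : c ^+ 2 = 1 - d ^+ 2 by rewrite -cd addrK.
  by congr pair; [field : c2|field].
move=> ab; have [b0|] := eqVneq b 0; last exact: H.
have a0 : a != 0.
  apply/eqP => a0; move: ab; rewrite a0 b0 !expr0n/= addr0 => /eqP.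
  by rewrite eq_sym oner_eq0.
have H1 : area_preserving (fun x => (0 * x.1 + 1 * x.2, 0 * x.2 - 1 * x.1)).
  by apply: H; rewrite ?oner_neq0// expr0n/= add0r expr1n.
have H2 : area_preserving (fun x => (b * x.1 + (- a) * x.2, b * x.2 - (- a) * x.1)).
  by apply: H; rewrite ?oppr_eq0// sqrrN addrC.
have := area_preserving_comp H1 H2.
by congr area_preserving; apply/funext => -[x y] /=; congr pair; ring.
Qed.
End plane_measure.

(** * Radial integrals in the plane *)

Section polar.
Context {R : realType}.
Local Notation leb := (@lebesgue_measure R).
Local Notation area := (leb \x leb)%E.

Lemma areaX (A B : set (measurableTypeR R)) : measurable A -> measurable B ->
  area (A `*` B) = (leb A * leb B)%E.
Proof. by move=> mA mB; exact: product_measure1E. Qed.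

Definition normsq (y : plane R) : R := y.1 ^+ 2 + y.2 ^+ 2.

Lemma measurable_normsq : measurable_fun setT (normsq : plane R -> measurableTypeR R).
Proof. by apply: measurable_funD; apply: measurable_funX. Qed.

Lemma normsq_ge0 y : 0 <= normsq y.
Proof. by rewrite addr_ge0// sqr_ge0. Qed.

(** Indexed by the square of the radius, so that the area is linear in [s]. *)
Definition disc (s : R) : set (plane R) := [set y | normsq y < s].

Lemma measurable_disc s : measurable (disc s).
Proof.
have := measurable_normsq; move=> /(_ measurableT `]-oo, s[%classic (measurable_itv _)).
by rewrite setTI; congr measurable; apply/seteqP; split => y /=; rewrite in_itv.
Qed.

Lemma area_disc_scale s : 0 < s ->
  area (disc s) = (s%:E * area (disc 1))%E.
Proof.
move=> s0; have a0 : 0 < (Num.sqrt s)^-1 by rewrite invr_gt0 sqrtr_gt0.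
have := area_affine (0, 0) a0 (measurable_disc 1).
have -> : (fun x : plane R => ((Num.sqrt s)^-1 * x.1 + (0 : measurableTypeR R, 0 : measurableTypeR R).1,
    (Num.sqrt s)^-1 * x.2 + (0: measurableTypeR R, 0: measurableTypeR R).2) : plane R) @^-1`
     (disc 1) = (disc s).
  apply/seteqP; split => -[x y] /=; rewrite /disc/= /normsq/= !addr0 !exprMn -mulrDr exprVn;
  by rewrite sqr_sqrtr ?ltW// mulrC ltr_pdivrMr// mul1r.
by move=> ->; rewrite exprVn invrK sqr_sqrtr// ltW.
Qed.

Lemma area_disc_fin : (area (disc 1) < +oo)%E.
Proof.
apply: (@le_lt_trans _ _ (area (`[-1, 1] `*` `[-1, 1]))).
  apply: le_measure; rewrite ?inE//=.
  - exact: measurable_disc.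
  - exact: measurableX.
  move=> [x y]; rewrite /disc/= /normsq/= => xy1.
  have := sqr_ge0 x; have := sqr_ge0 y => x2 y2.
  rewrite !in_itv/= -!ler_norml.
  by split; rewrite -(ler_pXn2r (n := 2)) ?nnegrE// ?expr1n ?real_normK ?num_real//; lra.
rewrite areaX// !lebesgue_measure_itv/= !lte_fin.
by rewrite ifT; [rewrite -EFinB -EFinM ltry|lra].
Qed.

(** By scaling, the image of the area under [normsq] and a multiple of the Lebesgue
    measure agree on the half-lines, which determine a measure. *)
Lemma area_normsq_preimage (c := fine (area (disc 1))) (A : set (measurableTypeR R)) :
  measurable A -> A `<=` `[0, +oo[ -> area (normsq @^-1` A) = (c%:E * leb A)%E.
Proof.
have c0 : 0 <= c by exact: fine_ge0.
have cE : c%:E = area (disc 1).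
  by rewrite fineK// ge0_fin_numE ?area_disc_fin.
move=> mA A0.
have m0y : measurable (`[0, +oo[ : set (measurableTypeR R)) by exact: measurable_itv.
pose m2 := mscale (NngNum c0) (mrestr leb m0y).
have -> : (c%:E * leb A)%E = m2 A.
  by rewrite /m2 /mscale /= /mrestr setIidl.
pose ns : plane R -> measurableTypeR R := normsq.
have mns : measurable_fun setT ns := measurable_normsq.
have := @measure_unique _ R (measurableTypeR R) (@RGenInftyO.G R) (fun k => `]-oo, k%:R[%classic)
  (RGenInftyO.measurableE R) _ _ _ (pushforward area ns) m2.
apply => //=.
- move=> _ _ [x ->] [y ->]; exists (Num.min x y).
  by apply/seteqP; split => z /=; rewrite !in_itv/= lt_min => /andP.
- by move=> i; exists i%:R.
- apply/seteqP; split => // x _; exists (Num.bound `|x|) => //=.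
  by rewrite in_itv/= (le_lt_trans (ler_norm x))//; exact: (@archi_boundP R).
- move=> _ [w ->].
  transitivity (c%:E * leb (`]-oo, w[ `&` `[0%R, +oo[))%E; last by [].
  rewrite /pushforward.
  have -> : normsq @^-1` `]-oo, w[ = (disc w).
    by apply/seteqP; split => y /=; rewrite in_itv.
  have [w0|w0] := ltP 0 w; last first.
    have -> : disc w = set0.
      by apply/seteqP; split => y //; have := normsq_ge0 y; rewrite /disc/=; lra.
    rewrite measure0 [X in leb X](_ : _ = set0); first by rewrite measure0 mule0.
    by apply/seteqP; split => y //=; rewrite !in_itv/= andbT => -[]; lra.
  rewrite area_disc_scale// cE muleC; congr (_ * _)%E.
  rewrite [X in leb X](_ : _ = `[0, w[%classic).
    by rewrite lebesgue_measure_itv/= lte_fin w0 sube0.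
  by apply/seteqP; split => y /=; rewrite !in_itv/= andbT; [case=> -> ->|case/andP].
- move=> k.
  have -> : pushforward area ns `]-oo, k%:R[ = area (disc k%:R).
    rewrite /pushforward; suff -> : ns @^-1` `]-oo, k%:R[ = disc k%:R by [].
    by apply/seteqP; split => y /=; rewrite /disc in_itv.
  case: k => [|k].
    rewrite (_ : disc _ = set0) ?measure0//.
    by apply/seteqP; split => y //; have := normsq_ge0 y; rewrite /disc/=; lra.
  by rewrite area_disc_scale ?ltr0n// -cE -EFinM ltry.
Qed.

Lemma polar_integral_disc (c := fine (area (disc 1))) (f : measurableTypeR R -> \bar R) :
  measurable_fun setT f -> (forall s, 0 <= f s)%E ->
  (\int[area]_y f (normsq y) = c%:E * \int[leb]_(s in `[0%R, +oo[) f s)%E.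
Proof.
move=> mf f0.
have c0 : 0 <= c by exact: fine_ge0.
have m0y : measurable (`[0, +oo[ : set (measurableTypeR R)) by exact: measurable_itv.
pose ns : plane R -> measurableTypeR R := normsq.
have mns : measurable_fun setT ns := measurable_normsq.
rewrite -(@ge0_integral_mscale _ _ R leb _ _ (NngNum c0))//; last exact: measurable_funTS.
transitivity (\int[pushforward area ns]_(s in `[0%R, +oo[) f s)%E; last first.
  by apply: eq_measure_integral => A mA A0; exact: area_normsq_preimage.
rewrite ge0_integral_pushforward//; last exact: measurable_funTS.
rewrite (_ : normsq @^-1` _ = setT)//.
by apply/seteqP; split => y //= _; rewrite in_itv/= normsq_ge0.
Qed.

(** The constant of [polar_integral_disc] is found by integrating [exp (- |y|^2)] over
    the plane: radially this gives the area of the unit disc, and as a product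
    it is the square of the Gauss integral. *)
Lemma area_unit_disc : area (disc 1) = pi%:E.
Proof.
rewrite -[LHS]fineK ?ge0_fin_numE ?area_disc_fin//.
have me : measurable_fun setT (fun s : measurableTypeR R => (expR (- s))%:E).
  by apply/measurable_EFinP; apply: measurableT_comp => //; exact: measurable_funN.
have e0 (s : R) : (0 <= (expR (- s))%:E)%E by rewrite lee_fin expR_ge0.
have := polar_integral_disc me e0.
have -> : (\int[leb]_(s in `[0%R, +oo[) (expR (- s))%:E = 1)%E.
  have := @integral_exponential_pdf R 1 ltr01.
  rewrite /exponential_pdf => <-; rewrite [LHS]integral_mkcond.
  by apply: eq_integral => x _; rewrite !patchE; case: ifP => //= _; rewrite mul1r mulN1r.
rewrite mule1 => <-.
rewrite fubini_tonelli1//=; last first.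
  exact: (measurableT_comp me measurable_normsq).
have mg : measurable_fun setT (fun y : measurableTypeR R => (gauss_fun y)%:E).
  by apply/measurable_EFinP; exact: measurable_gauss_fun.
have g0 (y : R) : (0 <= (gauss_fun y)%:E)%E by rewrite lee_fin expR_ge0.
transitivity (\int[leb]_x ((gauss_fun x)%:E * \int[leb]_y (gauss_fun y)%:E))%E.
  apply: eq_integral => x _; rewrite -ge0_integralZl//.
  by apply: eq_integral => y _; rewrite -EFinM -expRD /normsq/= opprD.
rewrite ge0_integralZr//.
  by rewrite integralT_gauss -EFinM -expr2 sqr_sqrtr ?pi_ge0.
exact: integral_ge0.
Qed.

Lemma area_disc_fin_nat (N : nat) : (area (disc N%:R) < +oo)%E.
Proof.
case: N => [|N].
  rewrite (_ : disc _ = set0) ?measure0//.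
  by apply/seteqP; split => y //; rewrite /disc/= ltNge normsq_ge0.
by rewrite area_disc_scale ?ltr0n// area_unit_disc -EFinM ltry.
Qed.

Lemma polar_integral (f : measurableTypeR R -> \bar R) :
  measurable_fun setT f -> (forall s, 0 <= f s)%E ->
  (\int[area]_y f (normsq y) = pi%:E * \int[leb]_(s in `[0%R, +oo[) f s)%E.
Proof. by move=> mf f0; rewrite polar_integral_disc// area_unit_disc. Qed.
End polar.

(** * Exchange of integrals with the area *)

Section area_sigma_finite.
Context {R : realType}.
Local Notation leb := (@lebesgue_measure R).
Local Notation area := (leb \x leb)%E.

Lemma area_sigma_finite : sigma_finite setT area.
Proof.
have b x : exists n : nat, `|x : R| < n%:R by exists (Num.bound `|x|); exact: (@archi_boundP R).
exists (fun n : nat => `[- n%:R, n%:R] `*` `[- n%:R, n%:R]).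
  apply/seteqP; split => // -[x y] _; have [[n xn] [m yn]] := (b x, b y).
  exists (maxn n m) => //=; rewrite !in_itv/= -!ler_norml; split.
    by rewrite (le_trans (ltW xn))// ler_nat leq_maxl.
  by rewrite (le_trans (ltW yn))// ler_nat leq_maxr.
move=> n; split; first exact: measurableX.
rewrite areaX// !lebesgue_measure_itv/= !lte_fin.
by case: ifP => _; rewrite ?mul0e// -EFinB -EFinM ltry.
Qed.

(** The area with its sigma-finiteness bundled, as the exchange of integrals takes it. *)
Definition sigma_finite_area : {sigma_finite_measure set (plane R) -> \bar R} :=
  HB.pack area (Measure_isSigmaFinite.Build _ _ _ area area_sigma_finite).

Lemma area_fubini {d2} {V : measurableType d2} (mu : {sigma_finite_measure set V -> \bar R})
   (f : plane R * V -> \bar R) :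
  measurable_fun setT f -> (forall z, 0 <= f z)%E ->
 (\int[area]_x \int[mu]_a f (x, a) = \int[mu]_a \int[area]_x f (x, a))%E.
Proof. by move=> mf f0; exact: (@fubini_tonelli _ _ (plane R) V R sigma_finite_area mu f mf f0). Qed.
End area_sigma_finite.

(** * Averaging out an independent variable *)

Section indep.
Local Open Scope ereal_scope.
Context {d : measure_display} {T : measurableType d} {R : realType}.
Variable P : probability T R.

Lemma indep_integral {d1 : measure_display} {V : measurableType d1}
    {d2 : measure_display} {W : measurableType d2}
    (Y : {RV P >-> V}) (Z : T -> W) (mu : probability W R)
    (f : V * W -> \bar R) :
  measurable_fun setT Z ->
  (forall A B, measurable A -> measurable B ->
    P (Y @^-1` A `&` Z @^-1` B) = P (Y @^-1` A) * mu B) ->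
  measurable_fun setT f -> (forall y, 0 <= f y) ->
  \int[P]_w f (Y w, Z w) = \int[P]_w \int[mu]_z f (Y w, z).
Proof.
move=> mZ ind mf f0.
have mY : measurable_fun setT Y by [].
pose YZ := fun w => (Y w, Z w) : V * W.
have mYZ : measurable_fun setT YZ by exact: measurable_fun_pair.
transitivity (\int[pushforward P YZ]_y f y).
  by rewrite ge0_integral_pushforward.
transitivity (\int[distribution P Y \x mu]_y f y).
  apply: eq_measure_integral => A mA _; apply/esym.
  by have := @product_measure_unique _ _ _ _ R (distribution P Y) mu (pushforward P YZ); apply => //= C D mC mD; rewrite /pushforward -ind.
rewrite fubini_tonelli1// ge0_integral_pushforward//.
  exact: measurable_fun_fubini_tonelli_F.
by move=> y _; exact: integral_ge0.
Qed.

Lemma pi_system_indep (G : set (set T)) (F : set T) :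
  G `<=` measurable -> setI_closed G -> G setT -> measurable F ->
  (forall E, G E -> P (E `&` F) = P E * P F) ->
  forall E, <<s G >> E -> P (E `&` F) = P E * P F.
Proof.
move=> Gm GI GT mF GF E sE.
have PF0 : (0 <= fine (P F))%R by exact: fine_ge0.
have PFE : (fine (P F))%:E = P F by rewrite fineK// fin_num_measure.
have := @g_sigma_algebra_measure_unique _ R T G Gm (fun=> setT) (fun=> GT) _
  (mrestr P mF) (mscale (NngNum PF0) P) GI.
move=> /(_ _ _ _ E sE).
rewrite /mrestr/= /mscale/= PFE muleC; apply => //.
- by apply/seteqP; split => // x _; exists 0%N.
- by move=> A GA; exact: etrans (GF A GA) (muleC _ _).
- move=> _; apply: (@le_lt_trans _ _ 1); last exact: ltry.
  by apply: probability_le1; exact: measurableI.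
Qed.

(** The identity, seen as a variable with values in [T] equipped with the
    sigma-algebra generated by [G], is a random variable independent of [Z]. So
    [f] may depend on anything known to [G], infinitely many variables included. *)
Lemma subalgebra_indep_integral (G : set (set T))
    {d2 : measure_display} {W : measurableType d2}
    (Z : T -> W) (mu : probability W R)
    (f : g_sigma_algebraType G * W -> \bar R) :
  G `<=` measurable -> setI_closed G -> G setT ->
  measurable_fun setT Z ->
  (forall E B, G E -> measurable B ->
    P (E `&` Z @^-1` B) = P E * mu B) ->
  measurable_fun setT f -> (forall y, 0 <= f y) ->
  \int[P]_w f (w, Z w) = \int[P]_w \int[mu]_z f (w, z).
Proof.
move=> Gm GI GT mZ ind mf f0.
pose Y0 : T -> g_sigma_algebraType G := id.
have mY0 : measurable_fun setT Y0.
  move=> _ A sA; rewrite setTI.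
  by apply: (smallest_sub (@sigma_algebra_measurable _ T) Gm).
pose Y : {RV P >-> g_sigma_algebraType G} := HB.pack Y0 (isMeasurableFun.Build _ _ _ _ _ mY0).
have := @indep_integral _ _ _ _ Y Z mu f mZ _ mf f0.
apply => A B mA mB.
have mZB : measurable (Z @^-1` B) by rewrite -[X in measurable X]setTI; exact: mZ.
have PZ : P (Z @^-1` B) = mu B.
  by have := ind setT B GT mB; rewrite setTI probability_setT mul1e.
rewrite -PZ; apply: (@pi_system_indep G) => //.
by move=> E GE; rewrite ind// PZ.
Qed.
End indep.

(** * Averaging out the angles *)

Section angle_averaging.
Local Open Scope ereal_scope.
Context {d : measure_display} {T : measurableType d} {R : realType}.
Variables (P : probability T R) (lam : R) (X : nat -> {RV P >-> plane R})
    (Theta : nat -> {RV P >-> measurableTypeR R}).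
Hypothesis net : mobile_network lam X Theta.
Local Notation U := (uniform_prob (ltNpi_pi R)).

(** A pi-system that generates the information carried by all the positions and by
    the angles of the stations in [s]. *)
Definition known (s : seq nat) : set (set T) :=
  [set A | exists E B, [/\ sigma_generated X E, forall i, measurable (B i) &
    A = E `&` \bigcap_(i in [set` s]) Theta i @^-1` B i]].

Lemma sigma_generated_measurable {d'} {V : measurableType d'} (Y : nat -> {RV P >-> V}) :
  sigma_generated Y `<=` measurable.
Proof.
apply: smallest_sub; first exact: sigma_algebra_measurable.
by move=> _ [i [B [mB ->]]]; rewrite -[X in measurable X]setTI; exact: measurable_funP.
Qed.

Lemma known_measurable s : known s `<=` measurable.
Proof.
move=> _ [E [B [sE mB ->]]]; apply: measurableI.
  exact: sigma_generated_measurable sE.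
apply: fin_bigcap_measurable => // i _.
by rewrite -[X in measurable X]setTI; exact: measurable_funP.
Qed.

Lemma known_setI s : setI_closed (known s).
Proof.
move=> _ _ [E [B [sE mB ->]]] [E' [B' [sE' mB' ->]]].
exists (E `&` E'), (fun i => B i `&` B' i); split.
- exact: (@measurableI _ (g_sigma_algebraType _)).
- by move=> i; exact: measurableI.
- rewrite setIACA; congr (_ `&` _); apply/seteqP; split => w.
    by move=> [h1 h2] i si; split; [exact: h1|exact: h2].
  by move=> h; split=> i si; have [] := h i si.
Qed.

Lemma known_setT s : known s setT.
Proof.
exists setT, (fun=> setT); split => //.
  exact: (@measurableT _ (g_sigma_algebraType _)).
by rewrite setTI; apply/seteqP; split.
Qed.

(** The events on positions and on angles factor by independence of the two
    sequences, and the angles by mutual independence, applied to [s] and to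
    [j :: s]. *)
Lemma known_indep s j E B : uniq s -> j \notin s -> known s E -> measurable B ->
  P (E `&` Theta j @^-1` B) = P E * U B.
Proof.
move=> us js [F [C [sF mC ->]]] mB.
have sG (u : seq nat) (D : nat -> set (measurableTypeR R)) : (forall i, measurable (D i)) ->
    sigma_generated Theta (\bigcap_(i in [set` u]) Theta i @^-1` D i).
  move=> mD; apply: (@fin_bigcap_measurable _ (g_sigma_algebraType _)) => // i _.
  by apply: sub_sigma_algebra; exists i, (D i).
have [_ net2 net3 net4] := net.
pose C' i := if i == j then B else C i.
have mC' i : measurable (C' i) by rewrite /C'; case: ifP.
have e1 : P (F `&` \bigcap_(i in [set` s]) Theta i @^-1` C i) =
    P F * \prod_(i <- s) P (Theta i @^-1` C i).
  by apply: etrans (net4 F _ sF (sG s C mC)) _; congr (_ * _); exact: net3.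
have e2 : P (F `&` \bigcap_(i in [set` j :: s]) Theta i @^-1` C' i) =
    P F * \prod_(i <- j :: s) P (Theta i @^-1` C' i).
  apply: etrans (net4 F _ sF (sG (j :: s) C' mC')) _; congr (_ * _).
  by apply: net3 => //=; rewrite js.
rewrite e1 -setIA [X in _ `&` X](_ : _ = \bigcap_(i in [set` j :: s]) Theta i @^-1` C' i).
  rewrite e2 big_cons -muleA; congr (_ * _); rewrite muleC; congr (_ * _).
    apply: eq_big_seq => i si; rewrite /C' ifF//.
    by apply/negbTE; apply: contraNneq js => <-.
  by rewrite /C' eqxx; exact: net2.
apply/seteqP; split => w /=.
  move=> [h1 h2] i /=; rewrite inE => /orP[/eqP ->|si]; first by rewrite /C' eqxx.
  rewrite /C' ifF; first exact: h1.
  by apply/negbTE; apply: contraNneq js => <-.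
move=> h; split => [i /= si|].
  have := h i; rewrite /= inE si orbT /C' ifF; first exact.
  by apply/negbTE; apply: contraNneq js => <-.
by have := h j; rewrite /= inE eqxx /C' eqxx; exact.
Qed.

Lemma known_X s i : measurable_fun setT (X i : g_sigma_algebraType (known s) -> plane R).
Proof.
move=> _ B mB; rewrite setTI; apply: sub_sigma_algebra.
exists (X i @^-1` B), (fun=> setT); split => //.
  by apply: sub_sigma_algebra; exists i, B.
by rewrite [X in _ `&` X](_ : _ = setT) ?setIT//; apply/seteqP; split.
Qed.

Lemma known_Theta s i : i \in s ->
  measurable_fun setT (Theta i : g_sigma_algebraType (known s) -> measurableTypeR R).
Proof.
move=> si _ B mB; rewrite setTI; apply: sub_sigma_algebra.
exists setT, (fun k => if k == i then B else setT); split => //.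
- exact: (@measurableT _ (g_sigma_algebraType _)).
- by move=> k; case: ifP.
- rewrite setTI; apply/seteqP; split => w /=.
    by move=> Bw k _ /=; case: eqP => // ->.
  by move=> /(_ i si) /=; rewrite eqxx.
Qed.

Lemma integrate_angle s j (f : g_sigma_algebraType (known s) * measurableTypeR R -> \bar R) :
  uniq s -> j \notin s -> measurable_fun setT f -> (forall y, 0 <= f y) ->
  \int[P]_w f (w, Theta j w) = \int[P]_w \int[U]_a f (w, a).
Proof.
move=> us js mf f0.
apply: (@subalgebra_indep_integral _ _ _ P (known s) _ _ (Theta j) U f) => //.
- by move=> A; exact: known_measurable.
- by move=> A B; exact: known_setI.
- exact: known_setT.
- by move=> E B kE mB; exact: (known_indep us js kE mB).
Qed.
End angle_averaging.

Section marks.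
Context {d : measure_display} {T : measurableType d} {R : realType}.
Variables (P : probability T R) (lam : R) (X : nat -> {RV P >-> plane R})
    (Theta : nat -> {RV P >-> measurableTypeR R}).
Hypothesis net : mobile_network lam X Theta.
Local Notation U := (uniform_prob (ltNpi_pi R)).

Definition angle_mean (phi : plane R * measurableTypeR R -> R) (x : plane R) : R :=
  fine (\int[U]_a (phi (x, a))%:E).

Lemma angle_meanE (phi : plane R * measurableTypeR R -> R) (x : plane R) :
  measurable_fun setT phi -> (forall y, 0 <= phi y <= 1) ->
  (angle_mean phi x)%:E = (\int[U]_a (phi (x, a))%:E)%E /\ 0 <= angle_mean phi x <= 1.
Proof.
move=> mphi phi01.
have mx : measurable_fun setT (fun a : measurableTypeR R => (phi (x, a))%:E).
  by apply/measurable_EFinP; exact: measurableT_comp.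
have h0 : (0 <= \int[U]_a (phi (x, a))%:E)%E.
  by apply: integral_ge0 => a _; rewrite lee_fin; case/andP: (phi01 (x, a)).
have h1 : (\int[U]_a (phi (x, a))%:E <= 1)%E.
  rewrite -(@probability_setT _ _ R U) -[leRHS]mul1e -integral_cst//.
  apply: ge0_le_integral => //.
  - by move=> a _; rewrite lee_fin; case/andP: (phi01 (x, a)).
  - by move=> a _; rewrite lee_fin; case/andP: (phi01 (x, a)).
have hf : (\int[U]_a (phi (x, a))%:E)%E \is a fin_num.
  by rewrite ge0_fin_numE// (le_lt_trans h1)// ltry.
by rewrite /angle_mean fineK//; split => //; rewrite -!lee_fin fineK// h0.
Qed.

Lemma measurable_angle_mean (phi : plane R * measurableTypeR R -> R) :
  measurable_fun setT phi -> (forall y, 0 <= phi y) ->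
  measurable_fun setT (angle_mean phi).
Proof.
move=> mphi phi0.
have mf : measurable_fun setT (fun y => (phi y)%:E) by exact/measurable_EFinP.
have f0 y : (0 <= (phi y)%:E)%E by rewrite lee_fin.
have h := measurable_fun_fubini_tonelli_F (m2 := U) _ mf f0.
exact: (measurableT_comp _ h).
Qed.

(** The angles are averaged out one at a time: all positions and the earlier angles
    are frozen while the angle of station [m] is integrated, which replaces its
    factor by the mean. *)
Lemma mean_prod_marks (phi : plane R * measurableTypeR R -> R) n :
  measurable_fun setT phi -> (forall y, 0 <= phi y <= 1) ->
  (\int[P]_w (\prod_(0 <= k < n) phi (X k w, Theta k w))%:E =
   \int[P]_w (\prod_(0 <= k < n) angle_mean phi (X k w))%:E)%E.
Proof.
move=> mphi phi01.
have phi0 y : 0 <= phi y by case/andP: (phi01 y).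
have am0 x : 0 <= angle_mean phi x.
  by have [_ /andP[]] := angle_meanE x mphi phi01.
have mam : measurable_fun setT (angle_mean phi) by exact: measurable_angle_mean.
suff H m : (m <= n)%N ->
  (\int[P]_w (\prod_(0 <= k < m) phi (X k w, Theta k w) * \prod_(m <= k < n) angle_mean phi (X k w))%:E =
   \int[P]_w (\prod_(0 <= k < n) angle_mean phi (X k w))%:E)%E.
  by rewrite -(H n)//; apply: eq_integral => w _; rewrite [X in _ = (_ * X)%:E]big_geq// mulr1.
elim: m => [_|m IH mn].
  by apply: eq_integral => w _; rewrite big_geq// mul1r.
rewrite -IH 1?ltnW//.
pose s := iota 0 m.
have ms : m \notin s by rewrite mem_iota ltnn.
pose f (y : g_sigma_algebraType (known X Theta s) * measurableTypeR R) : \bar R :=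
  ((\prod_(0 <= k < m) phi (X k y.1, Theta k y.1) *
    \prod_(m.+1 <= k < n) angle_mean phi (X k y.1)) * phi (X m y.1, y.2))%:E.
have f0 y : (0 <= f y)%E.
  by rewrite /f lee_fin; apply: mulr_ge0 => //; apply: mulr_ge0; apply: prodr_ge0 => k _.
have mX k : measurable_fun setT (X k \o (fst : g_sigma_algebraType (known X Theta s) * measurableTypeR R -> _) : _ -> plane R).
  exact: (measurableT_comp (@known_X _ _ _ P X Theta s k) (@measurable_fst _ _ _ _)).
have mf : measurable_fun setT f.
  apply/measurable_EFinP; apply: measurable_funM; first apply: measurable_funM.
  - apply: measurable_prod => k; rewrite mem_index_iota /= => km.
    apply: (measurableT_comp mphi); apply: measurable_fun_pair; first exact: mX.
    have ks : k \in s by rewrite mem_iota.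
    exact: (measurableT_comp (@known_Theta _ _ _ P X Theta s k ks) (@measurable_fst _ _ _ _)).
  - by apply: measurable_prod => k _; exact: (measurableT_comp mam (mX k)).
  - by apply: (measurableT_comp mphi); apply: measurable_fun_pair; first exact: mX.
have := @integrate_angle _ _ _ _ _ _ _ net s m f (iota_uniq _ _) ms mf f0.
rewrite /f/= => E; transitivity (\int[P]_w f (w, Theta m w))%E.
  by apply: eq_integral => w _; rewrite /f/= big_nat_recr//= mulrAC.
rewrite [LHS]E; apply: eq_integral => w _.
transitivity ((\prod_(0 <= k < m) phi (X k w, Theta k w) *
    \prod_(m.+1 <= k < n) angle_mean phi (X k w))%:E * \int[U]_a (phi (X m w, a))%:E)%E.
  rewrite -ge0_integralZl//.
  - by apply/measurable_EFinP; exact: measurableT_comp.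
  - by move=> a _; rewrite lee_fin.
  - by rewrite lee_fin; apply: mulr_ge0; apply: prodr_ge0 => k _.
have [<- _] := angle_meanE (X m w) mphi phi01.
by rewrite -EFinM [X in _ = (_ * X)%:E]big_ltn//; congr EFin; rewrite -mulrA; congr (_ * _); exact: mulrC.
Qed.
End marks.

(** * Counting variables and Poisson weights *)

Section counts.
Context {d : measure_display} {T : measurableType d} {R : realType}.
Variables (P : probability T R).

Definition hits {V : Type} (B : set V) (x : nat -> V) (n : nat) : nat :=
  (\sum_(0 <= k < n) (x k \in B))%N.

Lemma point_measureE {d'} {V : measurableType d'} (Y : nat -> {RV P >-> V}) w B :
  point_measure Y w B = (\sum_(k <oo) ((Y k w \in B)%:R : R)%:E)%E.
Proof. by []. Qed.

Lemma partial_hits {V : Type} (B : set V) (x : nat -> V) n :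
  (\sum_(0 <= k < n) ((x k \in B)%:R : R)%:E)%E = (hits B x n)%:R%:E.
Proof. by rewrite sumEFin /hits natr_sum. Qed.

Lemma point_measure_hits {d'} {V : measurableType d'} (Y : nat -> {RV P >-> V}) w B M :
  (forall k, (M <= k)%N -> ~ B (Y k w)) ->
  point_measure Y w B = (hits B (Y ^~ w) M)%:R%:E.
Proof.
move=> h; rewrite point_measureE (nneseries_split 0 M); last first.
  by move=> k _; rewrite lee_fin.
rewrite add0n partial_hits eseries0 ?adde0// => k Mk _.
by rewrite memNset//; exact: h.
Qed.

(** A finite sum of zeros and ones has finitely many ones. *)
Lemma point_measure_finite {d'} {V : measurableType d'} (Y : nat -> {RV P >-> V}) w B :
  (point_measure Y w B < +oo)%E -> exists M, forall k, (M <= k)%N -> ~ B (Y k w).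
Proof.
move=> fin; apply: contrapT => h.
have {}h M : exists2 k, (M <= k)%N & B (Y k w).
  apply: contrapT => h'; apply: h; exists M => k Mk Bk; apply: h'; by exists k.
have grow n : exists K, (n <= hits B (Y ^~ w) K)%N.
  elim: n => [|n [K nK]]; first by exists 0%N.
  have [k Kk Bk] := h K; exists k.+1.
  rewrite /hits big_nat_recr//= mem_set// addn1 ltnS (leq_trans nK)//.
  by rewrite /hits (big_cat_nat (leq0n _) Kk) /= leq_addr.
have ge n : (n%:R%:E <= point_measure Y w B)%E.
  have [K nK] := grow n; rewrite point_measureE.
  apply: le_trans (nneseries_lim_ge K _); last by move=> ? _ _; rewrite lee_fin.
  by rewrite partial_hits lee_fin ler_nat.
have nn : (0 <= point_measure Y w B)%E by exact: ge 0%N.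
move: fin; rewrite ltNge => /negP; apply.
case: (point_measure Y w B) ge nn => [r| |]//= ge _.
have := ge (Num.bound `|r|); rewrite lee_fin => h1.
have := @archi_boundP R `|r| (normr_ge0 _) => h2.
by have := lt_le_trans h2 (le_trans h1 (ler_norm r)); rewrite ltxx.
Qed.

Definition pois (m : R) (n : nat) : R := expR (- m) * m ^+ n / n`!%:R.

Lemma pois_ge0 m n : 0 <= m -> 0 <= pois m n.
Proof. by move=> m0; rewrite /pois !mulr_ge0 ?expR_ge0 ?exprn_ge0. Qed.

Lemma pois_gf (m c : R) : 0 <= m -> 0 <= c ->
  (\sum_(n <oo) (c ^+ n * pois m n)%:E = (expR (- (1 - c) * m))%:E)%E.
Proof.
move=> m0 c0.
have -> : expR (- (1 - c) * m) = expR (- m) * expR (c * m).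
  by rewrite -expRD; congr expR; ring.
transitivity (\sum_(n <oo) ((expR (- m))%:E * (exp_coeff (c * m) n)%:E))%E.
  apply: eq_eseriesr => n _; rewrite -EFinM; congr EFin.
  by rewrite /pois /exp_coeff/= exprMn; ring.
rewrite nneseriesZl; last by move=> n _; rewrite lee_fin exp_coeff_ge0// mulr_ge0.
rewrite EFinM; congr (_ * _)%E; apply/cvg_lim => //.
under eq_fun do rewrite sumEFin.
apply: cvg_EFin; first by exists 0%N.
rewrite (_ : fine \o _ = series (exp_coeff (c * m))).
  exact: (is_cvg_series_exp_coeff (c * m)).
by apply/funext => n.
Qed.

Lemma pois_sum (m : R) : 0 <= m -> (\sum_(n <oo) (pois m n)%:E = 1)%E.
Proof.
move=> m0; have := pois_gf m0 (@ler01 R).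
rewrite subrr oppr0 mul0r expR0 => <-.
by apply: eq_eseriesr => n _; rewrite expr1n mul1r.
Qed.
End counts.

Section pgf.
Context {d : measure_display} {T : measurableType d} {R : realType}.
Variables (P : probability T R).

(** Induction on the number of counts, splitting the integral according to the value
    of the first one. The event [A] and the factors [a] and [b] record the counts
    already fixed; without them the statement would not be inductive. *)
Lemma pgf_independent_poisson k : forall (A : set T) (N : 'I_k -> T -> \bar R)
    (m c : 'I_k -> R) (L : T -> R) (a b : R),
  measurable A -> (forall l n, measurable [set w | N l w = n%:R%:E]) ->
  measurable_fun setT L -> (forall w, 0 <= L w) ->
  (forall l, 0 <= m l) -> (forall l, 0 <= c l) -> 0 <= a -> 0 <= b ->
  (forall n : 'I_k -> nat, P (A `&` [set w | forall l, N l w = (n l)%:R%:E]) =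
     (a * \prod_l pois (m l) (n l))%:E) ->
  (forall n w, A w -> (forall l, N l w = (n l)%:R%:E) ->
     L w = b * \prod_l c l ^+ n l) ->
  (forall l, {ae P, forall w, exists n : nat, N l w = n%:R%:E}) ->
  (\int[P]_(w in A) (L w)%:E = (a * b * \prod_l expR (- (1 - c l) * m l))%:E)%E.
Proof.
elim: k => [|k IH] A N m c L a b mA mN mL L0 m0 c0 a0 b0 PA LA aeN.
  have PAa : P A = a%:E.
    rewrite -[in LHS](setIT A) -[a]mulr1; have := PA (fun=> 0%N); rewrite big_ord0 => <-.
    by congr (P (_ `&` _)); apply/seteqP; split => // w _ [].
  rewrite big_ord0 mulr1 (eq_integral (cst b%:E)); last first.
    move=> w /[!inE] Aw; have := LA (fun=> 0%N) w Aw _.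
    by rewrite big_ord0 mulr1 => -> // -[].
  by rewrite integral_cst//= PAa -EFinM mulrC.
pose F n := A `&` [set w | N ord0 w = n%:R%:E].
have mF n : measurable (F n) by exact: measurableI.
have mUF : measurable (\bigcup_n F n) by exact: bigcupT_measurable.
have null : P (A `\` \bigcup_n F n) = 0%E.
  have [D [mD D0 sD]] := aeN ord0.
  apply: (subset_measure0 _ mD _ D0); first exact: measurableD.
  move=> w [Aw nF]; apply: sD => /= -[n wn]; apply: nF; exists n => //.
rewrite (ge0_negligible_integral _ _ _ _ null)//; last 3 first.
- exact: measurableD.
- by apply/measurable_EFinP; exact: measurable_funTS.
- by move=> w _; rewrite lee_fin.
rewrite setDD [X in integral _ X _](_ : _ = \bigcup_n F n); last first.
  by apply/setIidr => w [n _ [Aw _]].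
rewrite ge0_integral_bigcup//; last 3 first.
- by apply/measurable_EFinP; exact: measurable_funTS.
- by move=> w _; rewrite lee_fin.
- apply/trivIsetP => i j _ _ ij; apply/seteqP; split => w //= -[[_ /= wi] [_ /= wj]].
  by move: wi; rewrite wj => -[] /eqP; rewrite eqr_nat eq_sym (negbTE ij).
pose S (l : 'I_k) := lift ord0 l.
have step n : (\int[P]_(w in F n) (L w)%:E =
    ((a * pois (m ord0) n) * (b * c ord0 ^+ n) *
      \prod_l expR (- (1 - c (S l)) * m (S l)))%:E)%E.
  pose ext (n' : 'I_k -> nat) (i : 'I_k.+1) : nat :=
    if unlift ord0 i is Some j then n' j else n.
  have ext0 n' : ext n' ord0 = n by rewrite /ext unlift_none.
  have extS n' l : ext n' (S l) = n' l by rewrite /ext /S liftK.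
  apply: (IH (F n) (fun l => N (S l)) (fun l => m (S l)) (fun l => c (S l))) => //.
  - by rewrite mulr_ge0// pois_ge0.
  - by rewrite mulr_ge0// exprn_ge0.
  - move=> n'; rewrite -setIA [X in P (A `&` X)](_ : _ = [set w | forall l, N l w = (ext n' l)%:R%:E]).
      rewrite PA big_ord_recl ext0 mulrA; congr (_ * _)%:E.
      by apply: eq_bigr => l _; rewrite extS.
    apply/seteqP; split => w /=.
      move=> [w0 wS] l; case: (unliftP ord0 l) => [j ->|->]; last by rewrite ext0.
      by rewrite extS wS.
    by move=> h; split => [|l]; [rewrite h ext0|rewrite h extS].
  - move=> n' w [Aw /= w0] wS; rewrite (LA (ext n'))//.
      rewrite big_ord_recl ext0 mulrA; congr (_ * _).
      by apply: eq_bigr => l _; rewrite extS.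
    move=> l; case: (unliftP ord0 l) => [j ->|->]; last by rewrite ext0.
    by rewrite extS wS.
under eq_eseriesr => n _ do rewrite step.
set D := \prod_l expR (- (1 - c (S l)) * m (S l)).
transitivity (\sum_(n <oo) ((a * b * D)%:E * (c ord0 ^+ n * pois (m ord0) n)%:E))%E.
  by apply: eq_eseriesr => n _; rewrite -EFinM; congr EFin; ring.
rewrite nneseriesZl; last by move=> n _; rewrite lee_fin mulr_ge0 ?exprn_ge0 ?pois_ge0.
by rewrite pois_gf// -EFinM big_ord_recl -/D; congr EFin; rewrite -!mulrA; congr (_ * (_ * _)); rewrite mulrC.
Qed.
End pgf.

Section local_finiteness.
Context {d : measure_display} {T : measurableType d} {R : realType}.
Variables (P : probability T R) (lam : R) (X : nat -> {RV P >-> plane R}).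
Hypothesis poisX : poisson_process lam X.
Hypothesis lam_gt0 : 0 < lam.
Local Notation area := (@lebesgue_measure R \x @lebesgue_measure R)%E.

Lemma measurable_count (B : set (plane R)) n : measurable B ->
  measurable [set w | point_measure X w B = n%:R%:E].
Proof.
move=> mB.
have mf : measurable_fun setT (fun w => point_measure X w B).
  apply: (@ge0_emeasurable_sum _ _ _ setT (fun k w => ((X k w \in B)%:R : R)%:E) xpredT).
    by move=> k w _ _; rewrite lee_fin.
  move=> k _; apply/measurable_EFinP.
  have h : measurable_fun setT ((\1_B : plane R -> R) \o X k).
    by apply: measurableT_comp => //; exact: measurable_indic.
  exact: h.
have := mf measurableT [set n%:R%:E] (emeasurable_set1 _); rewrite setTI.
by congr measurable; apply/seteqP; split.
Qed.

Lemma count_law (B : set (plane R)) n : measurable B -> (area B < +oo)%E ->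
  P [set w | point_measure X w B = n%:R%:E] = (pois (lam * fine (area B)) n)%:E.
Proof.
move=> mB fB.
have := @poisX 1 (fun=> B) (fun=> n) (fun=> mB) (fun=> fB).
rewrite big_ord1 => <-; last by apply/trivIsetP => -[[|]//= ?] [[|]//= ?] _ _ /eqP; case; exact: val_inj.
congr (P _); apply/seteqP; split => w //= h; exact: (h ord0).
Qed.

(** The Poisson weights sum to 1, so the count is almost surely an integer. *)
Lemma ae_count_finite (B : set (plane R)) : measurable B -> (area B < +oo)%E ->
  {ae P, forall w, exists n : nat, point_measure X w B = n%:R%:E}.
Proof.
move=> mB fB.
pose F n := [set w | point_measure X w B = n%:R%:E].
have mF n : measurable (F n) by exact: measurable_count.
have mU : measurable (\bigcup_n F n) by exact: bigcupT_measurable.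
have PU : P (\bigcup_n F n) = 1%E.
  rewrite measure_bigcup//; last first.
    apply/trivIsetP => i j _ _ ij; apply/seteqP; split => w //= -[/= wi wj].
    by move: wi; rewrite /F/= wj => -[] /eqP; rewrite eqr_nat eq_sym (negbTE ij).
  rewrite -(@pois_sum R (lam * fine (area B))); last first.
    by apply: mulr_ge0; [exact: ltW|exact: fine_ge0].
  rewrite (@eq_eseriesl _ _ xpredT); last by move=> n; rewrite in_setT.
  by apply: eq_eseriesr => n _; exact: count_law.
exists (~` \bigcup_n F n); split.
- exact: measurableC.
- by apply/eqP; rewrite probability_setC// PU subee.
- by move=> w /= h [n _ Fn]; apply: h; exists n.
Qed.
End local_finiteness.

(** * Infinite products of factors between 0 and 1 *)

Section infinite_products.
Context {R : realType}.

Lemma cvg_EFin_seq (u : nat -> R) (l : R) : u @ \oo --> l ->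
  (fun n => (u n)%:E) @ \oo --> l%:E.
Proof. by move=> ul; apply: cvg_EFin => //; exact: nearW. Qed.

Definition iprod (a : nat -> R) : R := limn (fun n => \prod_(0 <= k < n) a k).

Lemma prod01 (a : nat -> R) n : (forall k, 0 <= a k <= 1) ->
  0 <= \prod_(0 <= k < n) a k <= 1.
Proof.
move=> a01; elim: n => [|n /andP[h0 h1]]; first by rewrite big_geq// ler01 lexx.
rewrite big_nat_recr//=; have /andP[a0 a1] := a01 n.
by rewrite mulr_ge0//= mulr_ile1.
Qed.

(** The partial products decrease and are bounded below by 0. *)
Lemma cvg_iprod (a : nat -> R) : (forall k, 0 <= a k <= 1) ->
  (fun n => \prod_(0 <= k < n) a k) @ \oo --> iprod a.
Proof.
move=> a01; apply: nonincreasing_is_cvgn.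
  apply/nonincreasing_seqP => n; rewrite big_nat_recr//=.
  have /andP[h0 _] := prod01 n a01; have /andP[_ a1] := a01 n.
  by rewrite ler_piMr.
by exists 0 => _ [n _ <-]; have /andP[] := prod01 n a01.
Qed.

Lemma iprod01 (a : nat -> R) : (forall k, 0 <= a k <= 1) -> 0 <= iprod a <= 1.
Proof.
move=> a01; apply/andP; split.
  apply: limr_ge; first exact: cvg_iprod a01.
  by apply: nearW => n; have /andP[] := prod01 n a01.
apply: limr_le; first exact: cvg_iprod a01.
by apply: nearW => n; have /andP[] := prod01 n a01.
Qed.

Lemma iprodE (a : nat -> R) M : (forall k, (M <= k)%N -> a k = 1) ->
  iprod a = \prod_(0 <= k < M) a k.
Proof.
move=> a1; apply/cvg_lim => //.
apply: cvg_near_cst; exists M => // n /= Mn.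
rewrite (big_cat_nat (leq0n _) Mn) /= [X in _ * X]big1_seq ?mulr1// => k.
by rewrite mem_index_iota => /andP[_ /andP[Mk _]]; exact: a1.
Qed.

Lemma cvg_prod (u : nat -> nat -> R) (a : nat -> R) M :
  (forall k, (fun m => u m k) @ \oo --> a k) ->
  (fun m => \prod_(0 <= k < M) u m k) @ \oo --> \prod_(0 <= k < M) a k.
Proof.
move=> ua; elim: M => [|M IH].
  by rewrite big_geq//; under eq_fun do rewrite big_geq//; exact: cvg_cst.
rewrite big_nat_recr//=; under eq_fun do rewrite big_nat_recr//=.
exact: cvgM.
Qed.

End infinite_products.

Section expected_products.
Context {d : measure_display} {T : measurableType d} {R : realType}.
Variables (P : probability T R).

Lemma bounded_convergence (f_ : nat -> T -> R) (f : T -> R) (M : R) :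
  (forall n, measurable_fun setT (f_ n)) -> measurable_fun setT f ->
  {ae P, forall w, f_ ^~ w @ \oo --> f w} ->
  (forall n w, `|f_ n w| <= M) ->
  (fun n => \int[P]_w (f_ n w)%:E)%E @ \oo --> (\int[P]_w (f w)%:E)%E.
Proof.
move=> mf_ mf ff fM.
have [] := @dominated_convergence _ T R P setT measurableT (fun n w => (f_ n w)%:E)
  (fun w => (f w)%:E) (cst M%:E) _ _ _ _ _ => //.
- by move=> n; exact/measurable_EFinP.
- exact/measurable_EFinP.
- by apply: filterS ff => w h _; exact: cvg_EFin_seq.
- exact: finite_measure_integrable_cst.
- by apply: aeW => w n _ /=; rewrite lee_fin.
Qed.

Lemma measurable_iprod (a : nat -> T -> R) :
  (forall k, measurable_fun setT (a k)) -> (forall k w, 0 <= a k w <= 1) ->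
  measurable_fun setT (fun w => iprod (a ^~ w)).
Proof.
move=> ma a01; apply: (@measurable_fun_cvg _ T R setT (fun n w => \prod_(0 <= k < n) a k w)).
  by move=> n; apply: measurable_prod => k _.
by move=> w _; exact: (@cvg_iprod R (a ^~ w) (fun k => a01 k w)).
Qed.

Lemma cvg_expectation_prod (a : nat -> T -> R) :
  (forall k, measurable_fun setT (a k)) -> (forall k w, 0 <= a k w <= 1) ->
  (fun n => \int[P]_w (\prod_(0 <= k < n) a k w)%:E)%E @ \oo -->
    (\int[P]_w (iprod (a ^~ w))%:E)%E.
Proof.
move=> ma a01; apply: (@bounded_convergence _ _ 1).
- by move=> n; apply: measurable_prod => k _.
- exact: measurable_iprod.
- by apply: aeW => w; exact: (@cvg_iprod R (a ^~ w) (fun k => a01 k w)).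
- move=> n w; have /andP[h0 h1] := @prod01 R (a ^~ w) n (fun k => a01 k w).
  by rewrite ger0_norm.
Qed.
End expected_products.

(** * Approximation of a function by finitely many level sets *)

Section staircase.
Context {R : realType}.
Variables (W : set (plane R)) (q : plane R -> R).
Hypotheses (mW : measurable W) (mq : measurable_fun setT q).
Hypotheses (q01 : forall x, 0 <= q x <= 1) (qW : forall x, ~ W x -> q x = 0).
Local Notation area := (@lebesgue_measure R \x @lebesgue_measure R)%E.

Definition step_set m (j : nat) : set (plane R) :=
  W `&` [set x | j%:R <= m.+1%:R * q x < j.+1%:R].

(** [q] rounded down to a multiple of [1 / (m + 1)] on [W]. *)
Definition staircase m x : R :=
  \sum_(j < m.+2) j%:R / m.+1%:R * \1_(step_set m j) x.

Lemma measurable_step_set m j : measurable (step_set m j).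
Proof.
apply: measurableI => //.
have h : measurable_fun setT (fun x => m.+1%:R * q x) by exact: measurable_funM.
have := h measurableT `[j%:R, j.+1%:R[%classic (measurable_itv _); rewrite setTI.
by congr measurable; apply/seteqP; split => x /=; rewrite in_itv.
Qed.

Lemma step_set_inj m i j x : step_set m i x -> step_set m j x -> i = j.
Proof.
move=> [_ /= /andP[i1 i2]] [_ /= /andP[j1 j2]].
have := le_lt_trans i1 j2; have := le_lt_trans j1 i2.
by rewrite !ltr_nat !ltnS => ji ij; apply/eqP; rewrite eqn_leq ij ji.
Qed.

Lemma step_set_out m j x : ~ W x -> \1_(step_set m j) x = 0 :> R.
Proof. by move=> Wx; rewrite indicE memNset// => -[]. Qed.

Lemma staircase_out m x : ~ W x -> staircase m x = 0.
Proof.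
by move=> Wx; rewrite /staircase big1// => j _; rewrite step_set_out// mulr0.
Qed.

Lemma staircase_step m (j : 'I_m.+2) x : step_set m j x -> staircase m x = j%:R / m.+1%:R.
Proof.
move=> sx; rewrite /staircase (bigD1 j)//= big1 ?addr0.
  by rewrite indicE mem_set// mulr1.
move=> i ij; rewrite indicE memNset ?mulr0// => si.
by move/eqP: ij; apply; apply: val_inj; exact: step_set_inj si sx.
Qed.

Lemma step_set_exists m x : W x -> exists j : 'I_m.+2, step_set m j x.
Proof.
move=> Wx; have /andP[q0 q1] := q01 x.
have z0 : 0 <= m.+1%:R * q x by rewrite mulr_ge0.
have z1 := truncn_itv z0.
suff jm : (Num.Def.trunc (m.+1%:R * q x) < m.+2)%N by exists (Ordinal jm); split.
rewrite ltnS -(ler_nat R); case/andP: z1 => z1 _; apply: le_trans z1 _.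
by rewrite ler_piMr.
Qed.

Lemma staircase_near m x : `|staircase m x - q x| <= m.+1%:R^-1.
Proof.
have [Wx|Wx] := pselect (W x); last first.
  by rewrite staircase_out// qW// subrr normr0 invr_ge0.
have [j sx] := step_set_exists m Wx.
rewrite (staircase_step sx); case: sx => _ /= /andP[j1 j2].
have m0 : 0 < m.+1%:R :> R by [].
rewrite -(ler_pM2l m0) -[X in X * _](ger0_norm (ltW m0)) -normrM mulrBr.
rewrite mulrCA !divff ?gt_eqF// mulr1 ler_norml; move: j2; rewrite -natr1; lra.
Qed.

Lemma staircase_cvg x : staircase ^~ x @ \oo --> q x.
Proof.
apply/cvgrPdist_le => e e0; near=> m.
rewrite distrC; apply: le_trans (staircase_near m x) _.
by apply: ltW; near: m; exact: near_infty_natSinv_lt (PosNum e0).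
Unshelve. all: by end_near. Qed.

Lemma staircase01 m x : 0 <= staircase m x <= 1.
Proof.
have [Wx|Wx] := pselect (W x); last by rewrite staircase_out// lexx ler01.
have [j sx] := step_set_exists m Wx.
rewrite (staircase_step sx) divr_ge0//= ler_pdivrMr// mul1r ler_nat.
by rewrite -ltnS.
Qed.

Lemma measurable_staircase m : measurable_fun setT (staircase m).
Proof.
apply: measurable_sum => j; apply: measurable_funM => //.
by apply: measurable_indic; exact: measurable_step_set.
Qed.

Hypothesis Wfin : (area W < +oo)%E.

Lemma step_set_fin m j : (area (step_set m j) < +oo)%E.
Proof.
apply: le_lt_trans Wfin; apply: le_measure; rewrite ?inE//.
  exact: measurable_step_set.
exact: subIsetl.
Qed.

Lemma integral_staircase m :
  (\int[area]_x (staircase m x)%:E =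
   (\sum_(j < m.+2) j%:R / m.+1%:R * fine (area (step_set m j)))%:E)%E.
Proof.
under eq_integral do rewrite -sumEFin.
rewrite ge0_integral_sum//; last first.
  move=> j; apply/measurable_EFinP; apply: measurable_funM => //.
  by apply: measurable_indic; exact: measurable_step_set.
rewrite -sumEFin; apply: eq_bigr => j _.
under eq_integral do rewrite EFinM.
rewrite ge0_integralZl//; last first.
  by apply/measurable_EFinP; apply: measurable_indic; exact: measurable_step_set.
have mS := measurable_step_set m j.
have -> : (\int[area]_x (\1_(step_set m j) x)%:E = area (step_set m j))%E.
  by rewrite integral_indic ?setIT.
by rewrite [RHS]EFinM fineK// ge0_fin_numE// step_set_fin.
Qed.

Lemma integrable_indicW : area.-integrable setT (fun x => (\1_W x)%:E : \bar R).
Proof.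
apply/integrableP; split; first by apply/measurable_EFinP; exact: measurable_indic.
rewrite (eq_integral (fun x => (\1_W x)%:E)); first by rewrite integral_indic ?setIT.
by move=> x _; rewrite gee0_abs// lee_fin.
Qed.

Lemma staircase_integral_cvg :
  (fun m => \int[area]_x (staircase m x)%:E)%E @ \oo --> (\int[area]_x (q x)%:E)%E.
Proof.
have [] := @dominated_convergence _ _ R area setT measurableT
  (fun m x => (staircase m x)%:E) (fun x => (q x)%:E) (fun x => (\1_W x)%:E) _ _ _ _ _ => //.
- by move=> m; apply/measurable_EFinP; exact: measurable_staircase.
- exact/measurable_EFinP.
- by apply: aeW => x _; apply: cvg_EFin_seq; exact: staircase_cvg.
- exact: integrable_indicW.
- apply: aeW => x m _; rewrite lee_fin indicE.
  have /andP[h0 h1] := staircase01 m x; rewrite ger0_norm//.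
  have [Wx|Wx] := pselect (W x); first by rewrite mem_set.
  by rewrite staircase_out// memNset.
Qed.

Lemma integral_fin_num : (\int[area]_x (q x)%:E)%E \is a fin_num.
Proof.
rewrite ge0_fin_numE; last first.
  by apply: integral_ge0 => x _; rewrite lee_fin; case/andP: (q01 x).
apply: (@le_lt_trans _ _ (\int[area]_x (\1_W x)%:E)%E); last first.
  by rewrite integral_indic ?setIT.
apply: ge0_le_integral => //.
- by move=> x _; rewrite lee_fin; case/andP: (q01 x).
- exact/measurable_EFinP.
- by apply/measurable_EFinP; exact: measurable_indic.
- move=> x _; rewrite lee_fin indicE; have /andP[h0 h1] := q01 x.
  have [Wx|Wx] := pselect (W x); first by rewrite mem_set.
  by rewrite qW// memNset.
Qed.
End staircase.

(** * Laplace functional of the positions *)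

Section laplace_positions.
Context {d : measure_display} {T : measurableType d} {R : realType}.
Variables (P : probability T R) (lam : R) (X : nat -> {RV P >-> plane R}).
Hypothesis poisX : poisson_process lam X.
Hypothesis lam_gt0 : 0 < lam.
Variables (W : set (plane R)) (q : plane R -> R).
Local Notation area := (@lebesgue_measure R \x @lebesgue_measure R)%E.
Hypotheses (mW : measurable W) (mq : measurable_fun setT q).
Hypotheses (q01 : forall x, 0 <= q x <= 1) (qW : forall x, ~ W x -> q x = 0).
Hypothesis Wfin : (area W < +oo)%E.

Lemma ae_finite_in (B : set (plane R)) : measurable B -> (area B < +oo)%E ->
  {ae P, forall w, exists M, forall k, (M <= k)%N -> ~ B (X k w)}.
Proof.
move=> mB fB; apply: filterS (ae_count_finite poisX lam_gt0 mB fB) => w [n pn].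
by apply: point_measure_finite; rewrite pn ltry.
Qed.

(** The step sets are disjoint, so at most one exponent is 1. *)
Lemma onem_staircaseE m x :
  1 - staircase W q m x = \prod_(l < m.+2) (1 - l%:R / m.+1%:R) ^+ (x \in step_set W q m l).
Proof.
have [Wx|Wx] := pselect (W x); last first.
  rewrite staircase_out// subr0 big1// => l _.
  by rewrite memNset ?expr0// => -[].
have [j sx] := step_set_exists q01 m Wx.
rewrite (staircase_step sx) (bigD1 j)//= mem_set// expr1 big1 ?mulr1// => i ij.
rewrite memNset ?expr0// => si.
by move/eqP: ij; apply; apply: val_inj; exact: step_set_inj si sx.
Qed.

(** Regrouped by step sets, the product over the stations becomes the product of
    [(1 - l / (m + 1)) ^+ n l] where [n l] counts the stations in the [l]-th step
    set: a generating function of independent Poisson variables. *)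
Lemma laplace_staircase m :
  (\int[P]_w (iprod (fun k => 1 - staircase W q m (X k w)))%:E =
  (expR (- lam * \sum_(j < m.+2) j%:R / m.+1%:R * fine (area (step_set W q m j))))%:E)%E.
Proof.
have s01 k w : 0 <= 1 - staircase W q m (X k w) <= 1.
  by have := staircase01 W q01 m (X k w); lra.
have c0 (l : 'I_m.+2) : 0 <= 1 - l%:R / m.+1%:R :> R.
  by rewrite subr_ge0 ler_pdivrMr// mul1r ler_nat -ltnS.
have mS l := measurable_step_set mW mq m l.
have fS l := step_set_fin mW mq Wfin m l.
have pos l : 0 <= lam * fine (area (step_set W q m l)).
  by apply: mulr_ge0; [exact: ltW|exact: fine_ge0].
have := @pgf_independent_poisson _ T R P m.+2 setT
  (fun l w => point_measure X w (step_set W q m l))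
  (fun l => lam * fine (area (step_set W q m l)))
  (fun l => 1 - l%:R / m.+1%:R)
  (fun w => iprod (fun k => 1 - staircase W q m (X k w))) 1 1.
move=> -> //.
- rewrite !mul1r -expR_sum mulNr mulr_sumr -sumrN; congr (expR _)%:E.
  by apply: eq_bigr => l _; ring.
- by move=> l n; exact: measurable_count.
- apply: measurable_iprod => // k; apply: measurable_funB => //.
  by apply: measurableT_comp => //; exact: measurable_staircase.
- by move=> w; have /andP[] := @iprod01 R _ (s01 ^~ w).
- move=> n; rewrite setTI mul1r; apply: poisX => //.
  apply/trivIsetP => i j _ _ ij; apply/seteqP; split => x //= -[xi xj].
  by move/eqP: ij; apply; apply: val_inj; exact: step_set_inj xi xj.
- move=> n w _ hn; rewrite mul1r.
  have /choice[Mf hM] : forall l : 'I_m.+2, exists M, forall k, (M <= k)%N -> ~ step_set W q m l (X k w).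
    by move=> l; apply: point_measure_finite; rewrite hn ltry.
  pose M := \max_l Mf l.
  have hM' (l : 'I_m.+2) k : (M <= k)%N -> ~ step_set W q m l (X k w).
    by move=> Mk; apply: hM; apply: leq_trans Mk; exact: leq_bigmax.
  have outW k : (M <= k)%N -> ~ W (X k w).
    by move=> Mk Wk; have [j] := step_set_exists q01 m Wk; exact: hM'.
  rewrite (@iprodE _ _ M); last by move=> k Mk; rewrite staircase_out ?subr0//; exact: outW.
  have nE l : n l = hits (step_set W q m l) (X ^~ w) M.
    have := hn l; rewrite (point_measure_hits (hM' l)) => -[] /eqP.
    by rewrite eqr_nat => /eqP.
  under eq_bigr do rewrite onem_staircaseE.
  rewrite exchange_big/=; apply: eq_bigr => l _.
  by rewrite nE /hits prodrXr.
- by move=> l; exact: ae_count_finite poisX lam_gt0 _ (mS l) (fS l).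
Qed.

(** The level [m] tends to infinity. Almost surely [W] contains finitely many
    stations, so only finitely many factors differ from 1, and the products are
    bounded by 1. *)
Lemma laplace_iprod_positions :
  (\int[P]_w (iprod (fun k => 1 - q (X k w)))%:E =
   (expR (- lam * fine (\int[area]_x (q x)%:E)))%:E)%E.
Proof.
have s01 m k w : 0 <= 1 - staircase W q m (X k w) <= 1.
  by have := staircase01 W q01 m (X k w); lra.
have o01 k w : 0 <= 1 - q (X k w) <= 1 by have := q01 (X k w); lra.
have mX k (g : plane R -> R) : measurable_fun setT g -> measurable_fun setT (fun w => 1 - g (X k w)).
  by move=> mg; apply: measurable_funB => //; exact: measurableT_comp.
have lim1 : (fun m => \int[P]_w (iprod (fun k => 1 - staircase W q m (X k w)))%:E)%E @ \oo -->
    (\int[P]_w (iprod (fun k => 1 - q (X k w)))%:E)%E.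
  apply: (@bounded_convergence _ _ _ _ _ _ 1).
  - move=> m; apply: measurable_iprod => // k.
    by apply: mX; exact: measurable_staircase.
  - by apply: measurable_iprod => // k; exact: mX.
  - apply: filterS (ae_finite_in mW Wfin) => w [M outW].
    rewrite (@iprodE _ _ M); last by move=> k Mk; rewrite qW ?subr0//; exact: outW.
    rewrite (_ : (fun m => _) = (fun m => \prod_(0 <= k < M) (1 - staircase W q m (X k w)))).
      apply: cvg_prod => k; apply: cvgB; first exact: cvg_cst.
      exact: staircase_cvg.
    apply/funext => m; apply: iprodE => k Mk.
    by rewrite staircase_out ?subr0//; exact: outW.
  - move=> m w; have /andP[h0 h1] := @iprod01 R _ (s01 m ^~ w).
    by rewrite ger0_norm.
have lim2 := staircase_integral_cvg mW mq q01 qW Wfin.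
have fq := integral_fin_num mW mq q01 qW Wfin.
move: lim1; under eq_fun do rewrite laplace_staircase.
move=> lim1; apply/esym; apply: cvg_unique lim1; first exact: ereal_hausdorff.
apply: cvg_EFin_seq; apply: continuous_cvg; first exact: continuous_expR.
apply: cvgM; first exact: cvg_cst.
have := fine_cvg _; rewrite -(fineK fq) in lim2.
move/fine_cvgP : lim2 => [_].
by under eq_fun do rewrite /= integral_staircase//=.
Qed.

Lemma laplace_positions :
  (fun n => \int[P]_w (\prod_(0 <= k < n) (1 - q (X k w)))%:E)%E @ \oo -->
   (expR (- lam * fine (\int[area]_x (q x)%:E)))%:E.
Proof.
rewrite -laplace_iprod_positions.
apply: cvg_expectation_prod => [k|k w]; last by have := q01 (X k w); lra.
by apply: measurable_funB => //; exact: measurableT_comp.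
Qed.
End laplace_positions.

(** * Laplace functional of the marked stations *)

Section laplace_marked.
Context {d : measure_display} {T : measurableType d} {R : realType}.
Variables (P : probability T R) (lam : R) (X : nat -> {RV P >-> plane R})
    (Theta : nat -> {RV P >-> measurableTypeR R}).
Hypothesis net : mobile_network lam X Theta.
Hypothesis lam_gt0 : 0 < lam.
Local Notation U := (uniform_prob (ltNpi_pi R)).
Local Notation area := (@lebesgue_measure R \x @lebesgue_measure R)%E.

(** Averaging the angles reduces to the positions. The integral over the positions is
    assumed to be the same for every angle, as rotation invariance ensures for all
    the functions considered below; the law of the angles then disappears. *)
Theorem laplace_functional (W : set (plane R)) (phi : plane R * measurableTypeR R -> R) (I : R) :
  measurable W -> (area W < +oo)%E ->
  measurable_fun setT phi -> (forall z, 0 <= phi z <= 1) ->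
  (forall z, ~ W z.1 -> phi z = 1) ->
  (forall a, \int[area]_x (1 - phi (x, a))%:E = I%:E)%E ->
  (\int[P]_w (iprod (fun k => phi (X k w, Theta k w)))%:E = (expR (- lam * I))%:E)%E.
Proof.
move=> mW Wfin mphi phi01 phiW intI.
pose q x := 1 - angle_mean phi x.
have am x := angle_meanE x mphi phi01.
have q01 x : 0 <= q x <= 1 by have [_] := am x; rewrite /q; lra.
have mam : measurable_fun setT (angle_mean phi).
  by apply: measurable_angle_mean => // z; case/andP: (phi01 z).
have mq : measurable_fun setT q by exact: measurable_funB.
have qW x : ~ W x -> q x = 0.
  move=> Wx; rewrite /q /angle_mean (eq_integral (cst 1%E)).
    by rewrite integral_cst//= probability_setT mule1 subrr.
  by move=> a _; rewrite phiW.
have m1 : measurable_fun setT (fun z => (1 - phi z)%:E).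
  by apply/measurable_EFinP; exact: measurable_funB.
have p1 z : (0 <= (1 - phi z)%:E)%E by rewrite lee_fin; have := phi01 z; lra.
have iq : (\int[area]_x (q x)%:E = I%:E)%E.
  transitivity (\int[area]_x \int[U]_a (1 - phi (x, a))%:E)%E.
    apply: eq_integral => x _; rewrite /q EFinB; have [-> _] := am x.
    have mpx : measurable_fun setT (fun a : measurableTypeR R => (phi (x, a))%:E).
      by apply/measurable_EFinP; exact: measurableT_comp.
    have mpx' : measurable_fun setT (fun a : measurableTypeR R => (1 - phi (x, a))%:E).
      by apply/measurable_EFinP; apply: measurable_funB => //; exact: measurableT_comp.
    have e1 : (\int[U]_a (1 - phi (x, a))%:E + \int[U]_a (phi (x, a))%:E = 1)%E.
      rewrite -ge0_integralD//.
      - rewrite (eq_integral (cst 1%E)); first by rewrite integral_cst//= probability_setT mule1.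
        by move=> a _; rewrite -EFinD subrK.
      - by move=> a _; rewrite lee_fin; case/andP: (phi01 (x, a)).
    rewrite -e1; have [<- _] := am x.
    by rewrite addeK.
  transitivity (\int[U]_a \int[area]_x (1 - phi (x, a))%:E)%E.
    exact: (@area_fubini R _ (measurableTypeR R) U _ m1 p1).
  rewrite (eq_integral (cst I%:E)).
    by rewrite integral_cst//= probability_setT mule1.
  by move=> a _; exact: intI.
have lim1 := laplace_positions (network_poisson net) lam_gt0 mW mq q01 qW Wfin.
rewrite iq /= in lim1.
have mZ k : measurable_fun setT (fun w => phi (X k w, Theta k w)).
  by apply: (measurableT_comp mphi); exact: measurable_fun_pair.
have lim2 := @cvg_expectation_prod _ T R P (fun k w => phi (X k w, Theta k w)) mZ (fun k w => phi01 _).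
have e : (fun n => \int[P]_w (\prod_(0 <= k < n) (1 - q (X k w)))%:E)%E =
    (fun n => \int[P]_w (\prod_(0 <= k < n) phi (X k w, Theta k w))%:E)%E.
  apply/funext => n; rewrite (mean_prod_marks net)//.
  by apply: eq_integral => w _; congr EFin; apply: eq_bigr => k _; rewrite /q; ring.
rewrite e in lim1.
exact: (cvg_unique (@ereal_hausdorff _) lim2 lim1).
Qed.
End laplace_marked.

(** * Difference quotients of products *)

Section difference_quotients.
Context {R : realType}.

(** The derivative of a product at 0, along the steps [1 / (n + 1)]. *)
Lemma cvg_prod_diff (al be : nat -> R) M :
  (fun n => n.+1%:R * (\prod_(0 <= k < M) (al k + n.+1%:R^-1 * be k) - \prod_(0 <= k < M) al k)) @ \oo -->
  \sum_(0 <= j < M) be j * \prod_(0 <= k < M) (if k == j then 1 else al k).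
Proof.
have inv0 : (fun n => n.+1%:R^-1 : R) @ \oo --> (0 : R) by exact: cvg_harmonic.
elim: M => [|M IH].
  rewrite [X in _ --> X]big_geq//.
  rewrite (_ : (fun _ => _) = cst 0); first exact: cvg_cst.
  by apply/funext => n; rewrite !big_geq// subrr mulr0.
have -> : \sum_(0 <= j < M.+1) be j * \prod_(0 <= k < M.+1) (if k == j then 1 else al k) =
    (\sum_(0 <= j < M) be j * \prod_(0 <= k < M) (if k == j then 1 else al k)) * (al M + 0 * be M) +
    be M * \prod_(0 <= k < M) al k.
  rewrite big_nat_recr//=; congr (_ + _).
    rewrite mul0r addr0 mulr_suml; apply: eq_big_nat => j /andP[_ jM].
    by rewrite big_nat_recr//= gtn_eqF// mulrA.
  rewrite big_nat_recr//= eqxx mulr1; congr (_ * _).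
  by apply: eq_big_nat => k /andP[_ kM]; rewrite ltn_eqF.
rewrite (_ : (fun _ => _) = (fun n =>
   (n.+1%:R * (\prod_(0 <= k < M) (al k + n.+1%:R^-1 * be k) - \prod_(0 <= k < M) al k)) *
   (al M + n.+1%:R^-1 * be M) + be M * \prod_(0 <= k < M) al k)); last first.
  apply/funext => n; rewrite !big_nat_recr//=.
  have alg (x i p p0 y z : R) : x * i = 1 ->
      x * (p * (y + i * z) - p0 * y) = x * (p - p0) * (y + i * z) + z * p0.
    by move=> h; ring: h.
  by apply: alg; rewrite divff.
apply: cvgD; last exact: cvg_cst.
apply: cvgM => //; apply: cvgD; first exact: cvg_cst.
by apply: cvgM => //; exact: cvg_cst.
Qed.

Lemma cvg_onem_prod (c : nat -> R) M :
  (fun n => n.+1%:R * (1 - \prod_(0 <= k < M) (1 - n.+1%:R^-1 * c k))) @ \oo -->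
  \sum_(0 <= k < M) c k.
Proof.
have := @cvg_prod_diff (fun=> 1) (fun k => - c k) M.
move/cvgN; rewrite -sumrN.
rewrite [X in _ --> X -> _](_ : _ = \sum_(0 <= k < M) c k); last first.
  by apply: eq_bigr => j _; rewrite big1 ?mulr1 ?opprK// => k _; case: ifP.
apply: cvg_trans; apply: near_eq_cvg; apply: nearW => n /=.
rewrite big1// -mulrN opprB; congr (_ * (_ - _)).
by apply: eq_bigr => k _; rewrite mulrN.
Qed.

Lemma onem_prod_bounds (s : R) (c : nat -> R) M : 0 <= s <= 1 -> (forall k, 0 <= c k <= 1) ->
  0 <= 1 - \prod_(0 <= k < M) (1 - s * c k) <= s * \sum_(0 <= k < M) c k.
Proof.
move=> s01 c01; have h k : 0 <= 1 - s * c k <= 1.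
  have /andP[c0 c1] := c01 k; have /andP[s0 s1] := s01.
  have : 0 <= s * c k <= 1 by rewrite mulr_ge0//= mulr_ile1.
  by move=> /andP[? ?]; apply/andP; split; lra.
elim: M => [|M IH]; first by rewrite !big_geq// subrr mulr0 lexx.
have := prod01 M h; rewrite !big_nat_recr//=.
set p := \prod_(0 <= k < M) _ in IH *.
have /andP[h0 h1] := h M; have /andP[c0 c1] := c01 M; have /andP[s0 s1] := s01.
move=> /andP[p0 p1]; move: IH => /andP[_ IH2]; apply/andP; split.
  by rewrite subr_ge0 mulr_ile1.
rewrite [s * (_ + _)]mulrDr; have : p * (s * c M) <= s * c M by rewrite ler_piMl// mulr_ge0.
rewrite [p * (1 - _)]mulrBr mulr1; move: IH2; set t := s * \sum_(0 <= k < M) _; set x := s * c M.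
by set y := p * x; move=> *; lra.
Qed.

(** If no [a k] is 1 both products are 1. Otherwise the second one vanishes, and the
    first one contains a factor [u * g k], at most [u]. *)
Lemma mark_prod_bounds (u : R) (a g : nat -> R) M : 0 <= u <= 1 ->
  (forall k, 0 <= g k <= 1) -> (forall k, a k = 1 \/ a k = 0 /\ g k = 0) ->
  0 <= \prod_(0 <= k < M) (1 - a k + u * g k) - \prod_(0 <= k < M) (1 - a k) <= u.
Proof.
move=> /andP[u0 u1] g01 ag.
suff [] : let p := \prod_(0 <= k < M) (1 - a k + u * g k) in
  let p0 := \prod_(0 <= k < M) (1 - a k) in
  p0 <= p <= 1 /\ (p0 = 1 \/ p0 = 0 /\ p <= u) .
  move=> /= /andP[h1 h2] [h3|[h3 h4]]; rewrite subr_ge0 h1/=.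
    by rewrite h3 lerBlDr (le_trans h2)// lerDr.
  by rewrite h3 subr0.
elim: M => [|M [/andP[IH1 IH2] IH3]].
  by rewrite /= !big_geq// !lexx; split => //; left.
rewrite /= !big_nat_recr//=.
set p := \prod_(0 <= k < M) (_ + u * _) in IH1 IH2 IH3 *.
set p0 := \prod_(0 <= k < M) _ in IH1 IH3 *.
have /andP[g0 g1] := g01 M.
have pp : 0 <= p by case: IH3 => [e|[e _]]; move: IH1; rewrite e//; exact: le_trans.
have [->|[-> ->]] := ag M; last by rewrite mulr0 addr0 subr0 !mulr1 IH1.
rewrite subrr mulr0 add0r.
have ug0 : 0 <= u * g M by rewrite mulr_ge0.
have ug1 : u * g M <= u by rewrite ler_piMr.
have pug : p * (u * g M) <= u * g M by rewrite ler_piMl.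
have h0 : 0 <= p * (u * g M) by rewrite mulr_ge0.
have h1 : p * (u * g M) <= 1 by exact: le_trans pug (le_trans ug1 u1).
split; first by rewrite h0 h1.
by right; split => //; exact: le_trans pug ug1.
Qed.

End difference_quotients.

(** * The sole point of a set *)

Section sole_sums.
Context {R : realType} {V : Type}.
Implicit Types (A C : set V) (g : V -> R) (z : nat -> V).
Local Open Scope ereal_scope.

Definition alone A z (j : nat) : Prop := forall k, k != j -> ~ A (z k).

Definition sole_term A g z j : R := (g (z j) * `[< alone A z j >]%:R)%R.

(** When [g] vanishes off [A] this is the value of [g] at the only point of the
    sequence in [A], and 0 if [A] contains no point or several. *)
Definition sole_sum A g z : \bar R := \sum_(j <oo) (sole_term A g z j)%:E.

Definition count C z : \bar R := \sum_(k <oo) (\1_C (z k) : R)%:E.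

Lemma count_finite C z M : (forall k, (M <= k)%N -> ~ C (z k)) ->
  count C z = (\sum_(0 <= k < M) \1_C (z k))%R%:E.
Proof.
move=> h; rewrite /count (nneseries_split 0 M); last by move=> k _; rewrite lee_fin.
rewrite add0n sumEFin eseries0 ?adde0// => k Mk _.
by rewrite indicE memNset//; exact: h.
Qed.

Lemma sole_sum_finite A g z M : (forall y, 0 <= g y)%R -> (forall y, ~ A y -> g y = 0%R) ->
  (forall k, (M <= k)%N -> ~ A (z k)) ->
  sole_sum A g z = (\sum_(0 <= j < M) g (z j) *
     \prod_(0 <= k < M) (if k == j then 1 else 1 - \1_A (z k)))%R%:E.
Proof.
move=> g0 gA h; rewrite /sole_sum (nneseries_split 0 M); last first.
  by move=> k _; rewrite lee_fin mulr_ge0.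
rewrite add0n sumEFin eseries0 ?adde0; last first.
  by move=> k Mk _; rewrite /sole_term gA ?mul0r//; exact: h.
congr EFin; apply: eq_big_nat => j /andP[_ jM].
rewrite /sole_term; congr (_ * _)%R; case: asboolP => [al|nal].
  rewrite big1// => k _; case: eqVneq => // kj.
  by rewrite indicE memNset ?subr0//; exact: al.
have [k kj Ak] : exists2 k, k != j & A (z k).
  by apply: contrapT => hk; apply: nal => k kj Ak; apply: hk; exists k.
have kM : (k < M)%N by rewrite ltnNge; apply/negP => Mk; exact: h Mk Ak.
apply/esym/eqP; rewrite prodf_seq_eq0; apply/hasP; exists k.
  by rewrite mem_index_iota.
by rewrite /= (negbTE kj) indicE mem_set//= subrr.
Qed.

End sole_sums.

(** * A two-parameter family of Laplace functionals *)

Section cell_weights.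
Context {d : measure_display} {T : measurableType d} {R : realType}.
Variables (P : probability T R) (lam : R) (X : nat -> {RV P >-> plane R})
    (Theta : nat -> {RV P >-> measurableTypeR R}).
Hypothesis net : mobile_network lam X Theta.
Hypothesis lam_gt0 : 0 < lam.
Local Notation area := (@lebesgue_measure R \x @lebesgue_measure R)%E.
Local Notation marked := (plane R * measurableTypeR R)%type.
Local Notation Z w := (fun k : nat => (X k w, Theta k w) : marked).

Lemma measurable_mark (f : marked -> R) k : measurable_fun setT f ->
  measurable_fun setT (fun w => f (X k w, Theta k w)).
Proof.
by move=> mf; apply: (measurableT_comp mf); exact: measurable_fun_pair.
Qed.

Lemma integral_bounded_diff (f1 f2 : T -> R) (e1 e2 : R) :
  measurable_fun setT f1 -> measurable_fun setT f2 ->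
  (forall w, `|f1 w| <= 2) -> (forall w, `|f2 w| <= 2) ->
  (\int[P]_w (f1 w)%:E = e1%:E -> \int[P]_w (f2 w)%:E = e2%:E ->
  \int[P]_w (f1 w - f2 w)%:E = (e1 - e2)%:E)%E.
Proof.
move=> m1 m2 b1 b2 i1 i2.
have int (f : T -> R) : measurable_fun setT f -> (forall w, `|f w| <= 2) ->
    P.-integrable setT (fun w => (f w)%:E).
  move=> mf bf; apply: measurable_bounded_integrable => //.
    by rewrite (le_lt_trans (probability_le1 _ _))// ltry.
  by exists 2; split => // x x2 w _; exact: le_trans (bf w) (ltW x2).
under eq_integral do rewrite EFinB.
rewrite integralB_EFin//; [|exact: int|exact: int].
by rewrite i1 i2.
Qed.

Variables (W : set (plane R)) (A C : set marked) (g : marked -> R) (a c gam : R).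
Hypotheses (mW : measurable W) (Wfin : (area W < +oo)%E).
Hypotheses (mA : measurable A) (mC : measurable C) (mg : measurable_fun setT g).
Hypotheses (g01 : forall z, 0 <= g z <= 1) (gA : forall z, ~ A z -> g z = 0).
Hypotheses (AW : forall z, A z -> W z.1) (CW : forall z, C z -> W z.1).
Hypothesis AC : forall z, A z -> ~ C z.
Hypothesis iA : (forall t, \int[area]_x (\1_A ((x, t) : marked) : R)%:E = a%:E)%E.
Hypothesis iC : (forall t, \int[area]_x (\1_C ((x, t) : marked) : R)%:E = c%:E)%E.
Hypothesis ig : (forall t, \int[area]_x (g (x, t))%:E = gam%:E)%E.

(** The product of these weights over the points splits into a factor in [s], whose
    derivative at 0 is minus the number of points in [C], and a factor in [u], whose
    derivative at 0 is the value of [g] at the sole point of [A]. *)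
Definition cell_weight (s u : R) (z : marked) : R :=
  (1 - s * \1_C z) * (1 - \1_A z + u * g z).

Lemma cell_weight_factors (s u : R) (z : marked) : 0 <= s <= 1 -> 0 <= u <= 1 ->
  0 <= 1 - s * \1_C z <= 1 /\ 0 <= 1 - \1_A z + u * g z <= 1.
Proof.
move=> /andP[s0 s1] /andP[u0 u1]; have /andP[g0 g1] := g01 z.
split; rewrite indicE.
  by case: (z \in C); rewrite ?mulr1 ?mulr0; apply/andP; split; lra.
case: (boolP (z \in A)) => zA.
  by rewrite subrr add0r mulr_ge0//= mulr_ile1.
by rewrite gA ?mulr0 ?addr0 ?subr0 ?ler01 ?lexx//; move: zA; rewrite notin_setE.
Qed.

Lemma cell_weight01 (s u : R) (z : marked) : 0 <= s <= 1 -> 0 <= u <= 1 -> 0 <= cell_weight s u z <= 1.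
Proof.
move=> s01 u01; have [/andP[h0 h1] /andP[k0 k1]] := cell_weight_factors z s01 u01.
by rewrite /cell_weight mulr_ge0//= mulr_ile1.
Qed.

(** As [A] and [C] are disjoint, the weight has no term in [s * u]. *)
Lemma onem_cell_weight (s u : R) (z : marked) :
  1 - cell_weight s u z + u * g z = s * \1_C z + \1_A z.
Proof.
rewrite /cell_weight !indicE; case: (boolP (z \in C)) => zC; case: (boolP (z \in A)) => zA /=;
  rewrite ?mulr0n ?mulr1n.
- by exfalso; move: zA zC; rewrite !inE; exact: AC.
- by rewrite gA; [ring|move: zA; rewrite notin_setE].
- ring.
- by rewrite gA; [ring|move: zA; rewrite notin_setE].
Qed.

Lemma measurable_cell_weight s u : measurable_fun setT (cell_weight s u).
Proof.
apply: measurable_funM.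
  by apply: measurable_funB => //; apply: measurable_funM => //; exact: measurable_indic.
apply: measurable_funD; last exact: measurable_funM.
by apply: measurable_funB => //; exact: measurable_indic.
Qed.

Lemma laplace_cell (s u : R) : 0 <= s <= 1 -> 0 <= u <= 1 ->
  (\int[P]_w (iprod (fun k => cell_weight s u (Z w k)))%:E =
   (expR (- lam * (s * c + a - u * gam)))%:E)%E.
Proof.
move=> s01 u01; have /andP[s0 s1] := s01; have /andP[u0 u1] := u01.
apply: (laplace_functional net lam_gt0 mW Wfin).
- exact: measurable_cell_weight.
- by move=> z; exact: cell_weight01.
- move=> z Wz; rewrite /cell_weight !indicE !memNset; [|by move=> /AW|by move=> /CW].
  by rewrite /= mulr0n gA; [ring|by move=> /AW].
move=> t.
have m1 : measurable_fun setT (fun x : plane R => (1 - cell_weight s u (x, t))%:E).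
  apply/measurable_EFinP; apply: measurable_funB => //.
  by apply: (measurableT_comp (measurable_cell_weight s u)); exact: measurable_fun_pair.
have m2 (f : marked -> R) : measurable_fun setT f ->
    measurable_fun setT (fun x : plane R => (f (x, t))%:E).
  move=> mf; apply/measurable_EFinP.
  by apply: (measurableT_comp mf); exact: measurable_fun_pair.
have mg' := m2 _ mg.
have mI (B : set marked) : measurable B -> measurable_fun setT (\1_B : marked -> R).
  by move=> mB; exact: measurable_indic.
have mA' := m2 _ (mI _ mA).
have mC' := m2 _ (mI _ mC).
have p1 z : (0 <= (1 - cell_weight s u z)%:E)%E.
  by rewrite lee_fin subr_ge0; case/andP: (cell_weight01 z s01 u01).
have pg z : (0 <= (g z)%:E)%E by rewrite lee_fin; case/andP: (g01 z).
have e : (\int[area]_x (1 - cell_weight s u (x, t))%:E + (u * gam)%:E = (s * c + a)%:E)%E.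
  have i1 : (\int[area]_x (u%:E * (g (x, t))%:E) = (u * gam)%:E)%E.
    by rewrite ge0_integralZl// ig.
  have i2 : (\int[area]_x (s%:E * (\1_C ((x, t) : marked) : R)%:E) = (s * c)%:E)%E.
    by rewrite ge0_integralZl// ?iC// => x _; rewrite lee_fin.
  have ind0 (B : set marked) (x : plane R) : (0 <= (\1_B ((x, t) : marked) : R)%:E)%E by rewrite lee_fin.
  have h1 (x : plane R) : setT x -> (0 <= u%:E * (g (x, t))%:E)%E by move=> _; rewrite mule_ge0.
  have h2 (x : plane R) : setT x -> (0 <= s%:E * (\1_C ((x, t) : marked) : R)%:E)%E.
    by move=> _; rewrite mule_ge0.
  have k1 := measurable_funeM u%:E mg'.
  have k2 := measurable_funeM s%:E mC'.
  rewrite -i1 EFinD -i2 -(iA t).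
  rewrite -(ge0_integralD area measurableT _ m1 h1 k1)//.
  rewrite -(ge0_integralD area measurableT h2 k2 _ mA')//.
  by apply: eq_integral => x _; rewrite -!EFinM -!EFinD onem_cell_weight.
by rewrite EFinB -e addeK.
Qed.

Lemma iprod_cell_finite (s u : R) w M : (forall k, (M <= k)%N -> ~ W (X k w)) ->
  iprod (fun k => cell_weight s u (Z w k)) =
  (\prod_(0 <= k < M) (1 - s * \1_C (Z w k))) *
  \prod_(0 <= k < M) (1 - \1_A (Z w k) + u * g (Z w k)).
Proof.
move=> outW; rewrite (@iprodE _ _ M).
  by rewrite -big_split.
move=> k /outW Wk; rewrite /cell_weight !indicE !memNset; [|by move=> /AW|by move=> /CW].
by rewrite /= mulr0n gA; [ring|by move=> /AW].
Qed.

End cell_weights.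

(** * The derivative of the exponential along [1 / (n + 1)] *)

Section exponential_quotient.
Context {R : realType}.

Lemma cvg_expR_quotient (y : R) :
  (fun n => n.+1%:R * (expR (n.+1%:R^-1 * y) - 1)) @ \oo --> y.
Proof.
have inv0 : (fun n => n.+1%:R^-1 : R) @ \oo --> (0 : R) by exact: cvg_harmonic.
have xy : (fun n => n.+1%:R^-1 * y) @ \oo --> (0 : R).
  by rewrite -[X in _ --> X](mul0r y); apply: cvgM => //; exact: cvg_cst.
have sq : \forall n \near \oo, y <= n.+1%:R * (expR (n.+1%:R^-1 * y) - 1) <= y / (1 - n.+1%:R^-1 * y).
  near=> n.
  have x1 : n.+1%:R^-1 * y < 1.
    near: n; move/cvgr_lt : xy; apply; exact: ltr01.
  have n0 : 0 < n.+1%:R :> R by [].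
  have yE : y = n.+1%:R * (n.+1%:R^-1 * y) by rewrite mulrA divff ?mul1r// gt_eqF.
  move: x1 yE; set x := _^-1 * y => x1 yE.
  have e1 := expR_ge1Dx x.
  have e2 : expR x <= (1 - x)^-1.
    rewrite -[expR x]invrK -expRN lef_pV2 ?posrE ?expR_gt0 ?subr_gt0//.
    exact: expR_ge1Dx.
  rewrite yE; apply/andP; split.
    by rewrite ler_pM2l//; lra.
  rewrite -mulrA ler_pM2l//; apply: (@le_trans _ _ ((1 - x)^-1 - 1)); first by lra.
  by rewrite le_eqVlt; apply/orP; left; apply/eqP; field; rewrite gt_eqF// subr_gt0.
apply: (squeeze_cvgr sq (cvg_cst y)).
rewrite -[X in _ --> X]divr1; apply: cvgM; first exact: cvg_cst.
apply: cvgV; first exact: oner_neq0.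
rewrite -[X in _ --> X]subr0; apply: cvgB => //; exact: cvg_cst.
Unshelve. all: by end_near. Qed.

Lemma iprod_le_prod (a : nat -> R) K : (forall k, 0 <= a k <= 1) ->
  iprod a <= \prod_(0 <= k < K) a k.
Proof.
move=> a01; apply: nonincreasing_cvgn_ge; last exact: (cvg_iprod a01).
apply/nonincreasing_seqP => n; rewrite big_nat_recr//=.
have /andP[h0 _] := prod01 n a01; have /andP[_ a1] := a01 n.
by rewrite ler_piMr.
Qed.
End exponential_quotient.

(** * Mean number of points of a set *)

Section count_mean.
Context {d : measure_display} {T : measurableType d} {R : realType}.
Variables (P : probability T R) (lam : R) (X : nat -> {RV P >-> plane R})
    (Theta : nat -> {RV P >-> measurableTypeR R}).
Hypothesis net : mobile_network lam X Theta.
Hypothesis lam_gt0 : 0 < lam.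
Local Notation area := (@lebesgue_measure R \x @lebesgue_measure R)%E.
Local Notation marked := (plane R * measurableTypeR R)%type.
Local Notation Z w := (fun k : nat => (X k w, Theta k w) : marked).

Lemma measurable_count_marks (C : set marked) : measurable C ->
  measurable_fun setT (fun w => count C (Z w) : \bar R).
Proof.
move=> mC; apply: (@ge0_emeasurable_sum _ _ _ setT (fun k w => (\1_C (Z w k) : R)%:E) xpredT).
  by move=> k w _ _; rewrite lee_fin.
move=> k _; apply/measurable_EFinP.
by apply: measurable_mark; exact: measurable_indic.
Qed.

(** With [s = 1 / (n + 1)], the mean of [1 - prod (1 - s 1_C)] is
    [1 - exp (- s lam c)], at most [s lam c]; divided by [s] the left-hand side tends
    to the mean count, first for finitely many points. The bound makes the count
    available as a dominating function. *)
Lemma mean_count_le (W : set (plane R)) (C : set marked) (c : R) :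
  measurable W -> (area W < +oo)%E -> measurable C -> (forall z, C z -> W z.1) ->
  (forall t, \int[area]_x (\1_C ((x, t) : marked) : R)%:E = c%:E)%E ->
  (\int[P]_w count C (Z w) <= (lam * c)%:E)%E.
Proof.
move=> mW Wfin mC CW iC.
pose inv (n : nat) : R := n.+1%:R^-1.
have inv01 n : 0 <= inv n <= 1 by rewrite /inv invr_ge0 ler0n/= invf_le1// ler1n.
have mI : measurable_fun setT (\1_C : marked -> R) by exact: measurable_indic.
have c01 (z : marked) : 0 <= (\1_C z : R) <= 1 by rewrite indicE; case: (_ \in _); rewrite ?lexx ?ler01.
have w01 n w k : 0 <= 1 - inv n * \1_C (Z w k) <= 1.
  have /andP[h0 h1] := c01 (Z w k); have /andP[i0 i1] := inv01 n.
  have a0 : 0 <= inv n * \1_C (Z w k) by rewrite mulr_ge0.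
  have a1 : inv n * \1_C (Z w k) <= 1 by rewrite mulr_ile1.
  by apply/andP; split; lra.
have Eiprod n : (\int[P]_w (iprod (fun k => 1 - inv n * \1_C (Z w k)))%:E =
    (expR (- (inv n * (lam * c))))%:E)%E.
  have z01 (z : marked) : 0 <= (0 : R) <= 1 by rewrite lexx ler01.
  have i0 (t : measurableTypeR R) : (\int[area]_x (\1_(set0 : set marked) (x, t) : R)%:E = 0%:E)%E.
    by rewrite integral0_eq// => x _; rewrite indicE in_set0.
  have ig0 (t : measurableTypeR R) : (\int[area]_x (0 : R)%:E = 0%:E)%E by rewrite integral0_eq.
  have := @laplace_cell _ T R P lam X Theta net lam_gt0 W set0 C (fun=> 0) 0 c 0
    mW Wfin measurable0 mC (measurable_cst _) z01 (fun _ _ => erefl) (fun _ => False_ind _) CW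
    (fun _ => False_ind _) i0 iC ig0 (inv n) 0 (inv01 n) (z01 point).
  rewrite (_ : - lam * (inv n * c + 0 - 0 * 0) = - (inv n * (lam * c))); last by ring.
  move=> <-; apply: eq_integral => w _; congr (iprod _)%:E; apply/funext => k.
  by rewrite /cell_weight [\1_set0 _]indicE in_set0/= mulr0n; ring.
have partial K : (\int[P]_w (\sum_(0 <= k < K) \1_C (Z w k))%:E <= (lam * c)%:E)%E.
  have lim : (fun n => \int[P]_w (n.+1%:R * (1 - \prod_(0 <= k < K) (1 - inv n * \1_C (Z w k))))%:E)%E @ \oo -->
      (\int[P]_w (\sum_(0 <= k < K) \1_C (Z w k))%:E)%E.
    apply: (@bounded_convergence _ _ _ _ _ _ K%:R).
    - move=> n; apply: measurable_funM => //; apply: measurable_funB => //.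
      apply: measurable_prod => k _; apply: measurable_funB => //.
      by apply: measurable_funM => //; exact: (measurable_mark X Theta k mI).
    - by apply: measurable_sum => k; exact: (measurable_mark X Theta k mI).
    - apply: aeW => w; exact: cvg_onem_prod.
    - move=> n w.
      have /andP[h0 h1] := @onem_prod_bounds R (inv n) (fun k => \1_C (Z w k)) K (inv01 n) (fun k => c01 _).
      rewrite ger0_norm ?mulr_ge0//.
      apply: (@le_trans _ _ (n.+1%:R * (inv n * \sum_(0 <= k < K) \1_C (Z w k)))).
        by rewrite ler_wpM2l.
      rewrite mulrA divff// mul1r.
      apply: (@le_trans _ _ (\sum_(0 <= k < K) 1)); last by rewrite sumr_const_nat subn0.
      by apply: ler_sum => k _; case/andP: (c01 (Z w k)).
  apply: (cvge_le _ lim).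
  apply: nearW => n.
  have mip : measurable_fun setT (fun w => iprod (fun k => 1 - inv n * \1_C (Z w k))).
    apply: measurable_iprod => // k; apply: measurable_funB => //.
    by apply: measurable_funM => //; exact: (measurable_mark X Theta k mI).
  have mpr : measurable_fun setT (fun w => \prod_(0 <= k < K) (1 - inv n * \1_C (Z w k))).
    apply: measurable_prod => k _; apply: measurable_funB => //.
    by apply: measurable_funM => //; exact: (measurable_mark X Theta k mI).
  have ipr01 w := @iprod01 R _ (w01 n w).
  apply: (@le_trans _ _ (\int[P]_w (n.+1%:R%:E * (1 - iprod (fun k => 1 - inv n * \1_C (Z w k)))%:E))%E).
    apply: ge0_le_integral => //.
    - move=> w _; rewrite lee_fin mulr_ge0// subr_ge0.
      by case/andP: (prod01 K (w01 n w)).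
    - by apply/measurable_EFinP; apply: measurable_funM => //; exact: measurable_funB.
    - by apply: measurable_funeM; apply/measurable_EFinP; exact: measurable_funB.
    - move=> w _; rewrite -EFinM lee_fin ler_pM2l// lerD2l lerN2.
      exact: iprod_le_prod (w01 n w).
  rewrite ge0_integralZl//; last 2 first.
  - by apply/measurable_EFinP; exact: measurable_funB.
  - by move=> w _; rewrite lee_fin subr_ge0; case/andP: (ipr01 w).
  have E1 : (\int[P]_w (1 - iprod (fun k => 1 - inv n * \1_C (Z w k)))%:E =
      (1 - expR (- (inv n * (lam * c))))%:E)%E.
    apply: (@integral_bounded_diff _ T R P (fun=> 1)) => //.
    - by move=> w; rewrite normr1 ler1n.
    - move=> w; case/andP: (ipr01 w) => h0 h1.
      by rewrite ger0_norm// (le_trans h1)// ler1n.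
    - by rewrite integral_cst//= probability_setT mule1.
  rewrite E1 -EFinM lee_fin.
  apply: (@le_trans _ _ (n.+1%:R * (inv n * (lam * c)))); last first.
    by rewrite mulrA divff// mul1r.
  rewrite ler_pM2l//; have := expR_ge1Dx (- (inv n * (lam * c))); lra.
rewrite /count integral_nneseries//; last first.
  move=> k; apply/measurable_EFinP; exact: (measurable_mark X Theta k mI).
apply: lime_le; first by apply: is_cvg_nneseries => k _ _; apply: integral_ge0 => w _; rewrite lee_fin.
apply: nearW => K; apply: le_trans (partial K).
rewrite -ge0_integral_sum//.
  rewrite le_eqVlt; apply/orP; left; apply/eqP; apply: eq_integral => w _.
  by rewrite sumEFin.
move=> k; apply/measurable_EFinP; exact: (measurable_mark X Theta k mI).
Qed.
End count_mean.

(** * A point of one set and the sole point of another *)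

Section cell_formula.
Context {d : measure_display} {T : measurableType d} {R : realType}.
Variables (P : probability T R) (lam : R) (X : nat -> {RV P >-> plane R})
    (Theta : nat -> {RV P >-> measurableTypeR R}).
Hypothesis net : mobile_network lam X Theta.
Hypothesis lam_gt0 : 0 < lam.
Local Notation area := (@lebesgue_measure R \x @lebesgue_measure R)%E.
Local Notation marked := (plane R * measurableTypeR R)%type.
Local Notation Z w := (fun k : nat => (X k w, Theta k w) : marked).

Lemma measurable_alone (A : set marked) j : measurable A ->
  measurable [set w | alone A (Z w) j].
Proof.
move=> mA.
rewrite (_ : [set w | _] = \bigcap_(k in [set k | k != j]) ~` [set w | A (Z w k)]).
  apply: bigcap_measurable; first by exists j.+1 => //=; rewrite gtn_eqF.
  move=> k _; apply: measurableC; rewrite -[X in measurable X]setTI.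
  have mZ : measurable_fun setT (fun w => (X k w, Theta k w) : marked).
    exact: measurable_fun_pair.
  exact: mZ.
by apply/seteqP; split => w /=.
Qed.

Lemma measurable_sole_sum (A : set marked) (g : marked -> R) : measurable A ->
  measurable_fun setT g -> (forall z, 0 <= g z) ->
  measurable_fun setT (fun w => sole_sum A g (Z w)).
Proof.
move=> mA mg g0.
apply: (@ge0_emeasurable_sum _ _ _ setT (fun j w => (sole_term A g (Z w) j)%:E) xpredT).
  by move=> k w _ _; rewrite lee_fin mulr_ge0.
move=> j _; apply/measurable_EFinP; apply: measurable_funM.
  exact: (measurable_mark X Theta j mg).
rewrite (_ : (fun w => _) = \1_[set w | alone A (Z w) j]).
  by apply: measurable_indic; exact: measurable_alone.
by apply/funext => w; rewrite indicE; case: asboolP => h; [rewrite mem_set|rewrite memNset].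
Qed.

Lemma sole_sum_ge0 (A : set marked) (g : marked -> R) z : (forall z, 0 <= g z) ->
  (0 <= sole_sum A g z)%E.
Proof. by move=> g0; apply: nneseries_ge0 => k _ _; rewrite lee_fin mulr_ge0. Qed.

(** The Laplace functional with weight [cell_weight] is
    [exp (- lam (s c + a - u gam))]. Its mixed derivative in [- s] and [u] at 0 is the
    right-hand side; inside the expectation the same derivative produces
    the product of the count and of the sole sum. The derivatives are taken as
    difference quotients with the same step [1 / (n + 1)] in both variables, which
    are dominated by the count. *)
Theorem cell_formula (W : set (plane R)) (A C : set marked) (g : marked -> R) (a c gam : R) :
  measurable W -> (area W < +oo)%E ->
  measurable A -> measurable C -> measurable_fun setT g ->
  (forall z, 0 <= g z <= 1) -> (forall z, ~ A z -> g z = 0) ->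
  (forall z, A z -> W z.1) -> (forall z, C z -> W z.1) -> (forall z, A z -> ~ C z) ->
  (forall t, \int[area]_x (\1_A ((x, t) : marked) : R)%:E = a%:E)%E ->
  (forall t, \int[area]_x (\1_C ((x, t) : marked) : R)%:E = c%:E)%E ->
  (forall t, \int[area]_x (g (x, t))%:E = gam%:E)%E ->
  (\int[P]_w (count C (Z w) * sole_sum A g (Z w)) =
   (lam * c * (lam * gam) * expR (- (lam * a)))%:E)%E.
Proof.
move=> mW Wfin mA mC mg g01 gA AW CW AC iA iC ig.
pose inv (n : nat) : R := n.+1%:R^-1.
have inv01 n : 0 <= inv n <= 1 by rewrite /inv invr_ge0 ler0n/= invf_le1// ler1n.
have z01 : 0 <= (0 : R) <= 1 by rewrite lexx ler01.
have g0 z : 0 <= g z by case/andP: (g01 z).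
pose F (s u : R) w := iprod (fun k => cell_weight A C g s u (Z w k)).
pose e (s u : R) := expR (- lam * (s * c + a - u * gam)).
have EF s u : 0 <= s <= 1 -> 0 <= u <= 1 -> (\int[P]_w (F s u w)%:E = (e s u)%:E)%E.
  by move=> s01 u01; exact: (laplace_cell net lam_gt0 mW Wfin mA mC mg).
have mF s u : 0 <= s <= 1 -> 0 <= u <= 1 -> measurable_fun setT (F s u).
  move=> s01 u01; apply: measurable_iprod => [k|k w].
    by apply: (measurable_mark X Theta k); exact: measurable_cell_weight.
  exact: cell_weight01.
have F01 s u w : 0 <= s <= 1 -> 0 <= u <= 1 -> 0 <= F s u w <= 1.
  by move=> s01 u01; apply: iprod01 => k; exact: cell_weight01.
(* the mixed difference quotient, with the sign of the derivative in - s *)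
pose D n w := n.+1%:R * n.+1%:R * ((F 0 (inv n) w - F 0 0 w) - (F (inv n) (inv n) w - F (inv n) 0 w)).
have ED n : (\int[P]_w (D n w)%:E = (expR (- (lam * a)) * (- (n.+1%:R * (expR (inv n * (- (lam * c))) - 1))) *
   (n.+1%:R * (expR (inv n * (lam * gam)) - 1)))%:E)%E.
  have bnd s u w : 0 <= s <= 1 -> 0 <= u <= 1 -> `|F s u w| <= 2.
    move=> s01 u01; have /andP[h0 h1] := F01 s u w s01 u01.
    by rewrite ger0_norm// (le_trans h1)// ler1n.
  have bnd1 s u s' u' w : 0 <= s <= 1 -> 0 <= u <= 1 -> 0 <= s' <= 1 -> 0 <= u' <= 1 ->
      `|F s u w - F s' u' w| <= 2.
    move=> s01 u01 s01' u01'; have h := F01 s u w s01 u01; have h' := F01 s' u' w s01' u01'.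
    by rewrite ler_norml; apply/andP; split; lra.
  have i1 := inv01 n.
  have E1 := integral_bounded_diff (mF _ _ z01 i1) (mF _ _ z01 z01) (fun w => bnd _ _ w z01 i1)
     (fun w => bnd _ _ w z01 z01) (EF _ _ z01 i1) (EF _ _ z01 z01).
  have E2 := integral_bounded_diff (mF _ _ i1 i1) (mF _ _ i1 z01) (fun w => bnd _ _ w i1 i1)
     (fun w => bnd _ _ w i1 z01) (EF _ _ i1 i1) (EF _ _ i1 z01).
  have m1 := measurable_funB (mF _ _ z01 i1) (mF _ _ z01 z01).
  have m2 := measurable_funB (mF _ _ i1 i1) (mF _ _ i1 z01).
  have E3 := integral_bounded_diff m1 m2 (fun w => bnd1 _ _ _ _ w z01 i1 z01 z01)
     (fun w => bnd1 _ _ _ _ w i1 i1 i1 z01) E1 E2.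
  have m3 := measurable_funB m1 m2.
  have int3 : P.-integrable setT (fun w => ((F 0 (inv n) w - F 0 0 w) - (F (inv n) (inv n) w - F (inv n) 0 w))%:E).
    apply: measurable_bounded_integrable => //.
      by rewrite (le_lt_trans (probability_le1 _ _))// ltry.
    exists 4; split => // y y4 w _ /=; apply: le_trans (ltW y4).
    have h1 := bnd1 _ _ _ _ w z01 i1 z01 z01; have h2 := bnd1 _ _ _ _ w i1 i1 i1 z01.
    by apply: le_trans (ler_normB _ _) _; lra.
  rewrite /D; under eq_integral do rewrite EFinM.
  rewrite integralZl// E3 -EFinM; congr EFin.
  rewrite /e.
  have -> : expR (- lam * (0 * c + a - inv n * gam)) = expR (- (lam * a)) * expR (inv n * (lam * gam)).
    by rewrite -expRD; congr expR; ring.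
  have -> : expR (- lam * (0 * c + a - 0 * gam)) = expR (- (lam * a)) by congr expR; ring.
  have -> : expR (- lam * (inv n * c + a - inv n * gam)) =
      expR (- (lam * a)) * expR (inv n * (- (lam * c))) * expR (inv n * (lam * gam)).
    by rewrite -!expRD; congr expR; ring.
  have -> : expR (- lam * (inv n * c + a - 0 * gam)) = expR (- (lam * a)) * expR (inv n * (- (lam * c))).
    by rewrite -!expRD; congr expR; ring.
  by ring.
have lim1 : (fun n => \int[P]_w (D n w)%:E)%E @ \oo -->
    (lam * c * (lam * gam) * expR (- (lam * a)))%:E.
  under eq_fun do rewrite ED.
  apply: cvg_EFin_seq.
  rewrite (_ : lam * c * (lam * gam) * expR (- (lam * a)) =
    expR (- (lam * a)) * (- (- (lam * c))) * (lam * gam)); last by ring.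
  apply: cvgM; last exact: cvg_expR_quotient.
  apply: cvgM; first exact: cvg_cst.
  by apply: cvgN; exact: cvg_expR_quotient.
have intN : P.-integrable setT (fun w => count C (Z w) : \bar R).
  apply/integrableP; split; first exact: measurable_count_marks.
  rewrite (eq_integral (fun w => count C (Z w))).
    apply: (@le_lt_trans _ _ (lam * c)%:E); last exact: ltry.
    exact: (mean_count_le net lam_gt0 mW Wfin mC CW iC).
  by move=> w _; rewrite gee0_abs// nneseries_ge0// => k _ _; rewrite lee_fin.
(* the quotient factors once finitely many stations lie in W *)
have goodE n w M : (forall k, (M <= k)%N -> ~ W (X k w)) -> D n w =
   (n.+1%:R * (1 - \prod_(0 <= k < M) (1 - inv n * \1_C (Z w k)))) *
   (n.+1%:R * (\prod_(0 <= k < M) (1 - \1_A (Z w k) + inv n * g (Z w k)) -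
     \prod_(0 <= k < M) (1 - \1_A (Z w k)))).
  move=> outW; rewrite /D /F !(iprod_cell_finite Theta gA AW CW _ _ outW).
  rewrite [X in X * \prod_(0 <= k < M) (1 - \1_A (Z w k) + inv n * _) - _ - _]big1; last first.
    by move=> k _; rewrite mul0r subr0.
  rewrite [X in _ - X * \prod_(0 <= k < M) (1 - \1_A (Z w k) + 0 * _) - _]big1; last first.
    by move=> k _; rewrite mul0r subr0.
  rewrite (_ : \prod_(0 <= k < M) (1 - \1_A (Z w k) + 0 * g (Z w k)) = \prod_(0 <= k < M) (1 - \1_A (Z w k))).
    by ring.
  by apply: eq_bigr => k _; rewrite mul0r addr0.
have ae := ae_finite_in (network_poisson net) lam_gt0 mW Wfin.
have ag w k : \1_A (Z w k) = 1 :> R \/ \1_A (Z w k) = 0 :> R /\ g (Z w k) = 0.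
  rewrite indicE; case: (boolP (Z w k \in A)) => ZA; [by left|right; split=> //].
  by apply: gA; move: ZA; rewrite notin_setE.
have c01 (z : marked) : 0 <= (\1_C z : R) <= 1 by rewrite indicE; case: (_ \in _); rewrite ?lexx ?ler01.
have [] := @dominated_convergence _ T R P setT measurableT (fun n w => (D n w)%:E)
   (fun w => count C (Z w) * sole_sum A g (Z w))%E (fun w => count C (Z w)) _ _ _ intN _.
- move=> n; apply/measurable_EFinP; apply: measurable_funM => //.
  by apply: measurable_funB; apply: measurable_funB; apply: mF.
- apply: emeasurable_funM; first exact: measurable_count_marks.
  exact: measurable_sole_sum.
- apply: filterS ae => w [M outW] _.
  rewrite (@count_finite _ _ _ _ M); last by move=> k Mk /CW; exact: outW.
  rewrite (@sole_sum_finite _ _ _ _ _ M)//; last by move=> k Mk /AW; exact: outW.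
  rewrite -EFinM; apply: cvg_EFin_seq.
  under eq_fun do rewrite (goodE _ _ _ outW).
  apply: cvgM; first exact: cvg_onem_prod.
  exact: (@cvg_prod_diff R (fun k => 1 - \1_A (Z w k)) (fun k => g (Z w k)) M).
- apply: filterS ae => w [M outW] n _.
  rewrite (@count_finite _ _ _ _ M); last by move=> k Mk /CW; exact: outW.
  rewrite (goodE _ _ _ outW) lee_fin.
  have /andP[h0 h1] := @onem_prod_bounds R (inv n) (fun k => \1_C (Z w k)) M (inv01 n) (fun k => c01 _).
  have /andP[k0 k1] := @mark_prod_bounds R (inv n) (fun k => \1_A (Z w k)) (fun k => g (Z w k)) M (inv01 n) (fun k => g01 _) (ag w).
  rewrite ger0_norm; last by apply: mulr_ge0; apply: mulr_ge0.
  have nn : n.+1%:R * inv n = 1 by rewrite divff.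
  set p := 1 - _ in h0 h1 *; set q := _ - _ in k0 k1 *; set S := \sum_(0 <= k < M) _ in h1 *.
  have -> : S = (n.+1%:R * (inv n * S)) * (n.+1%:R * inv n) by rewrite nn mulr1 mulrA nn mul1r.
  by apply: ler_pM; rewrite ?mulr_ge0// ler_pM2l.
move=> _ _ lim2.
exact: (cvg_unique (@ereal_hausdorff _) lim2 lim1).
Qed.
End cell_formula.

(** * The motion of a station in its own frame *)

Section geometry.
Context {R : realType}.
Local Notation leb := (@lebesgue_measure R).
Local Notation area := (leb \x leb)%E.
Local Notation marked := (plane R * measurableTypeR R)%type.
Variable v : R.
Hypothesis v_gt0 : 0 < v.

(** [along] and [across] are the coordinates of the initial position in the axes
    turned by the angle of motion. *)
Definition along (z : marked) : R := z.1.1 * cos z.2 + z.1.2 * sin z.2.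
Definition across (z : marked) : R := z.1.2 * cos z.2 - z.1.1 * sin z.2.
Definition arrival (z : marked) : R := - along z / v.
Definition sqdist (z : marked) (t : R) : R :=
  (z.1.1 + v * t * cos z.2) ^+ 2 + (z.1.2 + v * t * sin z.2) ^+ 2.

Lemma cos2sin2 (a : R) : cos a ^+ 2 = 1 - sin a ^+ 2.
Proof. by rewrite -(cos2Dsin2 a) addrK. Qed.

Lemma sqdist_frame z t : sqdist z t = (along z + v * t) ^+ 2 + across z ^+ 2.
Proof.
rewrite /sqdist /along /across; have := cos2sin2 z.2.
set c := cos _; set s := sin _; move=> h; ring: h.
Qed.

Lemma sqdist_arrival z t : sqdist z t = (v * (t - arrival z)) ^+ 2 + across z ^+ 2.
Proof.
rewrite sqdist_frame /arrival; congr (_ ^+ 2 + _).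
by field; rewrite gt_eqF.
Qed.

Lemma normsq_frame z : normsq z.1 = along z ^+ 2 + across z ^+ 2.
Proof.
rewrite /normsq /along /across; have := cos2sin2 z.2.
set c := cos _; set s := sin _; move=> h; ring: h.
Qed.

Lemma measurable_cos_angle : measurable_fun setT (fun z : marked => cos z.2).
Proof.
have mc : measurable_fun setT (@cos R : measurableTypeR R -> R).
  by apply: continuous_measurable_fun; exact: continuous_cos.
exact: (measurableT_comp mc (@measurable_snd _ _ _ _)).
Qed.

Lemma measurable_sin_angle : measurable_fun setT (fun z : marked => sin z.2).
Proof.
have mc : measurable_fun setT (@sin R : measurableTypeR R -> R).
  by apply: continuous_measurable_fun; exact: continuous_sin.
exact: (measurableT_comp mc (@measurable_snd _ _ _ _)).
Qed.

Lemma measurable_first : measurable_fun setT (fun z : marked => z.1.1).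
Proof. exact: (measurableT_comp (@measurable_fst _ _ _ _) (@measurable_fst _ _ _ _)). Qed.

Lemma measurable_second : measurable_fun setT (fun z : marked => z.1.2).
Proof. exact: (measurableT_comp (@measurable_snd _ _ _ _) (@measurable_fst _ _ _ _)). Qed.

Lemma measurable_along : measurable_fun setT along.
Proof.
apply: measurable_funD; apply: measurable_funM.
- exact: measurable_first.
- exact: measurable_cos_angle.
- exact: measurable_second.
- exact: measurable_sin_angle.
Qed.

Lemma measurable_across : measurable_fun setT across.
Proof.
apply: measurable_funB; apply: measurable_funM.
- exact: measurable_second.
- exact: measurable_cos_angle.
- exact: measurable_first.
- exact: measurable_sin_angle.
Qed.

Lemma measurable_arrival : measurable_fun setT arrival.
Proof. by apply: measurable_funM => //; apply: measurable_funN; exact: measurable_along. Qed.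

Lemma measurable_sqdist t : measurable_fun setT (sqdist ^~ t).
Proof.
rewrite (_ : sqdist ^~ t = fun z => (along z + v * t) ^+ 2 + across z ^+ 2); last first.
  by apply/funext => z; rewrite sqdist_frame.
apply: measurable_funD; apply: measurable_funX; last exact: measurable_across.
by apply: measurable_funD => //; exact: measurable_along.
Qed.

Lemma measurable_sqdist_at_arrival :
  measurable_fun setT (fun y : marked * marked => sqdist y.2 (arrival y.1)).
Proof.
rewrite (_ : (fun y => _) = (fun y : marked * marked =>
    (along y.2 + v * arrival y.1) ^+ 2 + across y.2 ^+ 2)); last first.
  by apply/funext => y; rewrite sqdist_frame.
apply: measurable_funD; last first.
  apply: measurable_funX.
  exact: (measurableT_comp measurable_across (@measurable_snd _ _ _ _)).
apply: measurable_funX; apply: measurable_funD.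
  exact: (measurableT_comp measurable_along (@measurable_snd _ _ _ _)).
apply: measurable_funM => //.
exact: (measurableT_comp measurable_arrival (@measurable_fst _ _ _ _)).
Qed.

Definition cell (t1 t2 h1 h2 : R) : set marked :=
  [set z | t1 <= arrival z < t2 /\ h1 <= `|across z| < h2].

Definition nearer (t h : R) : set marked := [set z | sqdist z t < h ^+ 2].

Lemma measurable_cell t1 t2 h1 h2 : measurable (cell t1 t2 h1 h2).
Proof.
have -> : cell t1 t2 h1 h2 = (arrival @^-1` `[t1, t2[) `&` ((fun z => `|across z|) @^-1` `[h1, h2[).
  by apply/seteqP; split => z /=; rewrite /cell/= !in_itv.
apply: measurableI; rewrite -[X in measurable X]setTI.
  by apply: measurable_arrival => //; exact: measurable_itv.
have h : measurable_fun setT (fun z => `|across z|).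
  by apply: measurableT_comp => //; exact: measurable_across.
by apply: h => //; exact: measurable_itv.
Qed.

Lemma measurable_nearer t h : measurable (nearer t h).
Proof.
have -> : nearer t h = (sqdist ^~ t) @^-1` `]-oo, h ^+ 2[.
  by apply/seteqP; split => z /=; rewrite in_itv.
rewrite -[X in measurable X]setTI.
by apply: measurable_sqdist => //; exact: measurable_itv.
Qed.

Lemma lebesgue_annulus (h1 h2 : R) : 0 <= h1 -> h1 <= h2 ->
  leb [set y | h1 <= `|y| < h2] = (2 * (h2 - h1))%:E.
Proof.
move=> h10 h12.
have E (h : R) : 0 <= h -> leb `]- h, h[ = (2 * h)%:E.
  move=> h0; rewrite lebesgue_measure_itv/= lte_fin.
  case: ltP => hh; first by rewrite -EFinB; congr EFin; ring.
  by congr EFin; lra.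
rewrite (_ : [set y | _] = `]- h2, h2[ `\` `]- h1, h1[); last first.
  apply/seteqP; split => y /=; rewrite !in_itv/= -!ltr_norml.
    by move=> /andP[y1 y2]; split => //; apply/negP; rewrite -leNgt.
  by move=> [y2 /negP]; rewrite -leNgt => ->.
rewrite measureD//=; last by rewrite E ?ltry// (le_trans h10).
rewrite setIidr; last first.
  move=> y /=; rewrite !in_itv/= -!ltr_norml => yh; exact: lt_le_trans yh h12.
rewrite !E// ?(le_trans h10)// -EFinB; congr EFin; ring.
Qed.

(** For a fixed angle the cell is the inverse image by a rotation of the product of an
    interval of length [v * (t2 - t1)] with two intervals of length [h2 - h1]. *)
Lemma cell_section_area t1 t2 h1 h2 (a : measurableTypeR R) : t1 <= t2 -> 0 <= h1 -> h1 <= h2 ->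
  (\int[area]_x (\1_(cell t1 t2 h1 h2) ((x, a) : marked) : R)%:E =
   (2 * v * (t2 - t1) * (h2 - h1))%:E)%E.
Proof.
move=> t12 h10 h12.
pose rot := fun x : plane R => (cos a * x.1 + sin a * x.2, cos a * x.2 - sin a * x.1) : plane R.
have [mrot arot] := rotation_area (cos2Dsin2 a).
pose S := [set y : measurableTypeR R | h1 <= `|y : R| < h2].
have mS : measurable S.
  have -> : S = (fun y : measurableTypeR R => `|y : R|) @^-1` `[h1, h2[.
    by apply/seteqP; split => y /=; rewrite in_itv.
  rewrite -[X in measurable X]setTI.
  by apply: (@normr_measurable R setT) => //; exact: measurable_itv.
pose B : set (plane R) := `](- (v * t2)), (- (v * t1))] `*` S.
have mB : measurable B by exact: measurableX.
transitivity (area (rot @^-1` B)).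
  rewrite -[X in area X]setIT -integral_indic//; last first.
    by rewrite -[X in measurable X]setTI; exact: mrot.
  apply: eq_integral => x _; rewrite !indicE; congr (_ %:R%:E); congr nat_of_bool.
  apply/idP/idP; rewrite !inE /cell /B /rot /S /= in_itv/=.
    rewrite /arrival /along /across /= => -[/andP[a1 a2] h]; split.
      move: a1 a2; rewrite ler_pdivlMr// ltr_pdivrMr// => a1 a2.
      by apply/andP; split; lra.
    by rewrite [cos a * _]mulrC [sin a * _]mulrC.
  rewrite /arrival /along /across /= => -[/andP[a1 a2] h]; split.
    rewrite ler_pdivlMr// ltr_pdivrMr//.
    by apply/andP; split; lra.
  by rewrite [x.2 * _]mulrC [x.1 * _]mulrC.
rewrite arot// /B areaX//.
rewrite lebesgue_annulus// lebesgue_measure_itv/= lte_fin.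
case: ltP => tt.
  by rewrite -EFinB -EFinM; congr EFin; ring.
rewrite mul0e; congr EFin.
have -> : t2 = t1 by apply/eqP; rewrite eq_le t12 andbT -(ler_pM2l v_gt0) -lerN2.
by rewrite subrr mulr0 mul0r.
Qed.

(** For a fixed angle the position at time [t] is a translation of the initial
    one; what remains is a radial integral over a disc. *)
Lemma nearer_section_integral (t h : R) (a : measurableTypeR R) (f : R -> R) :
  0 <= h -> measurable_fun setT (f : measurableTypeR R -> R) -> (forall s, 0 <= f s) ->
  (\int[area]_x (f (sqdist (x, a) t) * \1_(nearer t h) ((x, a) : marked))%:E =
   pi%:E * \int[leb]_(s in `[0%R, (h ^+ 2)%R[) (f s)%:E)%E.
Proof.
move=> h0 mf f0.
pose F (s : measurableTypeR R) : \bar R := (f s * ((s : R) < h ^+ 2)%R%:R)%:E.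
have mF : measurable_fun setT F.
  apply/measurable_EFinP; apply: measurable_funM => //.
  rewrite (_ : (fun s => _) = \1_`]-oo, h ^+ 2[).
    by apply: measurable_indic; exact: measurable_itv.
  apply/funext => s; rewrite indicE; congr (_ %:R); congr nat_of_bool.
  by apply/idP/idP; rewrite inE/= in_itv.
have F0 s : (0 <= F s)%E by rewrite lee_fin mulr_ge0.
pose shift := fun x : plane R => (x.1 + v * t * cos a, x.2 + v * t * sin a) : plane R.
have ashift := area_preserving_translation (v * t * cos a, v * t * sin a).
have mFn : measurable_fun setT (F \o normsq : plane R -> _).
  by apply: measurableT_comp => //; exact: measurable_normsq.
transitivity (\int[area]_x (F \o normsq) (shift x))%E.
  apply: eq_integral => x _; rewrite /F /= indicE; congr ((_ * _ %:R)%:E).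
  by congr nat_of_bool; apply/idP/idP; rewrite inE.
rewrite (area_preserving_integral ashift mFn); last by move=> y; exact: F0.
rewrite (polar_integral mF F0); congr (_ * _)%E.
rewrite [LHS]integral_mkcond [RHS]integral_mkcond; apply: eq_integral => s _.
rewrite !patchE /F; case: ifPn; case: ifPn; rewrite ?inE ?notin_setE /= !in_itv/= ?andbT.
- by move=> /andP[_ ->] _; rewrite mulr1.
- by move=> h1 s0; move: h1; rewrite s0/= => /negP/negbTE ->; rewrite mulr0.
- by move=> /andP[-> _].
- by [].
Qed.

End geometry.

(** * Level sets of a sinusoid *)

Section angle_level_sets.
Context {R : realType}.
Local Notation leb := (@lebesgue_measure R).
Local Notation U := (uniform_prob (ltNpi_pi R)).

(** Eliminating the sine leaves a quadratic equation for the cosine. *)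
Lemma cos_level_roots (p q c C S : R) : 0 < p ^+ 2 + q ^+ 2 -> C ^+ 2 + S ^+ 2 = 1 ->
  p * C + q * S = c ->
  let D := p ^+ 2 + q ^+ 2 in let e := (c * p) ^+ 2 - D * (c ^+ 2 - q ^+ 2) in
  C = (c * p + Num.sqrt e) / D \/ C = (c * p - Num.sqrt e) / D.
Proof.
move=> D0 CS pq D e.
have DN : D != 0 by rewrite gt_eqF.
have e1 : (D * C - c * p) ^+ 2 = e.
  rewrite /e /D -pq.
  have : S ^+ 2 = 1 - C ^+ 2 by rewrite -CS addrAC subrr add0r.
  move=> h; ring: h.
have e2 : `|D * C - c * p| = Num.sqrt e by rewrite -e1 sqrtr_sqr.
have [h|h] := lerP 0 (D * C - c * p).
  by left; rewrite -e2 ger0_norm//; field.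
by right; rewrite -e2 ltr0_norm//; field.
Qed.

(** The two possible cosines leave at most four angles in [[-pi, pi]], and the uniform
    law charges no finite set. *)
Lemma angle_level_null (p q c : R) (A : set (measurableTypeR R)) : measurable A ->
  0 < p ^+ 2 + q ^+ 2 -> (forall a, A a -> p * cos a + q * sin a = c) -> U A = 0%E.
Proof.
move=> mA D0 Ac.
pose D := p ^+ 2 + q ^+ 2; pose e := (c * p) ^+ 2 - D * (c ^+ 2 - q ^+ 2).
pose r1 := acos ((c * p + Num.sqrt e) / D); pose r2 := acos ((c * p - Num.sqrt e) / D).
pose F : set (measurableTypeR R) := [set r1] `|` [set - r1] `|` [set r2] `|` [set - r2].
have finF : finite_set F by rewrite !finite_setU; do !split; exact: finite_set1.
have mF : measurable F by do 3 (apply: measurableU; last exact: measurable_set1); exact: measurable_set1.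
have F0 : leb F = 0%E by apply: countable_lebesgue_measure0; exact: finite_set_countable.
have UF0 : U F = 0%E.
  by have /null_content_dominatesP := dominates_uniform_prob (ltNpi_pi R); apply.
have AF : A `&` `[- pi, pi] `<=` F.
  move=> a [/Ac h]; rewrite /= in_itv/= => /andP[a1 a2].
  have h2 := cos_level_roots D0 (cos2Dsin2 a) h.
  have ca : acos (cos a) = a \/ acos (cos a) = - a.
    have [a0|a0] := lerP 0 a; [left|right].
      by rewrite cosK// in_itv/= a0.
    by rewrite -cosN cosK// in_itv/=; apply/andP; split; lra.
  rewrite /F /r1 /r2 /e /D; case: h2 => h2; rewrite -h2.
    by left; left; case: ca => ->; rewrite ?opprK; [left|right].
  by case: ca => ->; rewrite ?opprK; [left; right|right].
have mA' : measurable (A `&` `[- pi, pi]) by apply: measurableI => //; exact: measurable_itv.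
transitivity (U (A `&` `[- pi, pi])).
  by rewrite /uniform_prob [LHS]integral_uniform_pdf [RHS]integral_uniform_pdf -setIA setIid.
exact: (subset_measure0 mA' mF AF UF0).
Qed.
End angle_level_sets.

(** * Almost sure properties of the network *)

Section general_position.
Context {d : measure_display} {T : measurableType d} {R : realType}.
Variables (P : probability T R) (lam v : R) (X : nat -> {RV P >-> plane R})
    (Theta : nat -> {RV P >-> measurableTypeR R}).
Hypothesis net : mobile_network lam X Theta.
Hypotheses (lam_gt0 : 0 < lam) (v_gt0 : 0 < v).
Local Notation leb := (@lebesgue_measure R).
Local Notation area := (leb \x leb)%E.
Local Notation marked := (plane R * measurableTypeR R)%type.
Local Notation U := (uniform_prob (ltNpi_pi R)).
Local Notation Z k w := ((X k w, Theta k w) : marked).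

(** Station [i] and the position of [j] being frozen, the angle of [j] is still
    uniform. *)
Lemma pair_angle_null (B : set (marked * marked)) i j : measurable B -> i != j ->
  (forall z x, U [set a | B (z, (x, a))] = 0%E) ->
  {ae P, forall w, ~ B (Z i w, Z j w)}.
Proof.
move=> mB ij B0.
pose G : T -> marked * marked := fun w => (Z i w, Z j w).
have mG : measurable_fun setT G by do 2 apply: measurable_fun_pair => //.
have mGB : measurable (G @^-1` B) by rewrite -[X in measurable X]setTI; exact: mG.
exists (G @^-1` B); split => //; last by move=> w /=; rewrite not_notE.
pose Y := g_sigma_algebraType (known X Theta [:: i]).
pose H (y : Y * measurableTypeR R) : marked * marked := ((X i y.1, Theta i y.1), (X j y.1, y.2)).
have mX k : measurable_fun setT (fun y : Y * measurableTypeR R => X k y.1 : plane R).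
  exact: (measurableT_comp (@known_X _ _ _ P X Theta [:: i] k) (@measurable_fst _ _ _ _)).
have mTh : measurable_fun setT (fun y : Y * measurableTypeR R => Theta i y.1 : measurableTypeR R).
  exact: (measurableT_comp (@known_Theta _ _ _ P X Theta [:: i] i (mem_head _ _)) (@measurable_fst _ _ _ _)).
have mH : measurable_fun setT H.
  apply: measurable_fun_pair; apply: measurable_fun_pair => //.
pose f (y : Y * measurableTypeR R) : \bar R := (\1_B (H y))%:E.
have mf : measurable_fun setT f.
  apply/measurable_EFinP.
  by apply: (@measurableT_comp _ _ _ _ _ _ (\1_B : _ -> R)) => //; exact: measurable_indic.
have f0 y : (0 <= f y)%E by rewrite lee_fin.
have js : j \notin [:: i] by rewrite inE eq_sym.
have := @integrate_angle _ _ _ _ _ _ _ net [:: i] j f erefl js mf f0.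
rewrite (_ : (\int[P]_w f (w, Theta j w) = P (G @^-1` B))%E); last first.
  rewrite -[X in P X]setIT -integral_indic//.
have -> : (\int[P]_w \int[U]_a f (w, a) = 0)%E.
  rewrite integral0_eq// => w _.
  pose Bw : set (measurableTypeR R) := [set a | B ((X i w, Theta i w), (X j w, a))].
  have mBw : measurable Bw.
    have mp : measurable_fun setT (fun a : measurableTypeR R => ((X i w, Theta i w), (X j w, a)) : marked * marked).
      by do 2 apply: measurable_fun_pair => //.
    by rewrite -[X in measurable X]setTI; exact: mp.
  transitivity (\int[U]_a (\1_Bw a)%:E)%E; first by [].
  by rewrite integral_indic// setIT; exact: B0.
by [].
Qed.

Lemma angle_null (B : set marked) j : measurable B ->
  (forall x, U [set a | B (x, a)] = 0%E) ->
  {ae P, forall w, ~ B (Z j w)}.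
Proof.
move=> mB B0.
have mB2 : measurable (snd @^-1` B : set (marked * marked)).
  by rewrite -[X in measurable X]setTI; exact: (@measurable_snd _ _ marked marked).
have := @pair_angle_null (snd @^-1` B) j.+1 j mB2.
by apply; rewrite ?gtn_eqF// => z x; exact: B0.
Qed.

(** The origin has area 0, so the number of stations there is Poisson of
    parameter 0. *)
Lemma ae_off_origin i : {ae P, forall w, 0 < normsq (X i w)}.
Proof.
pose B : set (plane R) := [set 0] `*` [set 0].
have m1 (x : R) : measurable ([set x] : set (measurableTypeR R)) by exact: measurable_set1.
have mB : measurable B by exact: measurableX.
have B0 : area B = 0%E by rewrite areaX// lebesgue_measure_set1 mule0.
have Bfin : (area B < +oo)%E by rewrite B0.
have := count_law (network_poisson net) 0 mB Bfin.
rewrite B0 /= mulr0 /pois oppr0 expR0 expr0 mulr1 fact0 divr1 => P1.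
have mE := measurable_count X 0 mB.
exists (~` [set w | point_measure X w B = (0%N)%:R%:E]); split.
- exact: measurableC.
- by apply/eqP; rewrite probability_setC// P1 subee.
- move=> w /= Xw pw; apply: Xw.
  rewrite lt0r normsq_ge0 andbT; apply/eqP => n0.
  have Bw : B (X i w).
    move: n0; rewrite /normsq => /eqP; rewrite paddr_eq0 ?sqr_ge0// !sqrf_eq0.
    by move=> /andP[/eqP h1 /eqP h2]; split.
  have := @nneseries_lim_ge R (fun n => ((X n w \in B)%:R : R)%:E) xpredT 0 i.+1.
  move: pw; rewrite point_measureE => -> h.
  have {}h := h (fun n _ _ => (ltac:(by rewrite lee_fin))).
  move: h; rewrite sumEFin lee_fin big_nat_recr//= mem_set//= => h1.
  have : (1 : R) <= 0 by apply: le_trans h1; rewrite lerDr sumr_ge0.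
  by rewrite ler10.
Qed.

(** When station [z] is at its minimal distance, [z'] is at that same distance. *)
Definition tie (z z' : marked) : Prop :=
  sqdist v z' (arrival v z) = across z ^+ 2.

Lemma measurable_eq_set {d'} {V : measurableType d'} (f g : V -> R) :
  measurable_fun setT f -> measurable_fun setT g -> measurable [set y | f y = g y].
Proof.
move=> mf mg; have h := measurable_funB mf mg.
rewrite (_ : [set y | _] = (f \- g) @^-1` [set 0]).
  by rewrite -[X in measurable X]setTI; apply: h => //; exact: measurable_set1.
by apply/seteqP; split => y /=; [move=> ->; rewrite subrr|move=> /eqP; rewrite subr_eq0 => /eqP].
Qed.

Lemma measurable_pos_set {d'} {V : measurableType d'} (f : V -> R) :
  measurable_fun setT f -> measurable [set y | 0 < f y].
Proof.
move=> mf; rewrite (_ : [set y | _] = f @^-1` `]0, +oo[).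
  by rewrite -[X in measurable X]setTI; apply: mf => //; exact: measurable_itv.
by apply/seteqP; split => y /=; rewrite in_itv/= andbT.
Qed.

Lemma measurable_normsq1 : measurable_fun setT (fun z : marked => normsq z.1).
Proof. exact: (measurableT_comp measurable_normsq (@measurable_fst _ _ _ _)). Qed.

Lemma ae_arrival i (t : R) : {ae P, forall w, arrival v (Z i w) <> t}.
Proof.
pose B : set marked := [set z | 0 < normsq z.1] `&` [set z | arrival v z = t].
have mB : measurable B.
  apply: measurableI; first exact: measurable_pos_set measurable_normsq1.
  by apply: measurable_eq_set => //; exact: measurable_arrival.
have h1 : {ae P, forall w, ~ B (Z i w)}.
  apply: angle_null => // x.
  have [x0|x0] := ltP 0 (normsq x); last first.
    rewrite (_ : [set a | _] = set0) ?measure0//.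
    by apply/seteqP; split => a //= -[/=]; rewrite ltNge x0.
  apply: (@angle_level_null R x.1 x.2 (- (v * t))) => //.
    have mp : measurable_fun setT (fun a : measurableTypeR R => (x, a) : marked).
      by apply: measurable_fun_pair.
    by rewrite -[X in measurable X]setTI; exact: mp.
  move=> a [_ /=]; rewrite /arrival /along /= => <-.
  by field; rewrite gt_eqF.
apply: filterS2 (ae_off_origin i) h1 => w X0 nB e; apply: nB; split => //.
Qed.

(** At a fixed time [t <> 0] the squared distance of the second station is
    [normsq + 2 v t along + (v t)^2], so a tie prescribes the value of [along], a
    sinusoid in the angle. At [t = 0] the angle has no influence, whence the
    detour through [ae_arrival] at time 0. *)
Lemma ae_no_tie i j : i != j -> {ae P, forall w, ~ tie (Z i w) (Z j w)}.
Proof.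
move=> ij.
pose B : set (marked * marked) := [set y | 0 < normsq y.2.1] `&`
  ([set y | 0 < arrival v y.1 ^+ 2] `&` [set y | tie y.1 y.2]).
have mar : measurable_fun setT (fun y : marked * marked => arrival v y.1).
  exact: (measurableT_comp (measurable_arrival v) (@measurable_fst _ _ _ _)).
have mB : measurable B.
  apply: measurableI; [|apply: measurableI].
  - apply: measurable_pos_set.
    exact: (measurableT_comp measurable_normsq1 (@measurable_snd _ _ _ _)).
  - by apply: measurable_pos_set; exact: measurable_funX.
  - apply: measurable_eq_set; first exact: measurable_sqdist_at_arrival.
    apply: measurable_funX.
    exact: (measurableT_comp measurable_across (@measurable_fst _ _ _ _)).
have h1 : {ae P, forall w, ~ B (Z i w, Z j w)}.
  apply: pair_angle_null => // z x.
  have [x0|x0] := ltP 0 (normsq x); last first.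
    rewrite (_ : [set a | _] = set0) ?measure0//.
    by apply/seteqP; split => a //= -[/=]; rewrite ltNge x0.
  have [t0|t0] := ltP 0 (arrival v z ^+ 2); last first.
    rewrite (_ : [set a | _] = set0) ?measure0//.
    by apply/seteqP; split => a //= -[_ [/=]]; rewrite ltNge t0.
  set t := arrival v z in t0.
  apply: (@angle_level_null R x.1 x.2 ((across z ^+ 2 - normsq x - (v * t) ^+ 2) / (2 * v * t))) => //.
    have mp : measurable_fun setT (fun a : measurableTypeR R => (z, (x, a)) : marked * marked).
      by do 2 apply: measurable_fun_pair => //.
    by rewrite -[X in measurable X]setTI; exact: mp.
  move=> a [_ [_ /=]]; rewrite /tie -/t => <-.
  rewrite sqdist_frame -addrA.
  have -> : normsq x = along (x, a) ^+ 2 + across (x, a) ^+ 2 by rewrite -normsq_frame.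
  have tn : t != 0 by move: t0; rewrite lt0r sqrf_eq0 => /andP[].
  transitivity (along (x, a)) => //.
  by field; rewrite tn gt_eqF.
apply: filterS3 (ae_off_origin j) (ae_arrival i 0) h1 => w X0 a0 nB e; apply: nB.
split => //; split => //=.
by rewrite lt0r sqr_ge0 andbT sqrf_eq0; exact/eqP.
Qed.

(** The time 1 is excluded because the atoms are summed over a closed interval
    and the cells are half-open. *)
Definition generic (z : nat -> marked) : Prop :=
  (forall K : nat, exists M, forall k, (M <= k)%N -> ~ disc K%:R (z k).1) /\
  (forall i, arrival v (z i) <> 1) /\
  (forall i j, i != j -> ~ tie (z i) (z j)).

Lemma ae_generic : {ae P, forall w, generic (fun k => Z k w)}.
Proof.
have h1 : {ae P, forall w, forall K : nat, exists M, forall k, (M <= k)%N -> ~ disc K%:R (X k w)}.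
  apply: ae_foralln => K; apply: (ae_finite_in (network_poisson net) lam_gt0).
    exact: measurable_disc.
  exact: area_disc_fin_nat.
have h2 : {ae P, forall w, forall i, arrival v (Z i w) <> 1}.
  by apply: ae_foralln => i; exact: ae_arrival.
have h3 : {ae P, forall w, forall i j, i != j -> ~ tie (Z i w) (Z j w)}.
  apply: ae_foralln => i; apply: ae_foralln => j.
  have [->|ij] := eqVneq i j; first by apply: aeW => w /eqP.
  by apply: filterS (ae_no_tie ij).
by apply: filterS3 h1 h2 h3 => w; split.
Qed.

End general_position.

(** * Rounding down to a grid *)

Section grid_floor.
Context {R : realType}.

Definition grid (n : nat) (a : nat) : R := a%:R / n.+1%:R.
Definition gfloor (n : nat) (y : R) : R := grid n (Num.trunc (n.+1%:R * y)).

Lemma grid_cellE n a y : 0 <= y ->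
  (grid n a <= y < grid n a.+1) = (Num.trunc (n.+1%:R * y) == a).
Proof.
move=> y0; rewrite truncn_eq ?mulr_ge0//.
by rewrite /grid ler_pdivrMr// ltr_pdivlMr// [y * _]mulrC.
Qed.

Lemma grid_ge0 n a : 0 <= grid n a.
Proof. by rewrite /grid divr_ge0. Qed.

Lemma grid_le1 n a : (a <= n.+1)%N -> grid n a <= 1.
Proof. by move=> an; rewrite /grid ler_pdivrMr// mul1r ler_nat. Qed.

Lemma grid_leK n K b : (b <= n.+1 * K)%N -> grid n b <= K%:R.
Proof. by move=> bK; rewrite /grid ler_pdivrMr// -natrM ler_nat mulnC. Qed.

(** Only the cell that contains [y] contributes. *)
Lemma grid_sum n N (y : R) (F : R -> R) :
  \sum_(0 <= a < N) (grid n a <= y < grid n a.+1)%R%:R * F (grid n a) =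
  if 0 <= y < grid n N then F (gfloor n y) else 0.
Proof.
have [y0|y0] := lerP 0 y; last first.
  rewrite /= big1// => a _; rewrite [_ <= y]leNgt (lt_le_trans y0 (grid_ge0 n a))/=.
  by rewrite mul0r.
have NE : (y < grid n N) = (Num.trunc (n.+1%:R * y) < N)%N.
  have z0 : 0 <= n.+1%:R * y by rewrite mulr_ge0.
  have /andP[t1 t2] := truncn_itv z0.
  rewrite /grid ltr_pdivlMr// [y * _]mulrC; apply/idP/idP => h.
    by rewrite -(ltr_nat R); exact: le_lt_trans t1 h.
  by apply: lt_le_trans t2 _; rewrite ler_nat.
rewrite /= NE; case: ifPn => h.
  rewrite (bigD1_seq (Num.trunc (n.+1%:R * y))) ?mem_index_iota ?iota_uniq//=.
  rewrite grid_cellE// eqxx mul1r big1 ?addr0// => a.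
  by rewrite grid_cellE// eq_sym => /negbTE ->; rewrite mul0r.
rewrite big_nat big1// => a /andP[_ aN].
rewrite grid_cellE//; case: eqP; rewrite ?mul0r// => e.
by move: h; rewrite e aN.
Qed.

Lemma gfloor_bounds n y : 0 <= y -> 0 <= gfloor n y <= y /\ y - n.+1%:R^-1 <= gfloor n y.
Proof.
move=> y0; have z0 : 0 <= n.+1%:R * y by rewrite mulr_ge0.
have /andP[t1 t2] := truncn_itv z0.
have n0 : 0 < n.+1%:R :> R by [].
rewrite /gfloor grid_ge0 /grid/=; split.
  by rewrite ler_pdivrMr// [y * _]mulrC.
rewrite lerBlDr; set c := (Num.trunc _)%:R.
have -> : c / n.+1%:R + n.+1%:R^-1 = (c + 1) / n.+1%:R by rewrite mulrDl mul1r.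
by rewrite ler_pdivlMr// natr1 [y * _]mulrC; exact: ltW.
Qed.

Lemma cvg_gfloor y : 0 <= y -> (gfloor ^~ y) @ \oo --> y.
Proof.
move=> y0.
have sq : \forall n \near \oo, y - n.+1%:R^-1 <= gfloor n y <= y.
  by apply: nearW => n; have [/andP[_ h1] h2] := gfloor_bounds n y0; rewrite h1 h2.
apply: (squeeze_cvgr sq); last exact: cvg_cst.
rewrite -[X in _ --> X]subr0; apply: cvgB; first exact: cvg_cst.
exact: cvg_harmonic.
Qed.

Lemma cvg_sum_nat (u : nat -> nat -> R) (a : nat -> R) M :
  (forall k, (fun m => u m k) @ \oo --> a k) ->
  (fun m => \sum_(0 <= k < M) u m k) @ \oo --> \sum_(0 <= k < M) a k.
Proof.
move=> ua; elim: M => [|M IH].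
  by rewrite big_geq//; under eq_fun do rewrite big_geq//; exact: cvg_cst.
rewrite big_nat_recr//=; under eq_fun do rewrite big_nat_recr//=.
exact: cvgD.
Qed.

Lemma cvg_ltr_indic (u w : nat -> R) (a b : R) : u @ \oo --> a -> w @ \oo --> b -> a <> b ->
  (fun n => (u n < w n)%R%:R : R) @ \oo --> ((a < b)%R%:R : R).
Proof.
move=> ua wb ab; apply: cvg_near_cst.
have uw : (fun n => w n - u n) @ \oo --> b - a by exact: cvgB.
have [h|h|h] := ltgtP a b; last by case: ab.
- move/cvgr_gt : uw => /(_ 0); rewrite subr_gt0 => /(_ h); apply: filterS => n.
  by rewrite subr_gt0 => ->.
- move/cvgr_lt : uw => /(_ 0); rewrite subr_lt0 => /(_ h); apply: filterS => n.
  by rewrite subr_lt0 => /ltW; rewrite leNgt => /negbTE ->.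
Qed.
End grid_floor.

(** * Limit of the sums over the cells *)

Section grid_limit.
Context {R : realType}.
Local Notation marked := (plane R * measurableTypeR R)%type.
Variables (v gamma beta : R).
Hypotheses (v_gt0 : 0 < v) (beta_ge0 : 0 <= beta) (gamma_ge0 : 0 <= gamma).

Definition weight (t h : R) (z : marked) : R :=
  expR (- gamma * h ^+ 2 - beta * sqdist v z t) * \1_(nearer v t h) z.

(** The contribution of an interferer whose minimum is at distance [h] and time [t]:
    it vanishes unless exactly one station is closer at that time, and is
    otherwise the weight of that station. *)
Definition sole (t h : R) (z : nat -> marked) : \bar R :=
  sole_sum (nearer v t h) (weight t h) z.

Lemma weight01 t h z : 0 <= weight t h z <= 1.
Proof.
have e1 : expR (- gamma * h ^+ 2 - beta * sqdist v z t) <= 1.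
  rewrite -expR0 ler_expR.
  have : 0 <= gamma * h ^+ 2 by rewrite mulr_ge0// sqr_ge0.
  have : 0 <= beta * sqdist v z t by rewrite mulr_ge0// addr_ge0// sqr_ge0.
  rewrite mulNr; lra.
rewrite /weight indicE; case: (_ \in _) => /=.
  by rewrite mulr1 expR_ge0.
by rewrite mulr0 lexx ler01.
Qed.

Lemma weight_out t h z : ~ nearer v t h z -> weight t h z = 0.
Proof. by move=> nz; rewrite /weight indicE memNset// mulr0. Qed.

Variable K N : nat.
Hypothesis KN : 2 * K%:R ^+ 2 + 2 * v ^+ 2 < N%:R.

(** The position at time [t] and the displacement since time 0 have norms at most [K]
    and [v], and [(a + b)^2 <= 2 a^2 + 2 b^2]. *)
Lemma nearer_in_disc t h z : `|t| <= 1 -> 0 <= h <= K%:R -> nearer v t h z -> disc N%:R z.1.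
Proof.
move=> t1 /andP[h0 hK]; rewrite /nearer /disc/= => zh.
apply: le_lt_trans KN; have hK2 : h ^+ 2 <= K%:R ^+ 2 by rewrite ler_sqr ?nnegrE.
have t2 : t ^+ 2 <= 1 by rewrite -[t ^+ 2]real_normK ?num_real// expr_le1.
have vt : (v * t) ^+ 2 <= v ^+ 2 by rewrite exprMn ler_piMr// sqr_ge0.
suff : normsq z.1 <= 2 * sqdist v z t + 2 * (v * t) ^+ 2 by move: zh; lra.
rewrite (normsq_frame z) sqdist_frame; move: (along z) (across z) (v * t) => p q s.
have := sqr_ge0 (p + 2 * s); have := sqr_ge0 q; nra.
Qed.

Definition window : set marked := cell v 0 1 0 K%:R.

Lemma window_in_disc z : window z -> disc N%:R z.1.
Proof.
move=> [/andP[a0 a1] /andP[_ c1]]; rewrite /disc/=.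
apply: le_lt_trans KN.
have e : along z = - (v * arrival v z) by rewrite /arrival; field; rewrite gt_eqF.
rewrite (normsq_frame z) e sqrrN exprMn.
have c2 : across z ^+ 2 <= K%:R ^+ 2.
  by rewrite -[across z ^+ 2]real_normK ?num_real// ler_sqr ?nnegrE// ltW.
have a2 : v ^+ 2 * arrival v z ^+ 2 <= v ^+ 2.
  by rewrite ler_piMr ?sqr_ge0// expr_le1// ltW.
have := sqr_ge0 (K%:R : R); have := sqr_ge0 v; lra.
Qed.

Lemma grid_cell_in_disc n a b z : (a < n.+1)%N -> (b < n.+1 * K)%N ->
  cell v (grid n a) (grid n a.+1) (grid n b) (grid n b.+1) z -> disc N%:R z.1.
Proof.
move=> an bK [/andP[c1 c2] /andP[c3 c4]]; apply: window_in_disc; split.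
  by rewrite (le_trans (grid_ge0 _ _) c1) (lt_le_trans c2)// grid_le1.
by rewrite (le_trans (grid_ge0 _ _) c3) (lt_le_trans c4)// grid_leK.
Qed.

(** The interferers in the window are sorted into cells of side [1 / (n + 1)], and each
    one contributes as if its minimum were the lower corner of its cell. *)
Definition grid_total (n : nat) (z : nat -> marked) : \bar R :=
  (\sum_(0 <= a < n.+1) \sum_(0 <= b < n.+1 * K)
    count (cell v (grid n a) (grid n a.+1) (grid n b) (grid n b.+1)) z *
    sole (grid n a) (grid n b) z)%E.

Definition window_total (z : nat -> marked) : \bar R :=
  (\sum_(i <oo) (\1_window (z i) : R)%:E * sole (arrival v (z i)) `|across (z i)| z)%E.

Variable z : nat -> marked.
Hypothesis gz : generic v z.
Variable M : nat.
Hypothesis zM : forall k, (M <= k)%N -> ~ disc N%:R (z k).1.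

(** [sole] when no station from [M] on matters. *)
Definition fsole (t h : R) : R := \sum_(0 <= j < M) weight t h (z j) *
  \prod_(0 <= k < M) (if k == j then 1 else 1 - \1_(nearer v t h) (z k)).

Lemma soleE t h : `|t| <= 1 -> 0 <= h <= K%:R -> sole t h z = (fsole t h)%:E.
Proof.
move=> t1 hK; apply: sole_sum_finite.
- by move=> y; case/andP: (weight01 t h y).
- exact: weight_out.
- by move=> k Mk /(nearer_in_disc t1 hK); exact: zM.
Qed.

(** [fsole] is a limit of the quotients bounded in [mark_prod_bounds]. *)
Lemma fsole01 t h : 0 <= fsole t h <= 1.
Proof.
have lim := @cvg_prod_diff R (fun k => 1 - \1_(nearer v t h) (z k)) (fun k => weight t h (z k)) M.
have b n : 0 <= n.+1%:R * (\prod_(0 <= k < M) (1 - \1_(nearer v t h) (z k) + n.+1%:R^-1 * weight t h (z k)) -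
    \prod_(0 <= k < M) (1 - \1_(nearer v t h) (z k))) <= 1.
  have inv01 : 0 <= (n.+1%:R^-1 : R) <= 1 by rewrite invr_ge0 ler0n/= invf_le1// ler1n.
  have ag k : \1_(nearer v t h) (z k) = 1 :> R \/ \1_(nearer v t h) (z k) = 0 :> R /\ weight t h (z k) = 0.
    rewrite indicE; case: (boolP (z k \in nearer v t h)) => ZA; [by left|right; split=> //].
    by apply: weight_out; move: ZA; rewrite notin_setE.
  have /andP[k0 k1] := @mark_prod_bounds R n.+1%:R^-1 _ _ M inv01 (fun k => weight01 t h (z k)) ag.
  by rewrite mulr_ge0//= -ler_pdivlMl// mulr1.
rewrite /fsole -(cvg_lim _ lim)//; apply/andP; split.
  apply: limr_ge; first by apply/cvg_ex; eexists; exact: lim.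
  by apply: nearW => n; case/andP: (b n).
apply: limr_le; first by apply/cvg_ex; eexists; exact: lim.
by apply: nearW => n; case/andP: (b n).
Qed.

Lemma grid_totalE n : grid_total n z =
  (\sum_(0 <= i < M) (\1_window (z i) : R) *
     fsole (gfloor n (arrival v (z i))) (gfloor n `|across (z i)|))%:E.
Proof.
have gK b : (b < n.+1 * K)%N -> 0 <= (grid n b : R) <= K%:R.
  by move=> bK; rewrite grid_ge0/= grid_leK// ltnW.
have g1 a : (a < n.+1)%N -> `|grid n a : R| <= 1.
  by move=> an; rewrite ger0_norm ?grid_ge0// grid_le1// ltnW.
transitivity (\sum_(0 <= a < n.+1) \sum_(0 <= b < n.+1 * K)
   ((\sum_(0 <= i < M) \1_(cell v (grid n a) (grid n a.+1) (grid n b) (grid n b.+1)) (z i)) *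
    fsole (grid n a) (grid n b))%:E)%E.
  rewrite /grid_total big_nat [RHS]big_nat; apply: eq_bigr => a /andP[_ an].
  rewrite big_nat [RHS]big_nat; apply: eq_bigr => b /andP[_ bn].
  rewrite soleE ?g1 ?gK// (@count_finite _ _ _ _ M) -?EFinM// => k Mk ck.
  exact: (zM Mk (grid_cell_in_disc an bn ck)).
under eq_bigr do rewrite sumEFin.
rewrite sumEFin; congr EFin.
under eq_bigr => a _ do (under eq_bigr => b _ do rewrite mulr_suml).
under eq_bigr => a _ do rewrite exchange_big/=.
rewrite exchange_big/=; apply: eq_bigr => i _.
have gn : grid n n.+1 = 1 :> R by rewrite /grid divff.
have gk : grid n (n.+1 * K) = K%:R :> R by rewrite /grid natrM mulrAC divff ?mul1r.
transitivity (\sum_(0 <= a < n.+1) (grid n a <= arrival v (z i) < grid n a.+1)%R%:R *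
   ((fun t => \sum_(0 <= b < n.+1 * K) (grid n b <= `|across (z i)| < grid n b.+1)%R%:R * fsole t (grid n b)) (grid n a))).
  apply: eq_bigr => a _; rewrite mulr_sumr; apply: eq_bigr => b _.
  rewrite mulrA -natrM mulnb indicE; congr (_ %:R * _); congr nat_of_bool.
  by apply/idP/idP; rewrite inE /cell/= => /andP.
rewrite (grid_sum _ _ _ (fun t => \sum_(0 <= b < n.+1 * K) (grid n b <= `|across (z i)| < grid n b.+1)%R%:R * fsole t (grid n b))).
rewrite grid_sum gn gk indicE.
have -> : (z i \in window) = (0 <= arrival v (z i) < 1) && (0 <= `|across (z i)| < K%:R).
  by apply/idP/idP; rewrite inE /window /cell/= => /andP.
by case: ifP => _ /=; [case: ifP => _; rewrite ?mul1r ?mul0r|rewrite mul0r].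
Qed.

Lemma window_totalE : window_total z =
  (\sum_(0 <= i < M) (\1_window (z i) : R) * fsole (arrival v (z i)) `|across (z i)|)%:E.
Proof.
have w0 i : (0 <= (\1_window (z i) : R)%:E * sole (arrival v (z i)) `|across (z i)| z)%E.
  rewrite mule_ge0// ?lee_fin//; apply: sole_sum_ge0 => y.
  by case/andP: (weight01 (arrival v (z i)) `|across (z i)| y).
rewrite /window_total (nneseries_split 0 M); last by move=> k _; exact: w0.
rewrite add0n [X in (_ + X)%E]eseries0 ?adde0; last first.
  by move=> k Mk _; rewrite indicE memNset ?mul0e// => /window_in_disc; exact: zM.
rewrite -sumEFin; apply: eq_bigr => i _; rewrite indicE EFinM.
have [wi|wi] := boolP (z i \in window); last by rewrite !mul0e.
move: wi; rewrite inE => -[/andP[a0 a1] /andP[c0 c1]].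
by rewrite soleE// ?c0 ?ltW// ger0_norm// ltW.
Qed.

Lemma grid_total_le n : (grid_total n z <= count window z)%E.
Proof.
rewrite grid_totalE (@count_finite _ _ _ _ M); last by move=> k Mk /window_in_disc; exact: zM.
rewrite lee_fin; apply: ler_sum => i _.
by rewrite ler_piMr//; case/andP: (fsole01 (gfloor n (arrival v (z i))) (gfloor n `|across (z i)|)).
Qed.

(** The only discontinuity comes from the indicators of closer stations. The other
    stations are not tied with the interferer. The interferer itself is at its
    minimum, so it is never strictly closer than the lower corner of its cell. *)
Lemma fsole_cvg i : 0 <= arrival v (z i) ->
  (fun n => fsole (gfloor n (arrival v (z i))) (gfloor n `|across (z i)|)) @ \oo -->
  fsole (arrival v (z i)) `|across (z i)|.
Proof.
move=> a0; set t := arrival v (z i); set h := `|across (z i)|.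
have h0 : 0 <= h by exact: normr_ge0.
have ct := cvg_gfloor a0; have ch := cvg_gfloor h0.
have ch2 : (fun n => gfloor n h ^+ 2) @ \oo --> h ^+ 2 by exact: cvgM.
have cd k : (fun n => sqdist v (z k) (gfloor n t)) @ \oo --> sqdist v (z k) t.
  rewrite sqdist_frame; under eq_fun do rewrite sqdist_frame.
  apply: cvgD; last exact: cvg_cst.
  have q1 : (fun n => along (z k) + v * gfloor n t) @ \oo --> along (z k) + v * t.
    by apply: cvgD; [exact: cvg_cst|apply: cvgM => //; exact: cvg_cst].
  exact: (cvgM q1 q1).
have indE t' h' k : \1_(nearer v t' h') (z k) = (sqdist v (z k) t' < h' ^+ 2)%R%:R :> R.
  by rewrite indicE; congr (_ %:R); congr nat_of_bool; apply/idP/idP; rewrite inE.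
have ci k : (fun n => \1_(nearer v (gfloor n t) (gfloor n h)) (z k) : R) @ \oo --> (\1_(nearer v t h) (z k) : R).
  rewrite indE; under eq_fun do rewrite indE.
  have [->|ki] := eqVneq k i.
    have hh (t' h' : R) : 0 <= h' <= h -> (sqdist v (z i) t' < h' ^+ 2) = false.
      move=> /andP[h1 h2]; apply/negbTE; rewrite -leNgt sqdist_arrival//.
      apply: (@le_trans _ _ (h ^+ 2)); first by rewrite ler_sqr ?nnegrE.
      by rewrite /h real_normK ?num_real// lerDr sqr_ge0.
    rewrite hh ?h0 ?lexx//; apply: cvg_near_cst; apply: nearW => n; rewrite hh//.
    by have [] := gfloor_bounds n h0.
  apply: cvg_ltr_indic => // e; have [_ [_ nt]] := gz.
  apply: (nt i k); first by rewrite eq_sym.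
  by rewrite /tie e /h real_normK ?num_real.
apply: cvg_sum_nat => j; apply: cvgM.
  apply: cvgM; last exact: ci.
  apply: continuous_cvg; first exact: continuous_expR.
  by apply: cvgB; apply: cvgM => //; exact: cvg_cst.
apply: cvg_prod => k; case: eqP => _; first exact: cvg_cst.
by apply: cvgB => //; exact: cvg_cst.
Qed.

Lemma grid_total_cvg : grid_total ^~ z @ \oo --> window_total z.
Proof.
rewrite window_totalE; under eq_fun do rewrite grid_totalE.
apply: cvg_EFin_seq; apply: cvg_sum_nat => i.
rewrite indicE; have [wi|wi] := boolP (z i \in window).
  apply: cvgM; first exact: cvg_cst.
  by apply: fsole_cvg; move: wi; rewrite inE => -[/andP[]].
rewrite mul0r; under eq_fun do rewrite mul0r; exact: cvg_cst.
Qed.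

End grid_limit.

(** * The integral over the distance of the interferer *)

Section analysis.
Context {R : realType}.
Local Notation leb := (@lebesgue_measure R).

(** The integral of [exp (- beta s)] over [[0, x]], by its explicit expression. *)
Definition exp_primitive (beta x : R) : R := if beta == 0 then x else (1 - expR (- beta * x)) / beta.

Lemma exp_primitive_integral (beta x : R) : 0 <= beta -> 0 <= x ->
  (\int[leb]_(s in `[0%R, x[) (expR (- beta * s))%:E = (exp_primitive beta x)%:E)%E.
Proof.
move=> b0 x0; rewrite /exp_primitive; have [->|bn] := eqVneq beta 0.
  rewrite (eq_integral (cst 1%E)); last by move=> s _; rewrite oppr0 mul0r expR0.
  rewrite integral_cst//= lebesgue_measure_itv/= lte_fin mul1e.
  by case: ltP => h; [rewrite sube0|congr EFin; apply/eqP; rewrite eq_le x0 h].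
have bpos : 0 < beta by rewrite lt0r bn.
have [->|xn] := eqVneq x 0.
  rewrite mulr0 expR0 subrr mul0r set_itvco0 integral_set0//.
have xpos : 0 < x by rewrite lt0r xn.
have mexp : measurable_fun setT (fun s : measurableTypeR R => (expR (- beta * s))%:E).
  apply/measurable_EFinP; apply: measurableT_comp; first exact: measurable_expR.
  exact: (@measurable_funM _ (measurableTypeR R) R setT (fun=> - beta) id).
have mpdf : measurable_fun (`[0%R, x[ : set (measurableTypeR R))
    (fun s : measurableTypeR R => (exponential_pdf beta s)%:E).
  by apply/measurable_EFinP; apply: measurable_funTS; exact: measurable_exponential_pdf.
have h : (beta%:E * \int[leb]_(s in `[0%R, x[) (expR (- beta * s))%:E =
    1 - (expR (- beta * x))%:E)%E.
  rewrite -(exponential_prob_itv0c beta xpos) /exponential_prob.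
  rewrite -(integral_itv_bndo_bndc mpdf) -ge0_integralZl//; last exact: measurable_funTS.
  apply: eq_integral => s; rewrite inE/= in_itv/= => /andP[s0 _].
  by rewrite exponential_pdfE// -EFinM.
have -> : ((1 - expR (- beta * x)) / beta)%:E = (beta^-1%:E * (1 - (expR (- beta * x))%:E))%E.
  by rewrite -EFinB -EFinM mulrC.
by rewrite -h muleA -EFinM mulVf// mul1e.
Qed.

Lemma exp_primitive_bounds (beta x : R) : 0 <= beta -> 0 <= x -> 0 <= exp_primitive beta x <= x.
Proof.
move=> b0 x0; rewrite /exp_primitive; have [_|bn] := eqVneq beta 0; first by rewrite x0 lexx.
have bpos : 0 < beta by rewrite lt0r bn.
have bx : 0 <= beta * x by rewrite mulr_ge0.
rewrite divr_ge0//=; last by rewrite subr_ge0 -expR0 ler_expR mulNr oppr_le0.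
by rewrite ler_pdivrMr//; have := expR_ge1Dx (- beta * x); lra.
Qed.

Lemma exp_primitive_nonincreasing (b b' x : R) : 0 <= b -> b <= b' -> 0 <= x -> exp_primitive b' x <= exp_primitive b x.
Proof.
move=> b0 bb x0; rewrite -lee_fin -!exp_primitive_integral//; last exact: le_trans bb.
have m (c : R) : measurable_fun `[0%R, x[ (fun s : measurableTypeR R => (expR (- c * s))%:E).
  apply/measurable_EFinP; apply: measurable_funTS; apply: measurableT_comp; first exact: measurable_expR.
  exact: (@measurable_funM _ (measurableTypeR R) R setT (fun=> - c) id).
apply: ge0_le_integral => //.
- exact: m.
- exact: m.
- move=> s; rewrite /= in_itv/= => /andP[s0 _]; rewrite lee_fin ler_expR.
  by rewrite !mulNr lerN2 ler_wpM2r.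
Qed.

Definition height_density (beta a h : R) : R := exp_primitive beta (h ^+ 2) * expR (- (a * h ^+ 2)).

Lemma continuous_exp_primitive beta : continuous (exp_primitive beta).
Proof.
rewrite /exp_primitive; case: eqP => _ x; first exact: cvg_id.
apply: cvgM; last exact: cvg_cst.
apply: cvgB; first exact: cvg_cst.
apply: continuous_cvg; first exact: continuous_expR.
by apply: cvgM; [exact: cvg_cst|exact: cvg_id].
Qed.

Lemma continuous_height_density beta a : continuous (height_density beta a).
Proof.
have sq (x : R) : (fun h : R => h ^+ 2) @ x --> x ^+ 2 by exact: exprn_continuous.
move=> x; apply: cvgM.
  exact: (cvg_comp _ _ (sq x) (@continuous_exp_primitive beta (x ^+ 2))).
apply: continuous_cvg; first exact: continuous_expR.
by apply: cvgN; apply: cvgM; [exact: cvg_cst|exact: sq].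
Qed.

Lemma measurable_height_density beta a : measurable_fun setT (height_density beta a : measurableTypeR R -> R).
Proof. by apply: continuous_measurable_fun; exact: continuous_height_density. Qed.

Lemma height_density_ge0 beta a h : 0 <= beta -> 0 <= height_density beta a h.
Proof.
move=> b0; rewrite mulr_ge0 ?expR_ge0//.
by case/andP: (exp_primitive_bounds b0 (sqr_ge0 h)).
Qed.

Lemma integral_scaled_gauss (a : R) : 0 < a ->
  (\int[leb]_(h in `[0%R, +oo[) (expR (- (a * h ^+ 2)))%:E = (Num.sqrt pi / 2 / Num.sqrt a)%:E)%E.
Proof.
move=> a0; have s0 : 0 < Num.sqrt a by rewrite sqrtr_gt0.
pose phi (x : measurableTypeR R) : measurableTypeR R := Num.sqrt a * x + 0.
have mphi : measurable_fun setT phi by apply: measurable_funD => //; exact: measurable_funM.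
have m0y : measurable (`[0%R, +oo[ : set (measurableTypeR R)) by exact: measurable_itv.
have si0 : 0 <= (Num.sqrt a)^-1 by rewrite invr_ge0 ltW.
have mg : measurable_fun (`[0%R, +oo[ : set (measurableTypeR R)) (fun y : measurableTypeR R => (gauss_fun y)%:E).
  by apply/measurable_EFinP; apply: measurable_funTS; exact: measurable_gauss_fun.
have E1 : (\int[pushforward leb phi]_(y in `[0%R, +oo[) (gauss_fun y)%:E =
    (Num.sqrt pi / 2 / Num.sqrt a)%:E)%E.
  transitivity (\int[mscale (NngNum si0) leb]_(y in `[0%R, +oo[) (gauss_fun y)%:E)%E.
    by apply: eq_measure_integral => A mA _; exact: lebesgue_affine.
  rewrite ge0_integral_mscale//=; last by move=> y _; rewrite lee_fin gauss_fun_ge0.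
  by rewrite integral0y_gauss -EFinM mulrC.
rewrite -E1 ge0_integral_pushforward//; last by move=> y _; rewrite lee_fin gauss_fun_ge0.
have -> : phi @^-1` `[0%R, +oo[ = `[0%R, +oo[%classic.
  by apply/seteqP; split => x; rewrite /phi /= !in_itv/= !andbT addr0 pmulr_rge0.
apply: eq_integral => x _; congr EFin; rewrite /phi /= /gauss_fun addr0 exprMn sqr_sqrtr//.
exact: ltW.
Qed.

(** The integral over [h >= 0] of [(exp (- a h^2) - exp (- b h^2)) / (b - a)], in a form
    that is also meaningful for [a = b]. *)
Definition gauss_gap (a b : R) : R :=
  Num.sqrt pi / 2 / (Num.sqrt a * Num.sqrt b * (Num.sqrt a + Num.sqrt b)).

(** [beta] times the density is a difference of two Gaussian functions; the
    subtraction is written as a sum to stay among nonnegative integrals. *)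
Lemma integral_height_density_pos (beta a : R) : 0 < beta -> 0 < a ->
  (\int[leb]_(h in `[0%R, +oo[) (height_density beta a h)%:E = (gauss_gap a (a + beta))%:E)%E.
Proof.
move=> b0 a0; have ab : 0 < a + beta by rewrite addr_gt0.
have bn : beta != 0 by rewrite gt_eqF.
have m1 (c : R) : measurable_fun (`[0%R, +oo[ : set (measurableTypeR R)) (fun h : measurableTypeR R => (expR (- (c * h ^+ 2)))%:E).
  apply/measurable_EFinP; apply: measurable_funTS; apply: measurableT_comp => //.
  by apply: measurable_funN; apply: measurable_funM => //; exact: measurable_funX.
have m2 : measurable_fun (`[0%R, +oo[ : set (measurableTypeR R)) (fun h : measurableTypeR R => (height_density beta a h)%:E).
  by apply/measurable_EFinP; apply: measurable_funTS; exact: measurable_height_density.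
have d0 (h : R) : (0 <= (height_density beta a h)%:E)%E by rewrite lee_fin height_density_ge0// ltW.
have e : (beta%:E * \int[leb]_(h in `[0%R, +oo[) (height_density beta a h)%:E +
    (Num.sqrt pi / 2 / Num.sqrt (a + beta))%:E = (Num.sqrt pi / 2 / Num.sqrt a)%:E)%E.
  rewrite -!integral_scaled_gauss// -ge0_integralZl//; last by rewrite lee_fin ltW.
  rewrite -ge0_integralD//.
  - apply: eq_integral => h _; rewrite -EFinM -EFinD; congr EFin.
    rewrite /height_density /exp_primitive (negbTE bn).
    have -> : expR (- ((a + beta) * h ^+ 2)) = expR (- beta * h ^+ 2) * expR (- (a * h ^+ 2)).
      by rewrite -expRD; congr expR; ring.
    by move: (expR (- beta * h ^+ 2)) (expR (- (a * h ^+ 2))) => x y; field.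
  - by move=> h _; rewrite mule_ge0// lee_fin ltW.
  - exact: measurable_funeM.
have sa : 0 < Num.sqrt a by rewrite sqrtr_gt0.
have sb : 0 < Num.sqrt (a + beta) by rewrite sqrtr_gt0.
have e2 : (beta%:E * \int[leb]_(h in `[0%R, +oo[) (height_density beta a h)%:E =
   (Num.sqrt pi / 2 / Num.sqrt a - Num.sqrt pi / 2 / Num.sqrt (a + beta))%:E)%E.
  by rewrite EFinB -e addeK.
have bE : beta = Num.sqrt (a + beta) ^+ 2 - Num.sqrt a ^+ 2.
  by rewrite !sqr_sqrtr ?ltW//; ring.
have -> : (\int[leb]_(h in `[0%R, +oo[) (height_density beta a h)%:E =
   beta^-1%:E * (beta%:E * \int[leb]_(h in `[0%R, +oo[) (height_density beta a h)%:E))%E.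
  by rewrite muleA -EFinM mulVf// mul1e.
rewrite e2 -EFinM; congr EFin; rewrite /gauss_gap.
have alg (x y k : R) : 0 < x -> 0 < y -> beta = y ^+ 2 - x ^+ 2 ->
    beta^-1 * (k / x - k / y) = k / (x * y * (x + y)).
  move=> x0 y0 bxy; have yx : y ^+ 2 - x ^+ 2 != 0 by rewrite -bxy.
  have xy : x + y != 0 by rewrite gt_eqF// addr_gt0.
  rewrite bxy; have yx' : y - x != 0.
    by apply: contraNneq yx => e'; rewrite subr_sqr e' mul0r.
  rewrite subr_sqr; field.
  by rewrite yx' xy !gt_eqF// [y + x]addrC xy.
exact: alg.
Qed.

(** The case [beta = 0] is the monotone limit along [beta = 1 / (n + 1)]. *)
Lemma integral_height_density (beta a : R) : 0 <= beta -> 0 < a ->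
  (\int[leb]_(h in `[0%R, +oo[) (height_density beta a h)%:E = (gauss_gap a (a + beta))%:E)%E.
Proof.
move=> b0 a0; have [->|bn] := eqVneq beta 0; last first.
  by apply: integral_height_density_pos => //; rewrite lt0r bn.
rewrite addr0.
pose bt (n : nat) : R := n.+1%:R^-1.
have bt0 n : 0 < bt n by rewrite invr_gt0.
have btc : bt @ \oo --> (0 : R) by exact: cvg_harmonic.
have lim1 : (fun n => \int[leb]_(h in `[0%R, +oo[) (height_density (bt n) a h)%:E)%E @ \oo -->
   (\int[leb]_(h in `[0%R, +oo[) (limn (fun n => (height_density (bt n) a h)%:E)))%E.
  apply: (@cvg_monotone_convergence _ (measurableTypeR R) R leb `[0%R, +oo[%classic
     (measurable_itv _) (fun n h => (height_density (bt n) a h)%:E)).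
  - by move=> n; apply/measurable_EFinP; apply: measurable_funTS; exact: measurable_height_density.
  - by move=> n h _; rewrite lee_fin height_density_ge0// ltW.
  - move=> h _ m n mn; rewrite lee_fin ler_wpM2r ?expR_ge0//.
    apply: exp_primitive_nonincreasing; [exact: ltW| |exact: sqr_ge0].
    by rewrite /bt lef_pV2 ?posrE// ler_nat.
have lim2 h : limn (fun n => (height_density (bt n) a h)%:E) = (height_density 0 a h)%:E.
  apply/cvg_lim => //; apply: cvg_EFin_seq; apply: cvgM; last exact: cvg_cst.
  rewrite {2}/exp_primitive eqxx.
  have := @cvg_expR_quotient R (- h ^+ 2).
  move/cvgN; rewrite opprK; apply: cvg_trans; apply: near_eq_cvg; apply: nearW => n /=.
  rewrite /exp_primitive gt_eqF// /bt invrK mulrC -mulrN opprB; congr (_ * (_ - expR _)).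
  by rewrite mulrN mulNr.
have lim3 : (fun n => \int[leb]_(h in `[0%R, +oo[) (height_density (bt n) a h)%:E)%E =
    (fun n => (gauss_gap a (a + bt n))%:E).
  by apply/funext => n; exact: integral_height_density_pos.
rewrite lim3 in lim1.
transitivity (\int[leb]_(h in `[0%R, +oo[) (limn (fun n => (height_density (bt n) a h)%:E)))%E.
  by apply: eq_integral => h _; rewrite lim2.
apply: (cvg_unique (@ereal_hausdorff _) lim1).
apply: cvg_EFin_seq.
have sa : 0 < Num.sqrt a by rewrite sqrtr_gt0.
have sc : (fun n => Num.sqrt (a + bt n)) @ \oo --> Num.sqrt a.
  apply: continuous_cvg; first exact: sqrt_continuous.
  by rewrite -[X in _ --> X]addr0; apply: cvgD => //; exact: cvg_cst.
apply: cvgM; first exact: cvg_cst.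
apply: cvgV; first by rewrite gt_eqF// !mulr_gt0// addr_gt0.
apply: cvgM; first by apply: cvgM => //; exact: cvg_cst.
by apply: cvgD => //; exact: cvg_cst.
Qed.

(** The sums are the integrals of step functions which converge to [F] pointwise and
    are bounded by [B]. *)
Lemma riemann_sum (K : nat) (F : R -> R) (B : R) : continuous F ->
  (forall h, 0 <= h < K%:R -> 0 <= F h <= B) ->
  (fun n => (\sum_(0 <= b < n.+1 * K) F (grid n b) / n.+1%:R)%:E) @ \oo -->
  (\int[leb]_(h in `[0%R, K%:R[) (F h)%:E)%E.
Proof.
move=> cF FB.
have mF : measurable_fun setT (F : measurableTypeR R -> R) by exact: continuous_measurable_fun.
pose s n (h : measurableTypeR R) : R :=
  \sum_(0 <= b < n.+1 * K) (grid n b <= (h : R) < grid n b.+1)%R%:R * F (grid n b).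
have gk n : grid n (n.+1 * K) = K%:R :> R by rewrite /grid natrM mulrAC divff ?mul1r.
have sE n h : s n h = if 0 <= (h : R) < K%:R then F (gfloor n h) else 0.
  by rewrite /s grid_sum gk.
have indE n b (h : measurableTypeR R) : (grid n b <= (h : R) < grid n b.+1)%R%:R = \1_`[grid n b, grid n b.+1[ h :> R.
  rewrite indicE; congr (_ %:R); congr nat_of_bool.
  by apply/idP/idP; rewrite inE/= in_itv.
have mi (n b : nat) : measurable_fun setT (\1_`[grid n b, grid n b.+1[ : measurableTypeR R -> R).
  by apply: measurable_indic; exact: measurable_itv.
have ms n : measurable_fun setT (s n).
  apply: measurable_sum => b; apply: measurable_funM => //.
  by under eq_fun do rewrite indE; exact: mi.
have gK n b : (b < n.+1 * K)%N -> 0 <= (grid n b : R) < K%:R.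
  move=> bK; rewrite grid_ge0/= /grid ltr_pdivrMr// -natrM ltr_nat mulnC; exact: bK.
have int_s n : (\int[leb]_h (s n h)%:E = (\sum_(0 <= b < n.+1 * K) F (grid n b) / n.+1%:R)%:E)%E.
  rewrite /s.
  transitivity (\int[leb]_h (\sum_(0 <= b < n.+1 * K) (if (b < n.+1 * K)%N then
     ((F (grid n b))%:E * (\1_`[grid n b, grid n b.+1[ h : R)%:E) else 0))%E)%E.
    apply: eq_integral => h _; rewrite -sumEFin big_nat [RHS]big_nat.
    by apply: eq_bigr => b /andP[_ bK]; rewrite bK indE -EFinM mulrC.
  have Fg b : (b < n.+1 * K)%N -> 0 <= F (grid n b) by move=> /gK /FB /andP[].
  have m2 b : measurable_fun setT (fun h : measurableTypeR R => if (b < n.+1 * K)%N then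
     ((F (grid n b))%:E * (\1_`[grid n b, grid n b.+1[ h : R)%:E)%E else 0%E).
    by case: (b < n.+1 * K)%N => //; apply: measurable_funeM; apply/measurable_EFinP; exact: mi.
  rewrite ge0_integral_sum//; last first.
    by move=> b h _; case: ifP => // bK; rewrite mule_ge0// lee_fin// Fg.
  rewrite -sumEFin big_nat [RHS]big_nat; apply: eq_bigr => b /andP[_ bK].
  under eq_integral do rewrite bK.
  have mi' : measurable_fun setT (fun h : measurableTypeR R => (\1_`[grid n b, grid n b.+1[ h : R)%:E).
    by apply/measurable_EFinP; exact: mi.
  rewrite (ge0_integralZl _ measurableT mi')//; last by rewrite lee_fin Fg.
  rewrite EFinM; congr (_ * _)%E.
  have mI : measurable (`[grid n b, grid n b.+1[ : set (measurableTypeR R)) by exact: measurable_itv.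
  transitivity (leb `[grid n b, grid n b.+1[); first by rewrite integral_indic// setIT.
  rewrite lebesgue_measure_itv/= lte_fin.
  have e : grid n b.+1 - grid n b = n.+1%:R^-1 :> R.
    by rewrite /grid -mulrBl -natr1 [_ + 1]addrC addrK mul1r.
  by rewrite ifT -?EFinB ?e// -subr_gt0 e invr_gt0.
under eq_fun do rewrite -int_s.
rewrite integral_mkcond.
have mI : measurable (`[0, K%:R[ : set (measurableTypeR R)) by exact: measurable_itv.
have [] := @dominated_convergence _ (measurableTypeR R) R leb setT measurableT (fun n h => (s n h)%:E)
  ((fun h => (F h)%:E) \_ `[0%R, K%:R[) (fun h => B%:E * (\1_`[0%R, (K%:R)%R[ h : R)%:E)%E _ _ _ _ _ => //.
- by move=> n; apply/measurable_EFinP; exact: ms.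
- have mF' : measurable_fun (`[0, K%:R[ : set (measurableTypeR R)) (fun h => (F h)%:E).
    by apply/measurable_EFinP; exact: measurable_funTS.
  exact: (measurable_restrictT _ mI).1 mF'.
- apply: aeW => h _; rewrite patchE; case: ifPn; rewrite ?inE ?notin_setE/= in_itv/=.
    move=> hK; under eq_fun do rewrite sE hK.
    apply: cvg_EFin_seq; apply: continuous_cvg; first exact: cF.
    by apply: cvg_gfloor; case/andP: hK.
  move=> /negP/negbTE hK; under eq_fun do rewrite sE hK; exact: cvg_cst.
- apply: integrableZl => //.
  apply/integrableP; split; first by apply/measurable_EFinP; exact: measurable_indic.
  rewrite (eq_integral (fun x : measurableTypeR R => (\1_`[0%R, (K%:R)%R[ x : R)%:E)); last by move=> x _; rewrite gee0_abs// lee_fin.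
  apply: (@le_lt_trans _ _ (leb `[0, K%:R[)); first by rewrite integral_indic// setIT.
  rewrite lebesgue_measure_itv/=.
  by case: ifP => _; rewrite ?ltry// -EFinB ltry.
- apply: aeW => h n _; rewrite sE -EFinM lee_fin indicE.
  have -> : (h \in `[0, K%:R[%classic) = (0 <= (h : R) < K%:R).
    by apply/idP/idP; rewrite inE/= in_itv.
  case: ifPn => hK; last by rewrite normr0 mulr0.
  have /andP[h0 h1] := hK; have [/andP[g0 g1] _] := gfloor_bounds n h0.
  have /FB/andP[f0 f1] : 0 <= gfloor n (h : R) < K%:R by rewrite g0 (le_lt_trans g1 h1).
  by rewrite ger0_norm// mulr1.
Qed.

End analysis.

(** * Mean of the sum over the cells *)

Section mean_window.
Context {d : measure_display} {T : measurableType d} {R : realType}.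
Variables (P : probability T R) (lam v gamma beta : R) (X : nat -> {RV P >-> plane R})
    (Theta : nat -> {RV P >-> measurableTypeR R}).
Hypothesis net : mobile_network lam X Theta.
Hypotheses (lam_gt0 : 0 < lam) (v_gt0 : 0 < v) (beta_ge0 : 0 <= beta) (gamma_ge0 : 0 <= gamma).
Local Notation leb := (@lebesgue_measure R).
Local Notation area := (leb \x leb)%E.
Local Notation marked := (plane R * measurableTypeR R)%type.
Local Notation Z w := (fun k : nat => (X k w, Theta k w) : marked).

Lemma measurable_weight t h : measurable_fun setT (weight v gamma beta t h).
Proof.
apply: measurable_funM; last by apply: measurable_indic; exact: measurable_nearer.
apply: measurableT_comp; first exact: measurable_expR.
by apply: measurable_funB => //; apply: measurable_funM => //; exact: measurable_sqdist.
Qed.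

Lemma nearer_section_area (t h : R) (a : measurableTypeR R) : 0 <= h ->
  (\int[area]_x (\1_(nearer v t h) ((x, a) : marked) : R)%:E = (pi * h ^+ 2)%:E)%E.
Proof.
move=> h0; have := @nearer_section_integral R v t h a (fun=> 1) h0 (measurable_cst _) (fun=> ler01).
rewrite integral_cst//= lebesgue_measure_itv/= lte_fin mul1e.
have -> : (if (0 < h ^+ 2)%R then (h ^+ 2)%:E - 0 else 0)%E = (h ^+ 2)%:E.
  by case: ltP => hh; [rewrite sube0|congr EFin; apply/eqP; rewrite eq_le sqr_ge0 hh].
by rewrite -EFinM => <-; apply: eq_integral => x _; rewrite mul1r.
Qed.

Lemma weight_section_integral (t h : R) (a : measurableTypeR R) : 0 <= h ->
  (\int[area]_x (weight v gamma beta t h (x, a))%:E =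
   (pi * (expR (- gamma * h ^+ 2) * exp_primitive beta (h ^+ 2)))%:E)%E.
Proof.
move=> h0.
pose f (s : R) := expR (- gamma * h ^+ 2 - beta * s).
have mf : measurable_fun setT (f : measurableTypeR R -> R).
  apply: measurableT_comp; first exact: measurable_expR.
  apply: (@measurable_funB _ (measurableTypeR R) R setT (fun=> - gamma * h ^+ 2) (fun s => beta * s)) => //.
  exact: (@measurable_funM _ (measurableTypeR R) R setT (fun=> beta) id).
have := @nearer_section_integral R v t h a f h0 mf (fun=> expR_ge0 _).
rewrite /weight => ->; rewrite EFinM; congr (_ * _)%E.
rewrite EFinM -exp_primitive_integral ?sqr_ge0//.
have me : measurable_fun `[0%R, (h ^+ 2)%R[ (fun s : measurableTypeR R => (expR (- beta * s))%:E).
  apply/measurable_EFinP; apply: measurable_funTS.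
  apply: measurableT_comp; first exact: measurable_expR.
  exact: (@measurable_funM _ (measurableTypeR R) R setT (fun=> - beta) id).
rewrite -ge0_integralZl//.
  by apply: eq_integral => s _; rewrite -EFinM -expRD /f !mulNr.
all: try by move=> *; rewrite lee_fin expR_ge0.
Qed.

(** The mean number per unit of time and distance of max interferers at distance
    [h], each weighted by [exp (- gamma HI^2 - beta RI^2)]. *)
Definition rate_density (h : R) : R :=
  2 * v * lam ^+ 2 * pi * height_density beta (gamma + lam * pi) h.

(** The hypothesis of disjointness in [cell_formula] holds because no station of
    the cell is ever closer than the lower corner of the cell. *)
Lemma cell_mean (K N : nat) n a b :
  2 * K%:R ^+ 2 + 2 * v ^+ 2 < N%:R :> R -> (a < n.+1)%N -> (b < n.+1 * K)%N ->
  (\int[P]_w (count (cell v (grid n a) (grid n a.+1) (grid n b) (grid n b.+1)) (Z w) *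
     sole v gamma beta (grid n a) (grid n b) (Z w)) =
   (rate_density (grid n b) / n.+1%:R / n.+1%:R)%:E)%E.
Proof.
move=> KN an bK.
have g0 := @grid_ge0 R n b.
have gK : 0 <= (grid n b : R) <= K%:R.
  by rewrite grid_ge0/= grid_leK// ltnW.
have g1 : `|grid n a : R| <= 1 by rewrite ger0_norm ?grid_ge0// grid_le1// ltnW.
have gS k : grid n k.+1 - grid n k = n.+1%:R^-1 :> R.
  by rewrite /grid -mulrBl -natr1 [_ + 1]addrC addrK mul1r.
have gle k : grid n k <= grid n k.+1 :> R by rewrite -subr_ge0 gS invr_ge0.
rewrite (@cell_formula _ T R P lam X Theta net lam_gt0 (disc N%:R) _ _ _
   (pi * grid n b ^+ 2) (2 * v * (grid n a.+1 - grid n a) * (grid n b.+1 - grid n b))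
   (pi * (expR (- gamma * grid n b ^+ 2) * exp_primitive beta (grid n b ^+ 2)))).
- congr EFin; rewrite !gS /rate_density /height_density.
  have -> : expR (- ((gamma + lam * pi) * grid n b ^+ 2)) =
    expR (- gamma * grid n b ^+ 2) * expR (- (lam * (pi * grid n b ^+ 2))).
    by rewrite -expRD; congr expR; ring.
  ring.
- exact: measurable_disc.
- exact: area_disc_fin_nat.
- exact: measurable_nearer.
- exact: measurable_cell.
- exact: measurable_weight.
- by move=> z; exact: weight01.
- exact: weight_out.
- by move=> z zA; exact: (nearer_in_disc KN g1 gK zA).
- by move=> z; exact: (grid_cell_in_disc v_gt0 KN an bK).
- move=> z; rewrite /nearer /= => zn [_ /andP[zc _]].
  move: zn; apply/negP; rewrite -leNgt sqdist_arrival//.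
  apply: (@le_trans _ _ (`|across z| ^+ 2)); first by rewrite ler_sqr ?nnegrE.
  by rewrite real_normK ?num_real// lerDr sqr_ge0.
- by move=> t; exact: nearer_section_area.
- by move=> t; exact: cell_section_area.
- by move=> t; exact: weight_section_integral.
Qed.

Lemma measurable_sole t h : measurable_fun setT (fun w => sole v gamma beta t h (Z w)).
Proof.
apply: measurable_sole_sum.
- exact: measurable_nearer.
- exact: measurable_weight.
- by move=> z; case/andP: (weight01 v beta_ge0 gamma_ge0 t h z).
Qed.

Lemma sole_ge0 t h z : (0 <= sole v gamma beta t h z)%E.
Proof.
by apply: sole_sum_ge0 => y; case/andP: (weight01 v beta_ge0 gamma_ge0 t h y).
Qed.

Lemma measurable_grid_total K n : measurable_fun setT (fun w => grid_total v gamma beta K n (Z w)).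
Proof.
apply: emeasurable_sum => a; apply: emeasurable_sum => b; apply: emeasurable_funM.
  by apply: measurable_count_marks; exact: measurable_cell.
exact: measurable_sole.
Qed.

(** The set of closer stations depends on the outcome through station [i], so
    measurability is that of a relation between two marked points. *)
Lemma measurable_sole_at i : measurable_fun setT
  (fun w => sole v gamma beta (arrival v (Z w i)) `|across (Z w i)| (Z w)).
Proof.
pose B : set (marked * marked) := [set y | nearer v (arrival v y.1) `|across y.1| y.2].
have mar : measurable_fun setT (fun y : marked * marked => arrival v y.1).
  exact: (measurableT_comp (measurable_arrival v) (@measurable_fst _ _ _ _)).
have mac : measurable_fun setT (fun y : marked * marked => `|across y.1|).
  apply: measurableT_comp => //.
  exact: (measurableT_comp measurable_across (@measurable_fst _ _ _ _)).
have msq := measurable_sqdist_at_arrival v.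
have mB : measurable B.
  rewrite (_ : B = [set y | 0 < `|across y.1| ^+ 2 - sqdist v y.2 (arrival v y.1)]).
    by apply: measurable_pos_set; apply: measurable_funB => //; by apply: measurable_funX.
  by apply/seteqP; split => y /=; rewrite /nearer/= subr_gt0.
have mG j : measurable_fun setT (fun w => (Z w i, Z w j)).
  by do 2 apply: measurable_fun_pair => //.
apply: (@ge0_emeasurable_sum _ _ _ setT (fun j w => (sole_term (nearer v (arrival v (Z w i)) `|across (Z w i)|)
   (weight v gamma beta (arrival v (Z w i)) `|across (Z w i)|) (Z w) j)%:E) xpredT).
  move=> k w _ _; rewrite lee_fin mulr_ge0//.
  by case/andP: (weight01 v beta_ge0 gamma_ge0 (arrival v (Z w i)) `|across (Z w i)| (Z w k)).
move=> j _; apply/measurable_EFinP; apply: measurable_funM.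
  pose f (y : marked * marked) := weight v gamma beta (arrival v y.1) `|across y.1| y.2.
  have mf : measurable_fun setT f.
    apply: measurable_funM.
      apply: measurableT_comp; first exact: measurable_expR.
      apply: measurable_funB; apply: measurable_funM => //.
      by apply: measurable_funX.
    rewrite (_ : (fun y => _) = \1_B); first exact: measurable_indic.
    by apply/funext => y; rewrite !indicE; congr ((_ : bool)%:R); apply/idP/idP => /set_mem ?; exact: mem_set.
  exact: (measurableT_comp mf (mG j)).
pose E := [set w | alone (nearer v (arrival v (Z w i)) `|across (Z w i)|) (Z w) j].
rewrite (_ : (fun w => _) = \1_E).
  apply: measurable_indic.
  rewrite (_ : E = \bigcap_(k in [set k | k != j]) ~` ((fun w => (Z w i, Z w k)) @^-1` B)).
    apply: bigcap_measurable; first by exists j.+1 => //=; rewrite gtn_eqF.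
    move=> k _; apply: measurableC; rewrite -[X in measurable X]setTI; exact: mG.
  by apply/seteqP; split => w /=.
by apply/funext => w; rewrite indicE; case: asboolP => h; [rewrite mem_set|rewrite memNset].
Qed.

Lemma window_term_measurable (C : set marked) i : measurable C ->
  measurable_fun setT (fun w => ((\1_C (Z w i) : R)%:E *
    sole v gamma beta (arrival v (Z w i)) `|across (Z w i)| (Z w))%E).
Proof.
move=> mC; apply: emeasurable_funM; last exact: measurable_sole_at.
by apply/measurable_EFinP; apply: measurable_mark; exact: measurable_indic.
Qed.

Lemma measurable_window_total K :
  measurable_fun setT (fun w => window_total v gamma beta K (Z w)).
Proof.
apply: (@ge0_emeasurable_sum _ _ _ setT (fun i w => ((\1_(window v K) (Z w i) : R)%:E *
    sole v gamma beta (arrival v (Z w i)) `|across (Z w i)| (Z w))%E) xpredT).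
  by move=> k w _ _; rewrite mule_ge0 ?lee_fin// sole_ge0.
by move=> i _; apply: window_term_measurable; exact: measurable_cell.
Qed.

(** The sums over the cells converge to the window sum, dominated by the number of
    stations in the window; their means are Riemann sums of [rate_density]. *)
Lemma mean_window_total (K : nat) :
  (\int[P]_w window_total v gamma beta K (Z w) =
   \int[leb]_(h in `[0%R, K%:R[) (rate_density h)%:E)%E.
Proof.
have [N KN] : exists N : nat, 2 * K%:R ^+ 2 + 2 * v ^+ 2 < N%:R :> R.
  exists (Num.bound (2 * K%:R ^+ 2 + 2 * v ^+ 2 : R)).
  by apply: (@archi_boundP R); rewrite addr_ge0// mulr_ge0// sqr_ge0.
have Egrid n : (\int[P]_w grid_total v gamma beta K n (Z w) =
    (\sum_(0 <= b < n.+1 * K) rate_density (grid n b) / n.+1%:R)%:E)%E.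
  have c0 (C : set marked) w : (0 <= count C (Z w) :> \bar R)%E.
    by apply: nneseries_ge0 => k _ _; rewrite lee_fin.
  have mterm a b : measurable_fun setT (fun w =>
     (count (cell v (grid n a) (grid n a.+1) (grid n b) (grid n b.+1)) (Z w) *
     sole v gamma beta (grid n a) (grid n b) (Z w))%E).
    apply: emeasurable_funM; last exact: measurable_sole.
    by apply: measurable_count_marks; exact: measurable_cell.
  rewrite /grid_total ge0_integral_sum//; last 2 first.
  - by move=> a; apply: emeasurable_sum => b; exact: mterm.
  - by move=> a w _; apply: sume_ge0 => b _; rewrite mule_ge0// sole_ge0.
  transitivity (\sum_(0 <= a < n.+1) (\sum_(0 <= b < n.+1 * K) rate_density (grid n b) / n.+1%:R / n.+1%:R)%:E)%E.
    rewrite big_nat [RHS]big_nat; apply: eq_bigr => a /andP[_ an].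
    rewrite ge0_integral_sum//; last by move=> b w _; rewrite mule_ge0// sole_ge0.
    rewrite -sumEFin big_nat [RHS]big_nat; apply: eq_bigr => b /andP[_ bn].
    exact: cell_mean KN an bn.
  rewrite sumEFin; congr EFin; rewrite sumr_const_nat subn0 -mulr_suml.
  by rewrite -mulrnAr -[X in _ * X]mulr_natr mulVf ?mulr1.
have lim1 : (fun n => \int[P]_w grid_total v gamma beta K n (Z w))%E @ \oo -->
    (\int[leb]_(h in `[0%R, K%:R[) (rate_density h)%:E)%E.
  under eq_fun do rewrite Egrid.
  apply: (@riemann_sum R K rate_density (2 * v * lam ^+ 2 * pi * K%:R ^+ 2)).
    move=> x; apply: cvgM; first exact: cvg_cst.
    exact: continuous_height_density.
  move=> h /andP[h0 hK].
  have k0 : 0 <= 2 * v * lam ^+ 2 * pi.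
    by rewrite !mulr_ge0 ?sqr_ge0 ?pi_ge0// ltW.
  rewrite /rate_density mulr_ge0 ?height_density_ge0//= ler_wpM2l//.
  have /andP[p0 p1] := exp_primitive_bounds beta_ge0 (sqr_ge0 h).
  have a0 : 0 <= (gamma + lam * pi) * h ^+ 2.
    by rewrite mulr_ge0 ?sqr_ge0// addr_ge0// mulr_ge0 ?pi_ge0// ltW.
  rewrite /height_density (@le_trans _ _ (h ^+ 2))//.
    rewrite -[leRHS]mulr1 ler_pM ?expR_ge0//.
    by rewrite -expR0 ler_expR oppr_le0.
  by rewrite ler_sqr ?nnegrE// ltW.
have [C0 iC] : exists c : R, forall t, (\int[area]_x (\1_(window v K) ((x, t) : marked) : R)%:E = c%:E)%E.
  by eexists => t; apply: cell_section_area => //; exact: ler0n.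
have intW : P.-integrable setT (fun w => count (window v K) (Z w) : \bar R).
  apply/integrableP; split; first by apply: measurable_count_marks; exact: measurable_cell.
  rewrite (eq_integral (fun w => count (window v K) (Z w))).
    apply: (@le_lt_trans _ _ (lam * C0)%:E); last exact: ltry.
    apply: (mean_count_le net lam_gt0 (measurable_disc N%:R) (area_disc_fin_nat N)) => //.
      exact: measurable_cell.
    by move=> z; exact: window_in_disc.
  by move=> w _; rewrite gee0_abs// nneseries_ge0// => k _ _; rewrite lee_fin.
have ae := ae_generic net lam_gt0 v_gt0.
have [] := @dominated_convergence _ T R P setT measurableT (fun n w => grid_total v gamma beta K n (Z w))
   (fun w => window_total v gamma beta K (Z w)) (fun w => count (window v K) (Z w)) _ _ _ intW _.
- by move=> n; exact: measurable_grid_total.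
- exact: measurable_window_total.
- apply: filterS ae => w gw _; have [fin _] := gw; have [M zM] := fin N.
  exact: (grid_total_cvg v_gt0 beta_ge0 gamma_ge0 KN gw zM).
- apply: filterS ae => w gw n _; have [fin _] := gw; have [M zM] := fin N.
  rewrite gee0_abs; first exact: (grid_total_le v_gt0 beta_ge0 gamma_ge0 KN zM).
  rewrite (grid_totalE v_gt0 beta_ge0 gamma_ge0 KN zM) lee_fin sumr_ge0// => i _.
  rewrite mulr_ge0//.
  by case/andP: (fsole01 v beta_ge0 gamma_ge0 (Z w) M
    (gfloor n (arrival v (Z w i))) (gfloor n `|across (Z w i)|)).
move=> _ _ lim2.
exact: (cvg_unique (@ereal_hausdorff _) lim2 lim1).
Qed.
End mean_window.

(** * Mean of the sum over all stations *)

Section mean_total.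
Context {d : measure_display} {T : measurableType d} {R : realType}.
Variables (P : probability T R) (lam v gamma beta : R) (X : nat -> {RV P >-> plane R})
    (Theta : nat -> {RV P >-> measurableTypeR R}).
Hypothesis net : mobile_network lam X Theta.
Hypotheses (lam_gt0 : 0 < lam) (v_gt0 : 0 < v) (beta_ge0 : 0 <= beta) (gamma_ge0 : 0 <= gamma).
Local Notation leb := (@lebesgue_measure R).
Local Notation marked := (plane R * measurableTypeR R)%type.
Local Notation Z w := (fun k : nat => (X k w, Theta k w) : marked).

Definition strip : set marked := [set z | 0 <= arrival v z < 1].

Definition station_total (z : nat -> marked) : \bar R :=
  (\sum_(i <oo) (\1_strip (z i) : R)%:E * sole v gamma beta (arrival v (z i)) `|across (z i)| z)%E.

Lemma window_strip K z : window v K z <-> strip z /\ `|across z| < K%:R.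
Proof.
rewrite /window /cell /strip /=; split => [[h1 /andP[_ h2]]|[h1 h2]]; first by [].
by split => //; rewrite normr_ge0.
Qed.

Lemma indic_le (A B : set marked) z : A `<=` B -> (\1_A z : R) <= \1_B z.
Proof.
move=> AB; rewrite !indicE; case: (boolP (z \in A)) => [/set_mem/AB zB|_]; last by rewrite ler0n.
by rewrite (mem_set zB).
Qed.

Lemma window_total_nd z : {homo (fun K => window_total v gamma beta K z) : n m / (n <= m)%N >-> (n <= m)%E}.
Proof.
move=> n m nm; apply: lee_nneseries => [k _ _|k _].
  by rewrite mule_ge0 ?lee_fin// sole_ge0.
rewrite lee_wpmul2r ?sole_ge0// lee_fin; apply: indic_le => y /window_strip[h1 h2].
by apply/window_strip; split=> //; rewrite (lt_le_trans h2)// ler_nat.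
Qed.

(** Any finite number of stations lies below some height [K], so each partial sum over
    stations is eventually reached by the window sums. *)
Lemma window_total_cvg z : (fun K => window_total v gamma beta K z) @ \oo --> station_total z.
Proof.
have nd := @window_total_nd z.
suff -> : station_total z = ereal_sup (range (fun K => window_total v gamma beta K z)).
  exact: ereal_nondecreasing_cvgn.
apply/eqP; rewrite eq_le; apply/andP; split.
  apply: lime_le.
    by apply: is_cvg_nneseries => k _ _; rewrite mule_ge0 ?lee_fin// sole_ge0.
  apply: nearW => M.
  have [K hK] : exists K : nat, forall i, (i < M)%N -> `|across (z i)| < K%:R.
    elim: M => [|M [K hK]]; first by exists 0.
    exists (maxn K (Num.bound `|across (z M)|)) => i; rewrite ltnS leq_eqVlt => /orP[/eqP->|iM].
      apply: lt_le_trans (archi_boundP (normr_ge0 _)) _.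
      by rewrite ler_nat leq_maxr.
    by apply: lt_le_trans (hK _ iM) _; rewrite ler_nat leq_maxl.
  apply: (@le_trans _ _ (window_total v gamma beta K z)); last first.
    by apply: ereal_sup_ubound; exists K.
  apply: le_trans (nneseries_lim_ge M _); last first.
    by move=> k _ _; rewrite mule_ge0 ?lee_fin// sole_ge0.
  rewrite big_nat [leRHS]big_nat; apply: lee_sum => i /andP[_ iM].
  rewrite lee_wpmul2r ?sole_ge0// lee_fin !indicE.
  case: (boolP (z i \in strip)) => [/set_mem h|_]; last by rewrite ler0n.
  by rewrite mem_set//; apply/window_strip; split=> //; exact: hK.
apply: ge_ereal_sup => _ [K _ <-]; apply: lee_nneseries => [k _ _|k _].
  by rewrite mule_ge0 ?lee_fin// sole_ge0.
rewrite lee_wpmul2r ?sole_ge0// lee_fin; apply: indic_le => y /window_strip[] //.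
Qed.

Lemma mean_total : (\int[P]_w station_total (Z w) =
  (2 * v * lam ^+ 2 * pi * gauss_gap (gamma + lam * pi) (gamma + lam * pi + beta))%:E)%E.
Proof.
have a0 : 0 < gamma + lam * pi by rewrite ltr_wpDl// mulr_gt0// pi_gt0.
have c0 : 0 <= 2 * v * lam ^+ 2 * pi.
  by rewrite !mulr_ge0 ?sqr_ge0 ?pi_ge0// ltW.
have mr : measurable_fun setT (rate_density lam v gamma beta : measurableTypeR R -> R).
  by apply: measurable_funM => //; exact: measurable_height_density.
have r0 h : 0 <= rate_density lam v gamma beta h.
  by rewrite /rate_density mulr_ge0// height_density_ge0.
have lim1 := @ge0_cvgn_integral R leb (rate_density lam v gamma beta) r0 mr.
have lim2 : (fun K => \int[P]_w window_total v gamma beta K (Z w))%E @ \oo -->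
    (\int[P]_w station_total (Z w))%E.
  have := @cvg_monotone_convergence _ T R P setT measurableT
     (fun K w => window_total v gamma beta K (Z w)) _ _ _.
  rewrite (_ : (fun w => limn _) = fun w => station_total (Z w)); last first.
    by apply/funext => w; apply/cvg_lim => //; exact: window_total_cvg.
  apply.
  - by move=> K; exact: measurable_window_total.
  - move=> K w _; apply: nneseries_ge0 => k _ _.
    by rewrite mule_ge0 ?lee_fin// sole_ge0.
  - by move=> w _; exact: window_total_nd.
have E K : (\int[P]_w window_total v gamma beta K (Z w) =
   \int[leb]_(h in `[0%R, K%:R]) (rate_density lam v gamma beta h)%:E)%E.
  rewrite (mean_window_total net lam_gt0 v_gt0 beta_ge0 gamma_ge0).
  by apply: integral_itv_bndo_bndc; apply/measurable_EFinP; exact: measurable_funTS.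
have lim3 : (fun K => \int[P]_w window_total v gamma beta K (Z w))%E @ \oo -->
    (\int[leb]_(h in `[0%R, +oo[) (rate_density lam v gamma beta h)%:E)%E.
  by under eq_fun do rewrite E.
rewrite (cvg_unique (@ereal_hausdorff _) lim2 lim3).
transitivity ((2 * v * lam ^+ 2 * pi)%:E * \int[leb]_(h in `[0%R, +oo[) (height_density beta (gamma + lam * pi) h)%:E)%E.
  rewrite -ge0_integralZl//.
  - by apply/measurable_EFinP; apply: measurable_funTS; exact: measurable_height_density.
  - by move=> h _; rewrite lee_fin height_density_ge0.
by rewrite integral_height_density// -EFinM.
Qed.
End mean_total.

(** * Integrals of nonnegative functions that may fail to be measurable *)

Section ae_nonmeasurable.
Import HBNNSimple.
Context {d : measure_display} {T : measurableType d} {R : realType}.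
Variable mu : {measure set T -> \bar R}.
Local Open Scope ereal_scope.

(** The integral of a nonnegative function is a supremum over the simple functions
    below it. *)
Lemma integral_le_nonmeasurable (F G : T -> \bar R) : (forall x, 0 <= F x) ->
  (forall x, F x <= G x) -> \int[mu]_x F x <= \int[mu]_x G x.
Proof.
move=> F0 FG; have G0 x : 0 <= G x by exact: le_trans (FG x).
rewrite !ge0_integralTE//; apply: le_ereal_sup => _ [h hF <-].
by exists h => // x; exact: le_trans (FG x).
Qed.

(** A simple function below [F] is almost everywhere below [G], and [G] cut off on the
    exceptional null set is everywhere below [F]; [G] keeps its integral when it is cut off. *)
Lemma ae_eq_integral_nonmeasurable (F G : T -> \bar R) : (forall x, 0 <= F x) ->
  (forall x, 0 <= G x) -> measurable_fun setT G -> {ae mu, forall x, F x = G x} ->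
  \int[mu]_x F x = \int[mu]_x G x.
Proof.
move=> F0 G0 mG [N [mN N0 FGN]]; apply/eqP; rewrite eq_le; apply/andP; split.
  rewrite ge0_integralTE//; apply: ge_ereal_sup => _ [h hF <-].
  have -> : sintegral mu h = \int[mu]_x (h x)%:E by rewrite integralT_nnsfun.
  apply: ae_ge0_le_integral => //.
  - by move=> x _; rewrite lee_fin.
  - by apply/measurable_EFinP.
  - exists N; split=> // x /= xN; apply: FGN => /= FG; apply: xN => _.
    by rewrite -FG; exact: hF.
have mNG : measurable_fun setT (fun x => if x \in N then 0 else G x).
  apply: measurable_fun_ifT => //.
  apply: (measurable_fun_bool true); rewrite setTI (_ : _ @^-1` _ = N)//.
  by apply/seteqP; split => x /=; [exact: set_mem|exact: mem_set].
have -> : \int[mu]_x G x = \int[mu]_x (if x \in N then 0 else G x).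
  apply: ge0_ae_eq_integral => //.
    by move=> x _; case: (x \in N).
  exists N; split=> // x /= xN; apply: contrapT => nN; apply: xN => _.
  by rewrite memNset.
apply: integral_le_nonmeasurable => x; case: (boolP (x \in N)) => //= xN.
have -> // : F x = G x.
by apply: contrapT => FG; move/negP: xN; apply; apply: mem_set; exact: FGN.
Qed.
End ae_nonmeasurable.

(** * From times to stations *)

Section identification.
Context {R : realType}.
Local Notation marked := (plane R * measurableTypeR R)%type.
Variables (v gamma beta : R) (z : nat -> marked).
Hypotheses (v_gt0 : 0 < v) (beta_ge0 : 0 <= beta) (gamma_ge0 : 0 <= gamma) (gz : generic v z).
Local Notation x := (fun i => (z i).1).
Local Notation th := (fun i => (z i).2 : R).

Lemma sqdist_ge0 (y : marked) t : 0 <= sqdist v y t.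
Proof. by rewrite addr_ge0// sqr_ge0. Qed.

Lemma bs_mintimeE i : bs_mintime v x th i = arrival v (z i).
Proof.
have mono t u : (bs_dist v x th i t <= bs_dist v x th i u) = (sqdist v (z i) t <= sqdist v (z i) u).
  by rewrite /bs_dist ler_sqrt// sqdist_ge0.
apply: xget_unique => [u|y /(_ (arrival v (z i)))].
  by rewrite mono !sqdist_arrival// lerD2r subrr mulr0 expr0n/= sqr_ge0.
rewrite mono !sqdist_arrival// lerD2r subrr mulr0 expr0n/= => h.
have /eqP : (v * (y - arrival v (z i))) ^+ 2 = 0 by apply/eqP; rewrite eq_le h sqr_ge0.
by rewrite sqrf_eq0 mulf_eq0 gt_eqF//= subr_eq0 => /eqP.
Qed.

Lemma sqdist_at_arrival i : sqdist v (z i) (arrival v (z i)) = across (z i) ^+ 2.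
Proof. by rewrite sqdist_arrival// subrr mulr0 expr0n/= add0r. Qed.

Lemma bs_mindistE i : bs_mindist v x th i = `|across (z i)|.
Proof.
by rewrite /bs_mindist bs_mintimeE -sqrtr_sqr -sqdist_at_arrival.
Qed.

Definition server (t h : R) (j : nat) : Prop := nearer v t h (z j) /\ alone (nearer v t h) z j.

Lemma closerE i k s : (bs_dist v x th k s < bs_mindist v x th i) = (sqdist v (z k) s < `|across (z i)| ^+ 2).
Proof.
by rewrite bs_mindistE -ltr_sqr ?nnegrE// ?sqrtr_ge0// sqr_sqrtr ?sqdist_ge0.
Qed.

Lemma max_interferenceE i j s : max_interference v x th i j s <->
  s = arrival v (z i) /\ server s `|across (z i)| j.
Proof.
rewrite /max_interference bs_mintimeE /unique /server /alone /nearer /= closerE.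
split => -[-> [h1 h2]]; do 2 split => //.
  by move=> k kj h; move/eqP: kj; apply; symmetry; apply: h2; rewrite closerE.
move=> k; rewrite closerE => h; apply: contrapT => jk.
by apply: (h2 k) => //; apply/eqP => e; apply: jk.
Qed.

(** If two interferers reach their minima together, the nearer one would be the
    server of the other, while having itself a strictly closer server; so they are
    at the same distance, which is a tie. *)
Lemma interferer_unique i j i' j' s : max_interference v x th i j s ->
  max_interference v x th i' j' s -> i = i'.
Proof.
have lem a b p q : max_interference v x th a b s -> max_interference v x th p q s ->
    ~ (across (z p) ^+ 2 < across (z a) ^+ 2).
  move=> /max_interferenceE[sa [_ al]] /max_interferenceE[sp [nq _]] lt.
  move: nq al; rewrite /alone /nearer /= !real_normK ?num_real// => nq al.
  have pb : p = b.
    apply: contrapT => pb; apply: (al p); first exact/eqP.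
    by rewrite sp sqdist_at_arrival.
  have qb : q = b.
    apply: contrapT => qb; apply: (al q); first exact/eqP.
    exact: lt_trans lt.
  move: nq; rewrite qb -pb sp sqdist_at_arrival => nq.
  by move: nq; rewrite ltxx.
move=> m m'; apply: contrapT => ii.
have [_ [_ noties]] := gz.
apply: (noties i i'); first exact/eqP.
have /max_interferenceE[si _] := m.
have /max_interferenceE[si' _] := m'.
rewrite /tie -si si' sqdist_at_arrival.
apply/eqP; rewrite eq_le !leNgt; apply/andP; split; apply/negP; first exact: lem m' m.
exact: lem m m'.
Qed.

Lemma server_unique t h j j' : server t h j -> server t h j' -> j = j'.
Proof.
by move=> [n1 _] [_ a2]; apply: contrapT => jj; apply: (a2 j) => //; exact/eqP.
Qed.

Lemma interferer_distE i j s : max_interference v x th i j s ->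
  interferer_dist v x th s = `|across (z i)|.
Proof.
move=> m; apply: xget_unique => [|y [i' [j' [m' ->]]]].
  by exists i, j; rewrite bs_mindistE.
by rewrite bs_mindistE (interferer_unique m m').
Qed.

Lemma server_distE i j s : max_interference v x th i j s ->
  server_dist v x th s ^+ 2 = sqdist v (z j) s.
Proof.
move=> m; suff -> : server_dist v x th s = bs_dist v x th j s by rewrite sqr_sqrtr// sqdist_ge0.
apply: xget_unique => [|y [i' [j' [m' ->]]]]; first by exists i, j.
have ii := interferer_unique m m'; move: m m' => /max_interferenceE[_ s1] /max_interferenceE[_ s2].
by rewrite -ii in s2; rewrite (server_unique s1 s2).
Qed.

Lemma sole_none t h : ~ (exists j, server t h j) -> sole v gamma beta t h z = 0%E.
Proof.
move=> no; rewrite /sole /sole_sum eseries0// => j _ _; congr EFin; rewrite /sole_term.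
have [a|a] := pselect (alone (nearer v t h) z j); last by rewrite asboolF// mulr0.
rewrite weight_out ?mul0r// => n; apply: no; by exists j.
Qed.

Lemma sole_server t h j : server t h j ->
  sole v gamma beta t h z = (expR (- gamma * h ^+ 2 - beta * sqdist v (z j) t))%:E.
Proof.
move=> [n a]; rewrite /sole /sole_sum nneseries_esumT; last first.
  move=> k; rewrite lee_fin mulr_ge0//.
  by case/andP: (weight01 v beta_ge0 gamma_ge0 t h (z k)).
transitivity (\esum_(k in [set j]) (sole_term (nearer v t h) (weight v gamma beta t h) z k)%:E)%E.
  rewrite [RHS]esum_mkcond; apply: eq_esum => k _; case: ifPn => // /negP kj.
  rewrite /sole_term weight_out ?mul0r// => nk; apply: kj; apply: mem_set => /=.
  by apply: contrapT => kj; apply: (a k) => //; apply/eqP.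
rewrite esum_set1; last first.
  by rewrite lee_fin mulr_ge0//; case/andP: (weight01 v beta_ge0 gamma_ge0 t h (z j)).
by congr EFin; rewrite /sole_term asboolT// mulr1 /weight indicE mem_set// mulr1.
Qed.

(** Distinct interferers have distinct minimal times, so the sum over the atoms is
    reindexed by the interferers; the other stations contribute 0. *)
Lemma sum_over_times :
  (\esum_(s in max_interference_times v x th `&` `[0%R, 1%R])
     (expR (- gamma * interferer_dist v x th s ^+ 2 - beta * server_dist v x th s ^+ 2))%:E
   = station_total v gamma beta z)%E.
Proof.
pose I := [set i | strip v (z i) /\ exists j, server (arrival v (z i)) `|across (z i)| j].
have [_ [narr _]] := gz.
have -> : max_interference_times v x th `&` `[0%R, 1%R] = (fun i => arrival v (z i)) @` I.
  apply/seteqP; split => [s [[i [j /max_interferenceE[-> sj]]]]|_ [i [str [j sj]] <-]].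
    rewrite /= in_itv/= => /andP[s0 s1]; exists i => //; split; last by exists j.
    by rewrite /strip/= s0 lt_neqAle s1 andbT; apply/eqP; exact: narr.
  split; first by exists i, j; apply/max_interferenceE.
  by move: str; rewrite /strip/= in_itv/= => /andP[-> /ltW ->].
rewrite esum_image; last first.
  move=> i i' /set_mem[_ [j sj]] /set_mem[_ [j' sj']] e.
  by apply: (@interferer_unique i j i' j' (arrival v (z i))); apply/max_interferenceE => //; rewrite e.
rewrite /station_total nneseries_esumT; last by move=> i; rewrite mule_ge0 ?lee_fin// sole_ge0.
rewrite esum_mkcond; apply: eq_esum => i _; case: ifPn => [/set_mem[str [j sj]]|/negP nI].
  rewrite indicE mem_set// mul1e (sole_server sj).
  have m : max_interference v x th i j (arrival v (z i)) by apply/max_interferenceE.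
  by rewrite (interferer_distE m) (server_distE m).
rewrite indicE; case: (boolP (z i \in strip v)) => [/set_mem str|_]; last by rewrite mul0e.
rewrite mul1e sole_none// => -[j sj]; apply: nI; apply: mem_set; split => //; by exists j.
Qed.
End identification.

(** * The Palm expectation *)

Section final.
Context {d : measure_display} {T : measurableType d} {R : realType}.
Variables (P : probability T R) (lam v : R) (X : nat -> {RV P >-> plane R})
    (Theta : nat -> {RV P >-> measurableTypeR R}).
Hypothesis net : mobile_network lam X Theta.
Hypotheses (lam_gt0 : 0 < lam) (v_gt0 : 0 < v).
Local Notation marked := (plane R * measurableTypeR R)%type.
Local Notation Z w := (fun k : nat => (X k w, Theta k w) : marked).

Lemma mean_over_VI (beta gamma : R) : 0 <= beta -> 0 <= gamma ->
  (\int[P]_w (\esum_(s in VI v X Theta w `&` `[0%R, 1%R])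
     (expR (- gamma * HI v X Theta w s ^+ 2 - beta * RI v X Theta w s ^+ 2))%:E) =
  (2 * v * lam ^+ 2 * pi * gauss_gap (gamma + lam * pi) (gamma + lam * pi + beta))%:E)%E.
Proof.
move=> b0 g0; rewrite -(mean_total net lam_gt0 v_gt0 b0 g0).
apply: ae_eq_integral_nonmeasurable.
- by move=> w; apply: esum_ge0 => s _; rewrite lee_fin expR_ge0.
- by move=> w; apply: nneseries_ge0 => k _ _; rewrite mule_ge0 ?lee_fin// sole_ge0.
- apply: (@ge0_emeasurable_sum _ _ _ setT (fun i w => ((\1_(strip v) (Z w i) : R)%:E *
    sole v gamma beta (arrival v (Z w i)) `|across (Z w i)| (Z w))%E) xpredT).
    by move=> k w _ _; rewrite mule_ge0 ?lee_fin// sole_ge0.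
  move=> i _; apply: window_term_measurable => //.
  rewrite -[strip v]setTI; exact: (measurable_arrival v measurableT (measurable_itv `[0, 1[)).
- apply: filterS (ae_generic net lam_gt0 v_gt0) => w gw.
  exact: (@sum_over_times R v gamma beta (Z w) v_gt0 b0 g0 gw).
Qed.

Lemma intensityE :
  intensity P (VI v X Theta) = (2 * v * lam ^+ 2 * pi * gauss_gap (lam * pi) (lam * pi))%:E.
Proof.
have := mean_over_VI (lexx 0) (lexx 0); rewrite add0r addr0 => <-.
apply: eq_integral => w _; apply: eq_esum => s _.
by rewrite oppr0 !mul0r subrr expR0.
Qed.

Definition palm_value (gamma beta : R) : R :=
  gauss_gap (gamma + lam * pi) (gamma + lam * pi + beta) / gauss_gap (lam * pi) (lam * pi).

Lemma gauss_gap_gt0 a b : 0 < a -> 0 < b -> 0 < gauss_gap a b :> R.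
Proof.
move=> a0 b0; rewrite /gauss_gap divr_gt0// ?divr_gt0 ?sqrtr_gt0 ?pi_gt0//.
by rewrite !mulr_gt0 ?addr_gt0 ?sqrtr_gt0.
Qed.

Lemma palm_laplaceE (beta gamma : R) : 0 <= beta -> 0 <= gamma ->
  palm_expectation P (VI v X Theta) (fun w s =>
    expR (- gamma * HI v X Theta w s ^+ 2 - beta * RI v X Theta w s ^+ 2)) =
  (palm_value gamma beta)%:E.
Proof.
move=> b0 g0; rewrite /palm_expectation intensityE mean_over_VI//.
have L0 : 0 < lam * pi by rewrite mulr_gt0// pi_gt0.
have c0 : 0 < 2 * v * lam ^+ 2 * pi by rewrite !mulr_gt0// ?exprn_gt0// pi_gt0.
have j0 := gauss_gap_gt0 L0 L0.
have n0 := mulr_gt0 c0 j0; rewrite inver (gt_eqF n0) -[LHS]EFinM; congr EFin.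
rewrite /palm_value; move: (2 * v * lam ^+ 2 * pi) (gauss_gap (lam * pi) (lam * pi)) c0 j0 {n0} => c j c0 j0.
by field; rewrite (gt_eqF j0) (gt_eqF c0).
Qed.

(** With [s, p, q] the square roots of [lam * pi], [gamma + lam * pi] and
    [gamma + lam * pi + beta], one has [beta = q^2 - p^2] and both sides equal
    [2 s^3 / (p q (p + q))]. *)
Lemma laplace_HRE (gamma beta : R) : 0 <= gamma -> 0 < beta ->
  laplace_HR lam gamma beta = palm_value gamma beta.
Proof.
move=> g0 b0; have L0 : 0 < lam * pi by rewrite mulr_gt0// pi_gt0.
have h (x : R) : 0 <= x -> (1 + x / (lam * pi)) `^ (- 2^-1) =
    Num.sqrt (lam * pi) / Num.sqrt (x + lam * pi).
  move=> x0; have -> : 1 + x / (lam * pi) = (x + lam * pi) / (lam * pi).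
    by rewrite [RHS]mulrDl divff ?gt_eqF// addrC.
  have xL : 0 < x + lam * pi by rewrite ltr_wpDl.
  rewrite powRN powR12_sqrt; last by rewrite divr_ge0// ltW.
  by rewrite sqrtrM ?(ltW xL)// sqrtrV ?(ltW L0)// invfM invrK mulrC.
rewrite /laplace_HR !h// ?addr_ge0// ?(ltW b0)//.
rewrite /palm_value /gauss_gap.
have e : (gamma + beta) + lam * pi = gamma + lam * pi + beta by ring.
rewrite e.
have a0 : 0 < gamma + lam * pi by rewrite ltr_wpDl.
have c0 : 0 < gamma + lam * pi + beta by rewrite addr_gt0.
have s0 : 0 < Num.sqrt (lam * pi) by rewrite sqrtr_gt0.
have p0 : 0 < Num.sqrt (gamma + lam * pi) by rewrite sqrtr_gt0.
have q0 : 0 < Num.sqrt (gamma + lam * pi + beta) by rewrite sqrtr_gt0.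
have pi0 : 0 < Num.sqrt (pi : R) by rewrite sqrtr_gt0 pi_gt0.
have es : lam * pi = Num.sqrt (lam * pi) ^+ 2 by rewrite sqr_sqrtr// ltW.
have eb : beta = Num.sqrt (gamma + lam * pi + beta) ^+ 2 - Num.sqrt (gamma + lam * pi) ^+ 2.
  by rewrite !sqr_sqrtr ?(ltW a0) ?(ltW c0)// addrC addKr.
have pq : Num.sqrt (gamma + lam * pi) < Num.sqrt (gamma + lam * pi + beta).
  by rewrite ltr_sqrt// ltrDl.
have -> : 2 * lam * pi / beta = 2 * Num.sqrt (lam * pi) ^+ 2 /
    (Num.sqrt (gamma + lam * pi + beta) ^+ 2 - Num.sqrt (gamma + lam * pi) ^+ 2).
  by rewrite -eb -es mulrA.
move: (Num.sqrt (lam * pi)) (Num.sqrt (gamma + lam * pi)) (Num.sqrt (gamma + lam * pi + beta))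
  (Num.sqrt pi) s0 p0 q0 pi0 pq => s p q r s0 p0 q0 r0 pq.
have d0 : q ^+ 2 - p ^+ 2 != 0 by rewrite subr_eq0 gt_eqF// ltr_sqr ?nnegrE ?ltW.
have t0 : p + q != 0 by rewrite gt_eqF// addr_gt0.
have ss : s + s != 0 by rewrite gt_eqF// addr_gt0.
field. by rewrite d0 t0 ss ?(gt_eqF s0) ?(gt_eqF p0) ?(gt_eqF q0) ?(gt_eqF r0).
Qed.

Lemma palm_value_cvg (gamma : R) : 0 <= gamma ->
  palm_value gamma b @[b --> 0^'+] --> palm_value gamma 0.
Proof.
move=> g0; have L0 : 0 < lam * pi by rewrite mulr_gt0// pi_gt0.
have a0 : 0 < gamma + lam * pi by rewrite ltr_wpDl.
apply: cvg_at_right_filter; rewrite /palm_value /gauss_gap.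
have sq : Num.sqrt (gamma + lam * pi + b) @[b --> (0:R)] --> Num.sqrt (gamma + lam * pi + 0).
  apply: (@continuous_comp _ _ _ (fun b => gamma + lam * pi + b) Num.sqrt); last exact: sqrt_continuous.
  by apply: cvgD; [exact: cvg_cst|exact: cvg_id].
apply: cvgM; last exact: cvg_cst.
apply: cvgM; first exact: cvg_cst.
apply: cvgV.
  by rewrite gt_eqF// addr0 !mulr_gt0 ?addr_gt0 ?sqrtr_gt0.
apply: cvgM; last by apply: cvgD => //; exact: cvg_cst.
by apply: cvgM => //; exact: cvg_cst.
Qed.
End final.

Theorem proposition4 (d : measure_display) (T : measurableType d)
    (R : realType) (P : probability T R) (lam v : R)
    (X : nat -> {RV P >-> plane R})
    (Theta : nat -> {RV P >-> measurableTypeR R})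
    (lam_gt0 : 0 < lam) (v_gt0 : 0 < v)
    (net : mobile_network lam X Theta)
    (beta gamma : R) (beta_ge0 : 0 <= beta) (gamma_ge0 : 0 <= gamma) :
  let palm_laplace := palm_expectation P (VI v X Theta) (fun w s =>
    expR (- gamma * HI v X Theta w s ^+ 2 - beta * RI v X Theta w s ^+ 2)) in
  (0 < beta -> palm_laplace = (laplace_HR lam gamma beta)%:E) /\
  (beta = 0 -> (laplace_HR lam gamma b)%:E @[b --> 0^'+] --> palm_laplace).
Proof.
move=> palm_laplace; rewrite /palm_laplace (palm_laplaceE net)//; split=> [b0|->].
  by rewrite laplace_HRE.
apply: (@cvg_comp _ _ _ (laplace_HR lam gamma) EFin _ (nbhs (palm_value lam gamma 0))) => //.
apply: cvg_trans (palm_value_cvg lam_gt0 gamma_ge0); apply: near_eq_cvg.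
near=> b; symmetry; apply: laplace_HRE => //.
Unshelve. all: by end_near.
Qed.
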